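(* Let $p$ be a positive integer. The Kanenobu knot $K(p,0)$ is homologically thin over $\mathbb{Q}$, and its rational Khovanov bigraded homology groups are given, for all $i,j\in\mathbb{Z}$, by \[ \mathcal{H}^{i,j}(K(p,0)) \cong \mathcal{H}^{-i,-j}(K(-p,0)). \]
   Context: Kanenobu knots. Let $D$ be the standard reduced alternating $4$-crossing diagram of the figure-eight knot $4_1$: its crossings are $a,b,c,d$; two edges join $a$ and $b$ and bound a bigon, two edges join $c$ and $d$ and bound a bigon, and there is exactly one edge joining each of the pairs $ac$, $ad$, $bc$, $bd$. Draw $D$ in the left half-plane so that its unbounded face is the triangle with vertices $a,b,c$, bounded by one of the edges $ab$, the edge $bc$ and the edge $ca$. Let $D^*$ be the mirror image of $D$ under reflection in the vertical axis (reflection of $\mathbb{R}^3$ in the plane through this axis perpendicular to the projection plane). Isotope so that each of the three outer edges $ca$, $bc$, $ab$ has a portion running next to the axis, facing its mirror image. Now (1) form the connected sum along $ca$: replace the two facing arcs of $ca$ and its mirror image by two parallel arcs crossing the axis; (2) twist the two facing arcs of $bc$ and its mirror image around each other by $p$ half twists, giving $|p|$ crossings stacked along the axis; (3) do the same for the outer edge $ab$ and its mirror image with $q$ half twists. In both twist regions the two strands are antiparallel; the twist crossings are positive crossings if the number of half twists is positive, negative crossings if it is negative. The resulting diagram, with $8+|p|+|q|$ crossings, is the standard diagram of $K(p,q)$. One has $K(0,0)\approx 4_1\#4_1$, $K(p,q)\approx K(q,p)$, the mirror image of $K(p,q)$ is $K(-p,-q)$, and the Jones polynomial of $K(p,q)$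 is $(-t)^{p+q}\bigl((t^{-2}-t^{-1}+1-t+t^2)^2-1\bigr)+1$. $\mathcal{H}^{i,j}(L)$ denotes the rational Khovanov homology of an oriented link $L$ in homological degree $i$ and quantum degree $j$, normalized so that $\sum_{i,j}(-1)^i q^j\dim\mathcal{H}^{i,j}(L)=(q^{-1}+q)V(L)|_{\sqrt{t}=-q}$, where $V$ is the Jones polynomial with $V(\text{unknot})=1$ and $t^{-1}V(L_+)-tV(L_-)=(t^{1/2}-t^{-1/2})V(L_0)$. A knot $K$ is homologically thin over $\mathbb{Q}$ if its rational Khovanov homology is supported on the two lines $j-2i=\sigma(K)\pm1$, where $\sigma(K)$ is the signature (with the sign convention making the right-handed trefoil have signature $2$). *)

(* Defs.v *)
From HB Require Import structures.
From mathcomp Require Import all_boot all_order all_algebra all_field.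

Set Implicit Arguments.
Unset Strict Implicit.
Unset Printing Implicit Defensive.

Import Order.TTheory GRing.Theory Num.Theory.
Local Open Scope ring_scope.

(** * Quotients of vector spaces *)

Section VectorQuotient.
Local Open Scope quotient_scope.
Variables (K : fieldType) (V : vectType K) (U : {vspace V}).

Definition vquot : Type := Quotient.quot (pred_of_vspace U).
HB.instance Definition _ := ZmodQuotient.on vquot.

Definition vquot_scale (a : K) : vquot -> vquot := lift_op1 vquot ( *:%R a).

Lemma vquot_scale_pi a : {morph \pi_vquot : v / a *: v >-> vquot_scale a v}.
Proof.
move=> v; unlock vquot_scale; apply/eqP.
by rewrite -Quotient.idealrBE -scalerBr memvZ // Quotient.idealrBE reprK.
Qed.

Fact vquot_scaleA a b x :
  vquot_scale a (vquot_scale b x) = vquot_scale (a * b) x.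
Proof. by elim/quotW: x => v; rewrite -!vquot_scale_pi scalerA. Qed.

Fact vquot_scale1 : left_id 1 vquot_scale.
Proof. by elim/quotW=> v; rewrite -vquot_scale_pi scale1r. Qed.

Fact vquot_scaleDr : right_distributive vquot_scale +%R.
Proof.
move=> a; elim/quotW=> v; elim/quotW=> w.
by rewrite -raddfD -!vquot_scale_pi -raddfD scalerDr.
Qed.

Fact vquot_scaleDl x : {morph vquot_scale^~ x : a b / a + b}.
Proof.
by elim/quotW: x => v a b; rewrite -!vquot_scale_pi scalerDl raddfD.
Qed.

HB.instance Definition _ := GRing.Zmodule_isLmodule.Build K vquot
  vquot_scaleA vquot_scale1 vquot_scaleDr vquot_scaleDl.

End VectorQuotient.

Definition isomorphic (K : fieldType) (V W : lmodType K) : Prop :=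
  exists f : {linear V -> W}, bijective f.

(** * Oriented link diagrams *)

(** A planar diagram code.  The four edges at a crossing are listed
    counterclockwise, [arc0] and [arc2] being the two ends of the under-strand.
    The under-strand runs from [arc0] to [arc2] if [under_fwd] and from [arc2]
    to [arc0] otherwise; the over-strand runs from [arc1] to [arc3] if
    [over_fwd] and from [arc3] to [arc1] otherwise. *)
Record crossing (E : Type) := Crossing {
  arc0 : E; arc1 : E; arc2 : E; arc3 : E;
  under_fwd : bool; over_fwd : bool }.

Section Crossing.
Variables (E : Type) (x : crossing E).

Definition under_in := if under_fwd x then arc0 x else arc2 x.
Definition under_out := if under_fwd x then arc2 x else arc0 x.
Definition over_in := if over_fwd x then arc1 x else arc3 x.
Definition over_out := if over_fwd x then arc3 x else arc1 x.

(** Right-hand rule: the crossing is positive when, counterclockwise from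
    [under_in], one meets [over_out] first. *)
Definition positive : bool := under_fwd x != over_fwd x.

(** The pairs of edges joined by the 0-smoothing (Kauffman's A-smoothing, the
    oriented one at a positive crossing) and by the 1-smoothing. *)
Definition smoothed (b : bool) : seq (E * E) :=
  if b then [:: (arc0 x, arc3 x); (arc1 x, arc2 x)]
  else [:: (arc0 x, arc1 x); (arc2 x, arc3 x)].

End Crossing.

Record diagram := Diagram {
  edge : finType;
  crossings : seq (crossing edge) }.

Section Invariants.
Variable D : diagram.
Local Notation E := (edge D).
Local Notation X := 'I_(size (crossings D)).

Definition xing (k : X) : crossing E := tnth (in_tuple (crossings D)) k.

Definition n_pos : nat := #|[set k : X | positive (xing k)]|.
Definition n_neg : nat := #|[set k : X | ~~ positive (xing k)]|.

(** ** Rational Khovanov homology *)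

Implicit Type v : {ffun X -> bool}.

(** The circles of the smoothing [v] are the classes of [connect (adj v)]. *)
Definition adj v : rel E := fun e f =>
  [exists k : X, ((e, f) \in smoothed (xing k) (v k))
              || ((f, e) \in smoothed (xing k) (v k))].

(** An enhanced state is a smoothing with a sign on each circle; [true] stands
    for the generator v_+ = 1 of Q[X]/(X^2) and [false] for v_- = X.  The signs
    are recorded as a function on edges that is constant on circles. *)
Definition enhanced_state := {s : {ffun X -> bool} * {ffun E -> bool} |
  [forall e, forall f, adj s.1 e f ==> (s.2 e == s.2 f)]}.

Implicit Type s t : enhanced_state.

Definition marker s : {ffun X -> bool} := (val s).1.
Definition label s : {ffun E -> bool} := (val s).2.

Definition height s : nat := #|[set k | marker s k]|.

Definition circle_sign s : int :=
  (n_comp (adj (marker s)) [pred e | label s e])%:Z -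
  (n_comp (adj (marker s)) [pred e | ~~ label s e])%:Z.

Definition hom_deg s : int := (height s)%:Z - n_neg%:Z.
Definition q_deg s : int :=
  circle_sign s + (height s)%:Z + n_pos%:Z - (2 * n_neg)%:Z.

(** [t] occurs in the differential of [s] along the cube edge that changes the
    smoothing of the crossing [k] from 0 to 1.  The condition on degrees encodes
    the multiplication (v_+v_+ -> v_+, v_+v_- and v_-v_+ -> v_-, v_-v_- -> 0) when
    two circles merge, and the comultiplication
    (v_+ -> v_+ (x) v_- + v_- (x) v_+, v_- -> v_- (x) v_-) when a circle splits. *)
Definition incident k s t : bool :=
  [&& ~~ marker s k,
      [forall l, marker t l == marker s l || (l == k)],
      [forall e, ~~ [exists f, connect (adj (marker s)) e f &&
           (f \in [:: arc0 (xing k); arc1 (xing k); arc2 (xing k); arc3 (xing k)])]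
         ==> (label t e == label s e)]
    & q_deg t == q_deg s].

Definition cube_sign k s : rat := (-1) ^+ #|[set l : X | (l < k)%N && marker s l]|.

Definition chain := {ffun enhanced_state -> rat^o}.

Definition diff_fun (c : chain) : chain :=
  [ffun t => \sum_(s : enhanced_state) \sum_(k < size (crossings D) | incident k s t)
     cube_sign k s * c s].

Fact diff_fun_is_linear : linear diff_fun.
Proof.
move=> a c1 c2; apply/ffunP=> t; rewrite !ffunE /GRing.scale /= mulr_sumr.
rewrite -big_split; apply: eq_bigr => s _; rewrite mulr_sumr -big_split.
by apply: eq_bigr => k _; rewrite !ffunE mulrDr mulrCA.
Qed.

HB.instance Definition _ :=
  GRing.isLinear.Build rat chain chain _ diff_fun diff_fun_is_linear.

Definition differential : 'End(chain) := linfun diff_fun.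

Definition delta s : chain := [ffun t => (t == s)%:R].

Definition chain_group (i j : int) : {vspace chain} :=
  <<image delta [pred s | (hom_deg s == i) && (q_deg s == j)]>>%VS.

Definition cycles (i j : int) : {vspace chain} :=
  (chain_group i j :&: lker differential)%VS.
Definition boundaries (i j : int) : {vspace chain} :=
  (differential @: chain_group (i - 1) j)%VS.

Definition Kh (i j : int) : lmodType rat :=
  vquot (linfun (vsval : subvs_of (cycles i j) -> chain) @^-1: boundaries i j)%VS.

(** ** Signature *)

(** Let F be the surface produced by Seifert's algorithm, all Seifert disks
    being pushed below the projection plane.  A flow z on the edges of the
    diagram (a 1-cycle of the 4-valent graph) is carried by F: z_e is the flow
    along the edge e of the Seifert circles, and the band at a crossing carries
    whatever one Seifert arc has to hand over to the other one.  This maps the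
    flows onto H_1(F), the kernel being spanned by the Seifert circles.

    Counting crossings of z with the push-off of w, the linking number is the
    sum over the crossings, of sign s and with right-hand Seifert arc i -> o, of
      - s/2 (z_o - z_i) (w_o - w_i) + (z_o - z_i) (w_i + w_o) / 2,
    the half-twisted band and its attachment to the Seifert arc on its right.
    This is (z_o - z_i) w_i if s = +1 and (z_o - z_i) w_o if s = -1. *)

Definition right_in (x : crossing E) := if positive x then under_in x else over_in x.
Definition right_out (x : crossing E) := if positive x then over_out x else under_out x.
Definition right_mid (x : crossing E) := if positive x then right_in x else right_out x.

Definition unit_flow (e : E) : 'rV[rat]_#|E| := delta_mx 0 (enum_rank e).

Definition seifert_form : 'M[rat]_#|E| :=
  \sum_(x <- crossings D)
    (unit_flow (right_out x) - unit_flow (right_in x))^T *m unit_flow (right_mid x).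

Definition net_flow : 'M[rat]_(#|E|, size (crossings D)) :=
  \matrix_(e, k) (unit_flow (under_in (xing k)) + unit_flow (over_in (xing k))
                - unit_flow (under_out (xing k)) - unit_flow (over_out (xing k))) 0 e.

(** The rows of [kermx net_flow] span the flows; vanishing rows and the Seifert
    circles only add to the radical. *)
Definition seifert_matrix : 'M[rat]_#|E| :=
  kermx net_flow *m seifert_form *m (kermx net_flow)^T.

End Invariants.

Definition mx_signature n (A : 'M[rat]_n) : int :=
  let eigenvalues : 'rV[algC]_n := spectral_diag (map_mx ratr A) in
  #|[set i | 0 < eigenvalues 0 i]|%:Z - #|[set i | eigenvalues 0 i < 0]|%:Z.

(** The minus sign makes the right-handed trefoil have signature 2. *)
Definition signature (D : diagram) : int :=
  - mx_signature (seifert_matrix D + (seifert_matrix D)^T).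

Definition homologically_thin (D : diagram) : Prop :=
  forall i j : int, (exists x : Kh D i j, x != 0) ->
    j - 2 * i = signature D + 1 \/ j - 2 * i = signature D - 1.

(** * Kanenobu knots *)

(** The edges of the figure-eight diagram not on the outer face: the inner edge
    [ab], and the inner and outer [cd] edges, [Ecd1] being the one next to [b]. *)
Inductive inner_edge := Eab | Ead | Ebd | Ecd1 | Ecd2.

Definition inner_code (e : inner_edge) : 'I_5 :=
  match e with
  | Eab => @Ordinal 5 0 isT | Ead => @Ordinal 5 1 isT | Ebd => @Ordinal 5 2 isT
  | Ecd1 => @Ordinal 5 3 isT | Ecd2 => @Ordinal 5 4 isT
  end.
Definition inner_decode (k : 'I_5) : inner_edge :=
  match val k with 0 => Eab | 1 => Ead | 2 => Ebd | 3 => Ecd1 | _ => Ecd2 end%N.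
Fact inner_codeK : cancel inner_code inner_decode. Proof. by case. Qed.
HB.instance Definition _ := Finite.copy inner_edge (can_type inner_codeK).

(** The figure-eight diagram cut open at its outer edges.  The outer face is the
    triangle with vertices a, c, b in counterclockwise order; the outer edge
    from a to c is cut into the ends [ac_a] and [ac_c], and similarly for the
    others.  The three strands so obtained are
      ac_a - a - Eab - b - bc_b,
      bc_c - c - Ecd2 - d - Ebd - b - ab_b,
      ab_a - a - Ead - d - Ecd1 - c - ac_c,
    and run in this direction if [s1], [s2], [s3] respectively.  *)
Definition figure_eight (E : Type) (inner : inner_edge -> E)
    (ac_a ac_c bc_b bc_c ab_a ab_b : E) (s1 s2 s3 : bool) : seq (crossing E) :=
  [:: (* a *) Crossing ab_a ac_a (inner Ead) (inner Eab) s3 s1;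
      (* b *) Crossing (inner Eab) (inner Ebd) bc_b ab_b s1 s2;
      (* c *) Crossing (inner Ecd1) (inner Ecd2) ac_c bc_c s3 (~~ s2);
      (* d *) Crossing (inner Ecd2) (inner Ecd1) (inner Ebd) (inner Ead) s2 (~~ s3)].

(** Reflection in a line of the projection plane. *)
Definition reflect E (x : crossing E) : crossing E :=
  Crossing (arc0 x) (arc3 x) (arc2 x) (arc1 x) (under_fwd x) (~~ over_fwd x).

(** [m] crossings stacked along a vertical axis; [pos k false] and [pos k true]
    are the edges on the left and on the right of the axis just above the [k]-th
    crossing from the top, counting from 0.  One strand runs down and the other
    one up, [down] telling whether the one starting at the top left runs down.
    The crossings are positive if [sgn], i.e. the line from top left to bottom
    right is the over-strand, and negative otherwise. *)
Definition twists (E : Type) (pos : nat -> bool -> E) (m : nat) (sgn down : bool) :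
    seq (crossing E) :=
  [seq let d := down (+) odd k in
       let tl := pos k false in let tr := pos k true in
       let bl := pos k.+1 false in let br := pos k.+1 true in
       if sgn then Crossing tr tl bl br (~~ d) d else Crossing tl bl br tr d d
  | k <- iota 0 m].

(** Left and right are [false] and [true].  The summands are: the inner edges of
    the two figure-eight diagrams; the two edges crossing the axis in the
    connected sum (lower: [false], joining the vertices a; upper: [true], joining
    the vertices c); the edges of the two twist regions, by level and side. *)
Definition kanenobu_edge (m n : nat) : finType :=
  ((bool * inner_edge + bool) + ('I_m.+1 * bool + 'I_n.+1 * bool))%type.

(** Along the axis, each outer edge of D runs upwards in the counterclockwise
    direction around D: from a to c, from c to b and from b to a.  The strand
    orientations depend on the parities of p and q; the strands of D* run
    opposite to the mirror images of those of D. *)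
Definition kanenobu (p q : int) : diagram :=
  let m := `|p|%N in let n := `|q|%N in
  let E := kanenobu_edge m n in
  let inner side e : E := inl (inl (side, e)) in
  let sum_lo : E := inl (inr false) in
  let sum_up : E := inl (inr true) in
  let P k side : E := inr (inl (inord k, side)) in
  let Q k side : E := inr (inr (inord k, side)) in
  let s1 := true in
  let s2 := ~~ odd m in
  let s3 := ~~ odd (m + n) in
  let half side s1 s2 s3 :=
    figure_eight (inner side) sum_lo sum_up (P 0%N side) (P m side)
      (Q 0%N side) (Q n side) s1 s2 s3 in
  @Diagram E
    (half false s1 s2 s3
     ++ [seq reflect x | x <- half true (~~ s1) (~~ s2) (~~ s3)]
     ++ twists P m (0 <= p) s1
     ++ twists Q n (0 <= q) (~~ s3)).

(* Main.v *)
Require Import Defs.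
From HB Require Import structures.
From mathcomp Require Import all_boot all_order all_algebra all_field.
From mathcomp Require Import zify ring lra.

(** The Khovanov complex of K(n+1,0) is the cone of a saddle map from the complex of
    [CapKan n] to that of K(n,0), where [CapKan n] is K(n+1,0) with the last crossing of
    the twist region 0-smoothed.  The twists of [CapKan n] unwind one by one: its last
    crossing has for 0-smoothing [CapKan n] plus a circle and for 1-smoothing [CapKan n].
    Hence exactness outside the diagonals j - 2i = 1, -1 propagates from n to n + 1,
    provided the multiplications X and Y at the two sides of the saddle satisfy that
    Y + X and Y - X are injective in the top degree.  The initial facts, on the diagrams
    with 8 and 9 crossings, are computed: a contracting homotopy is found by elimination
    and then checked.

    The reflection of the diagram, composed with the exchange of 0 and 1 and of v_+ and
    v_-, is a bijection of enhanced states that transposes the differential up to signs,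
    so that dual homology groups have the same dimension.

    The signature vanishes because the symmetrized Seifert form on flows, which depends
    on n only through its parity and one coefficient, has an anti-isometry. *)

Set Implicit Arguments.
Unset Strict Implicit.
Unset Printing Implicit Defensive.

Import Order.TTheory GRing.Theory Num.Theory.
Local Open Scope ring_scope.

(** * Circles and smoothings *)

(** [CapKan n] is a diagram of the two-component unlink: up to shifts its homology lies in one
    homological degree and in the quantum degrees 2, 0, -2. Inside the cone the two lower ones fall
    on j - 2i = 1 and -1, but the top one falls on j - 2i = 3. This class is the obstacle: the
    saddle must not kill it. Followed to the 0-smoothing of the preceding twist crossing, its image
    is, up to signs and boundaries, Y - X applied to the top class of the previous unlink. The two
    sides of the saddle lie on different components, so v_+ (x) v_+ goes to a combination of v_+ (x)
    v_- and v_- (x) v_+ that does not vanish. Removing a curl changes the sign of X, so both Y + X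
    and Y - X must be known at the start.

    Chains are graded by height and circle sign, which ignore orientations; the orientation of the
    strands changes with the parity of the number of twists. The identities d d = 0 and d X = X d
    travel along the same recursion and start from a computation on [Kan 1], whose complex contains
    those of both smoothings of its twist crossing. *)

Lemma n_comp_image (T K : finType) (e : rel T) (kappa : T -> K) (a : pred T) :
  (forall x y, connect e x y = (kappa x == kappa y)) -> closed e a ->
  n_comp e a = #|[set kappa x | x in a]|.
Proof.
move=> kP cl.
have sym : connect_sym e by move=> x y; rewrite !kP eq_sym.
have kroot x : kappa (fingraph.root e x) = kappa x.
  by apply/eqP; rewrite -kP sym connect_root.
rewrite /n_comp_mem -(@card_in_imset _ _ kappa) => [|x y].
  apply: eq_card => z; apply/imsetP/imsetP => -[x].
    by rewrite inE /= => /andP[_ ax] ->; exists x.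
  move=> ax ->; exists (fingraph.root e x); last by rewrite kroot.
  rewrite inE /= roots_root //=.
  by rewrite -(closed_connect cl (connect_root e x)).
rewrite !inE => /andP[/eqP rx _] /andP[/eqP ry _] /eqP.
by rewrite -kP => /(fingraph.rootP sym); rewrite rx ry.
Qed.

Section Arcs.
Variable E : Type.
(** Up to degree shifts the complex depends only on the arcs of the crossings. Dropping the
    orientation bits makes [Kan n.+1] comparable with [Kan n], whose strands are oriented
    differently. *)
Definition quad : Type := (E * E * E * E)%type.
Definition arcs (x : crossing E) : quad := (arc0 x, arc1 x, arc2 x, arc3 x).
Definition ends (a : quad) : seq E := let: (a0, a1, a2, a3) := a in [:: a0; a1; a2; a3].
Definition joins (a : quad) (b : bool) : seq (E * E) :=
  let: (a0, a1, a2, a3) := a in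
  if b then [:: (a0, a3); (a1, a2)] else [:: (a0, a1); (a2, a3)].
Lemma smoothedE x b : smoothed x b = joins (arcs x) b. Proof. by []. Qed.
End Arcs.

Definition quad_map (E F : Type) (f : E -> F) (a : quad E) : quad F :=
  let: (a0, a1, a2, a3) := a in (f a0, f a1, f a2, f a3).

Lemma joins_map (E F : Type) (f : E -> F) a b :
  joins (quad_map f a) b = [seq (f p.1, f p.2) | p <- joins a b].
Proof. by case: a => [[[? ?] ?] ?]; case: b. Qed.

Lemma ends_map (E F : Type) (f : E -> F) a : ends (quad_map f a) = map f (ends a).
Proof. by case: a => [[[? ?] ?] ?]. Qed.

Definition sgn_of (b : bool) : int := if b then 1 else -1.

Lemma arcs_xing (D : diagram) (k : 'I_(size (crossings D))) a :
  arcs (xing k) = nth a (map (@arcs _) (crossings D)) k.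
Proof. by rewrite /xing (tnth_nth (xing k)) (nth_map (xing k)). Qed.

Section Diagram.
Variable D : diagram.
Local Notation E := (edge D).
Local Notation X := 'I_(size (crossings D)).
Implicit Types (v : {ffun X -> bool}) (s t : enhanced_state D).

Lemma adj_sym v : symmetric (adj v).
Proof. by move=> e f; rewrite /adj; apply: eq_existsb => k; rewrite orbC. Qed.

Lemma connect_adj_sym v : connect_sym (adj v).
Proof. exact/sym_connect_sym/adj_sym. Qed.

Lemma label_closed s : closed (adj (marker s)) [pred e | label s e].
Proof.
move=> e f ef; rewrite !inE.
by have /forallP/(_ e)/forallP/(_ f)/implyP/(_ ef)/eqP := valP s.
Qed.

Lemma label_connect s e f : connect (adj (marker s)) e f -> label s e = label s f.
Proof. by move=> /(closed_connect (@label_closed s)); rewrite !inE. Qed.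

Lemma state_ext s t : marker s = marker t -> label s = label t -> s = t.
Proof. by move=> Em El; apply/val_inj; rewrite [LHS]surjective_pairing [RHS]surjective_pairing; congr pair. Qed.

Lemma circle_sign_image (K : finType) (kappa : E -> K) s :
  (forall x y, connect (adj (marker s)) x y = (kappa x == kappa y)) ->
  circle_sign s = #|[set kappa e | e in [pred e | label s e]]|%:Z
                - #|[set kappa e | e in [pred e | ~~ label s e]]|%:Z.
Proof.
move=> kP; rewrite /circle_sign.
rewrite (n_comp_image kP (@label_closed s)) (n_comp_image kP) //.
by move=> e f ef; rewrite !inE (label_connect (connect1 ef)).
Qed.

Definition agree_off (v : {ffun X -> bool}) (es : seq E) s t : bool :=
  [forall e, ~~ has (connect (adj v) e) es ==> (label t e == label s e)].

Definition agree_except k s t : bool := [forall l, marker t l == (marker s l || (l == k))].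

(** The height grows by one along a cube edge, so keeping the quantum degree means lowering the
    circle sign by one. In this form no orientation is left. *)
Lemma incidentE k s t :
  incident k s t =
  [&& ~~ marker s k, agree_except k s t,
      agree_off (marker s) (ends (arcs (xing k))) s t
    & circle_sign t + 1 == circle_sign s].
Proof.
rewrite /incident; case: (boolP (~~ marker s k)) => //= sk.
rewrite -/(agree_except k s t); case: (boolP (agree_except k s t)) => //= /forallP mt.
congr andb.
  rewrite /agree_off; apply: eq_forallb => e; congr (~~ _ ==> _).
  apply/existsP/hasP => -[g].
    by case/andP=> eg; exists g.
  by move=> gk eg; exists g; rewrite eg.
rewrite /q_deg; have -> : height t = (height s).+1.
  rewrite /height (cardsD1 k [set l | marker t l]) !inE (eqP (mt k)) eqxx orbT add1n.
  congr _.+1; apply: eq_card => l; rewrite !inE (eqP (mt l)).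
  by case: eqP => [->|]; rewrite ?orbF // (negPf sk).
by apply/eqP/eqP; lia.
Qed.

Lemma circle_sign_flip e s t :
  marker t = marker s -> agree_off (marker s) [:: e] s t ->
  label s e -> ~~ label t e -> circle_sign t + 2 = circle_sign s.
Proof.
move=> Em /forallP ag se te.
pose ka := fingraph.root (adj (marker s)).
have kP x y : connect (adj (marker s)) x y = (ka x == ka y).
  by apply/idP/eqP => /(fingraph.rootP (@connect_adj_sym _)).
have ag' x : ka x != ka e -> label t x = label s x.
  by move=> xe; apply/eqP; move: (ag x); rewrite /= orbF kP xe.
have ls x : ka x = ka e -> label s x.
  by move=> /eqP; rewrite -kP => /label_connect ->.
have lt x : ka x = ka e -> ~~ label t x.
  by move=> /eqP; rewrite -kP -Em => /label_connect ->.
rewrite (circle_sign_image kP) (@circle_sign_image _ ka t) ?Em //.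
have -> : [set ka x | x in [pred x | label s x]] =
          ka e |: [set ka x | x in [pred x | label t x]].
  apply/setP => z; rewrite !inE; apply/imsetP/orP.
    move=> [x]; rewrite inE => sx ->.
    case: (eqVneq (ka x) (ka e)) => xe; [by left | right].
    by apply/imsetP; exists x => //; rewrite inE ag'.
  case=> [/eqP ->|/imsetP[x]]; first by exists e.
  rewrite inE => tx ->; exists x => //; rewrite inE -ag' //.
  by apply: contraL tx => /eqP/lt.
have -> : [set ka x | x in [pred x | ~~ label t x]] =
          ka e |: [set ka x | x in [pred x | ~~ label s x]].
  apply/setP => z; rewrite !inE; apply/imsetP/orP.
    move=> [x]; rewrite inE => sx ->.
    case: (eqVneq (ka x) (ka e)) => xe; [by left | right].
    by apply/imsetP; exists x => //; rewrite inE -ag'.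
  case=> [/eqP ->|/imsetP[x]]; first by exists e.
  rewrite inE => tx ->; exists x => //; rewrite inE ag' //.
  by apply: contraNneq tx => /ls.
rewrite !cardsU1.
have -> : ka e \notin [set ka x | x in [pred x | label t x]].
  apply/imsetP => -[x]; rewrite inE => tx xe.
  by have := lt _ (esym xe); rewrite tx.
have -> : ka e \notin [set ka x | x in [pred x | ~~ label s x]].
  apply/imsetP => -[x]; rewrite inE => tx xe.
  by have := ls _ (esym xe); rewrite (negPf tx).
lia.
Qed.

(** Multiplication by X on the circle through the edge [e]. *)
Definition times_X (e : E) s t : bool :=
  [&& marker t == marker s, label s e, ~~ label t e & agree_off (marker s) [:: e] s t].

Lemma agree_off_eq e s t : marker t = marker s -> agree_off (marker s) [:: e] s t ->
  label s e = label t e -> s = t.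
Proof.
move=> Em /forallP ag se; apply: state_ext => //; apply/ffunP => x.
case: (boolP (connect (adj (marker s)) x e)) => xe; last first.
  by apply/esym/eqP; move: (ag x); rewrite /= orbF xe.
by rewrite (label_connect xe) se; apply/esym/label_connect; rewrite Em.
Qed.

End Diagram.

(** * Smoothing one crossing *)

Definition orel (E : finType) (r : rel E) : rel (option E) := fun o1 o2 =>
  match o1, o2 with
  | Some x, Some y => r x y | None, None => true | _, _ => false
  end.

Section Smoothing.
Variables (D D' : diagram).
Local Notation E := (edge D).
Local Notation E' := (edge D').
Local Notation X := 'I_(size (crossings D)).
Local Notation X' := 'I_(size (crossings D')).
Variables (L1 L2 : seq (quad E)) (a : quad E) (b : bool) (f : E -> option E').

(** [D'] is [D] with the crossing of arcs [a] replaced by its [b]-smoothing; [f] is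
    undefined on the edges of a circle split off by the smoothing. *)
Record smoothing : Prop := Smoothing {
  smD : map (@arcs E) (crossings D) = L1 ++ a :: L2;
  smD' : map (quad_map Some) (map (@arcs E') (crossings D')) = map (quad_map f) (L1 ++ L2);
  smP : forall p, p \in joins a b -> f p.1 = f p.2;
  smF : forall e1 e2, f e1 = f e2 ->
    connect (fun x y => ((x, y) \in joins a b) || ((y, x) \in joins a b)) e1 e2;
  smS : forall e', exists e, f e = Some e' }.

Hypothesis sm : smoothing.

Lemma sm_size : size (crossings D) = (size L1 + size L2).+1.
Proof. by rewrite -(size_map (@arcs E)) (smD sm) size_cat /= addnS. Qed.

Lemma sm_size' : size (crossings D') = (size L1 + size L2)%N.
Proof.
by rewrite -(size_map (@arcs E')) -(size_map (quad_map Some)) (smD' sm) size_map size_cat.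
Qed.

Fact sm_index_subproof : (size L1 < size (crossings D))%N.
Proof. by rewrite sm_size ltnS leq_addr. Qed.
Definition sm_index : X := Ordinal sm_index_subproof.

Fact sm_lift_subproof (k : X') : (bump (size L1) k < size (crossings D))%N.
Proof.
have : (k < size L1 + size L2)%N by rewrite -sm_size'.
by rewrite sm_size /bump; lia.
Qed.
Definition sm_lift (k : X') : X := Ordinal (sm_lift_subproof k).

Lemma sm_lift_inj : injective sm_lift.
Proof. by move=> k l /(congr1 val) /= /(can_inj (bumpK _))/val_inj. Qed.

Lemma sm_lift_index k : sm_lift k != sm_index.
Proof. by apply/eqP => /(congr1 val)/= /eqP; rewrite eq_sym (negPf (neq_bump _ _)). Qed.

Variant sm_spec (k : X) : Prop :=
| SmIndex of k = sm_index
| SmLift k' of k = sm_lift k'.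

Lemma smP_ k : sm_spec k.
Proof.
case: (eqVneq k sm_index) => [|kj]; first by left.
have lt : (unbump (size L1) k < size (crossings D'))%N.
  have : (k < (size L1 + size L2).+1)%N by rewrite -sm_size.
  rewrite sm_size' /unbump.
  have : nat_of_ord k != size L1 by apply: contra_neq kj => kj'; apply: val_inj.
  lia.
apply: (@SmLift _ (Ordinal lt)); apply: val_inj => /=.
rewrite unbumpKcond /=.
have : nat_of_ord k != size L1 by apply: contra_neq kj => kj'; apply: val_inj.
by rewrite /=; case: eqP.
Qed.

Lemma sm_arcs_index : arcs (xing sm_index) = a.
Proof. by rewrite (arcs_xing _ a) (smD sm) nth_cat ltnn subnn. Qed.

Lemma sm_arcs_lift k :
  quad_map f (arcs (xing (sm_lift k))) = quad_map Some (arcs (xing k)).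
Proof.
have kD : (k < size L1 + size L2)%N by rewrite -sm_size'.
rewrite (arcs_xing _ a) (arcs_xing k (arcs (xing k))).
rewrite -(nth_map _ (quad_map f a) (quad_map Some)) ?size_map // (smD' sm).
rewrite (nth_map a) ?size_cat //; congr quad_map.
rewrite (smD sm) !nth_cat /= /bump.
case: (leqP (size L1) k) => hk; last by rewrite add0n hk.
by rewrite add1n ltnNge (leq_trans hk) //= subSn.
Qed.

Definition pull_marker (v : {ffun X' -> bool}) : {ffun X -> bool} :=
  [ffun k => if [pick k' | sm_lift k' == k] is Some k' then v k' else b].

Lemma pull_marker_lift v k : pull_marker v (sm_lift k) = v k.
Proof.
rewrite ffunE; case: pickP => [k' /eqP/sm_lift_inj -> //|/(_ k)].
by rewrite eqxx.
Qed.

Lemma pull_marker_index v : pull_marker v sm_index = b.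
Proof.
by rewrite ffunE; case: pickP => [k' /eqP E1|//]; have := sm_lift_index k'; rewrite E1 eqxx.
Qed.

(** Forwards, a join of [D] becomes an equality or a join of [D']. Backwards, a path of [D'] lifts
    step by step, and consecutive pieces are linked because [smF] connects each fibre of [f] through
    the smoothed crossing. The value [None], the circle split off, is a class of its own. *)
Lemma pull_connect v e1 e2 :
  connect (adj (pull_marker v)) e1 e2 = orel (connect (adj v)) (f e1) (f e2).
Proof.
have orefl o : orel (connect (adj v)) o o by case: o => /=.
have fib x y : f x = f y -> connect (adj (pull_marker v)) x y.
  move=> /(smF sm); apply: connect_sub => u w uw; apply: connect1.
  apply/existsP; exists sm_index.
  by rewrite !smoothedE sm_arcs_index pull_marker_index.
apply/idP/idP.
  have otrans : transitive (orel (connect (adj v))).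
    by move=> [y|] [x|] [z|] //=; apply: connect_trans.
  case/connectP => p; elim: p e1 => [|e p IH] e1 /=; first by move=> _ ->.
  case/andP=> e1e pp E2; apply: otrans (IH _ pp E2).
  case/existsP: e1e => k; rewrite !smoothedE.
  case: (smP_ k) => [->|k' ->].
    rewrite sm_arcs_index pull_marker_index => /orP[] /(smP sm) /= ->; exact: orefl.
  rewrite pull_marker_lift => H.
  have : ((f e1, f e) \in joins (quad_map f (arcs (xing (sm_lift k')))) (v k'))
      || ((f e, f e1) \in joins (quad_map f (arcs (xing (sm_lift k')))) (v k')).
    by rewrite joins_map; case/orP: H => H; [|rewrite orbC]; rewrite (map_f (fun p => (f p.1, f p.2)) H).
  rewrite sm_arcs_lift joins_map => /orP[] /mapP[[x y] /= xy [-> ->]] /=.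
    by apply/connect1/existsP; exists k'; rewrite !smoothedE xy.
  by apply/connect1/existsP; exists k'; rewrite !smoothedE xy orbT.
case E1: (f e1) => [x|]; case E2: (f e2) => [y|] //=; last by move=> _; apply: fib; rewrite E1.
case/connectP => p; elim: p x e1 E1 => [|z p IH] x e1 E1 /=.
  by move=> _ yx; apply: fib; rewrite E1 E2 yx.
case/andP=> xz pp Ey.
have [k' xz'] := existsP xz; rewrite !smoothedE in xz'.
have : exists u w, [/\ f u = Some x, f w = Some z & adj (pull_marker v) u w].
  have M p0 : p0 \in joins (arcs (xing k')) (v k') ->
     exists p1, p1 \in joins (arcs (xing (sm_lift k'))) (v k') /\
       (Some p0.1, Some p0.2) = (f p1.1, f p1.2).
    move=> H; have := map_f (fun p => (Some p.1, Some p.2)) H.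
    rewrite -joins_map -sm_arcs_lift joins_map => /mapP[p1 H1 H2].
    by exists p1.
  case/orP: xz' => /M[[u w] [/= H [Eu Ew]]].
    exists u, w; split=> //; apply/existsP; exists (sm_lift k').
    by rewrite !smoothedE pull_marker_lift H.
  exists w, u; split=> //; apply/existsP; exists (sm_lift k').
  by rewrite !smoothedE pull_marker_lift H orbT.
case=> u [w [Eu Ew uw]].
apply: connect_trans (IH z w Ew pp Ey).
by apply: connect_trans (connect1 uw); apply: fib; rewrite E1 Eu.
Qed.

Definition pull_label (l : {ffun E' -> bool}) (c : bool) : {ffun E -> bool} :=
  [ffun e => if f e is Some e' then l e' else c].

Fact pull_subproof (s : enhanced_state D') c :
  [forall e, forall g, adj (pull_marker (marker s)) e g ==>
     (pull_label (label s) c e == pull_label (label s) c g)].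
Proof.
apply/forallP => e; apply/forallP => g; apply/implyP => /connect1.
rewrite pull_connect !ffunE; case: (f e) (f g) => [x|] [y|] //= xy.
by rewrite (label_connect xy).
Qed.

Definition pull s c : enhanced_state D := exist _ (_, _) (pull_subproof s c).

Lemma marker_pull s c : marker (pull s c) = pull_marker (marker s). Proof. by []. Qed.
Lemma label_pull s c e : label (pull s c) e = if f e is Some e' then label s e' else c.
Proof. by rewrite /label /= ffunE. Qed.

Lemma marker_pull_lift s c k : marker (pull s c) (sm_lift k) = marker s k.
Proof. exact: pull_marker_lift. Qed.
Lemma marker_pull_index s c : marker (pull s c) sm_index = b.
Proof. exact: pull_marker_index. Qed.

Lemma pull_inj s t c d : pull s c = pull t d -> s = t.
Proof.
move=> E0; apply: state_ext; apply/ffunP => x.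
  by rewrite -(marker_pull_lift s c) E0 marker_pull_lift.
have [e Ee] := smS sm x.
by have := label_pull s c e; rewrite E0 label_pull Ee.
Qed.

Lemma pull_surj s : marker s sm_index = b -> exists t c, s = pull t c.
Proof.
move=> sj.
pose v : {ffun X' -> bool} := [ffun k => marker s (sm_lift k)].
have Ev : marker s = pull_marker v.
  apply/ffunP => k; case: (smP_ k) => [->|k' ->].
    by rewrite pull_marker_index.
  by rewrite pull_marker_lift ffunE.
have sS e' : exists e, f e == Some e' by have [e Ee] := smS sm e'; exists e; apply/eqP.
pose g e' := xchoose (sS e').
have gK e' : f (g e') = Some e' by apply/eqP/(xchooseP (sS e')).
have lf x y : f x = f y -> label s x = label s y.
  move=> xy; apply: label_connect; rewrite Ev pull_connect xy.
  by case: (f y) => /=.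
pose l : {ffun E' -> bool} := [ffun e => label s (g e)].
have Pl : [forall e, forall h, adj v e h ==> (l e == l h)].
  apply/forallP => e; apply/forallP => h; apply/implyP => eh; rewrite !ffunE.
  by apply/eqP/label_connect; rewrite Ev pull_connect !gK /= connect1.
(* The sign of the circle split off; without such a circle any value will do. *)
pose c := if [pick e | f e == None] is Some e then label s e else true.
exists (exist _ (v, l) Pl), c; apply: state_ext => //.
apply/ffunP => e; rewrite label_pull.
case Ee: (f e) => [e'|].
  by rewrite /label /= ffunE; apply: lf; rewrite gK.
rewrite /c; case: pickP => [x /eqP fx|/(_ e)]; last by rewrite Ee.
by apply: lf; rewrite Ee fx.
Qed.

Lemma height_pull s c : height (pull s c) = (b + height s)%N.
Proof.
rewrite /height (cardsD1 sm_index) inE marker_pull_index; congr addn.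
rewrite -(card_imset _ sm_lift_inj); apply: eq_card => k; rewrite !inE.
apply/andP/imsetP => [[kj]|[k']].
  case: (smP_ k) kj => [->|k' ->]; first by rewrite eqxx.
  by rewrite marker_pull_lift => _ H; exists k'; rewrite ?inE.
by rewrite inE => H ->; rewrite sm_lift_index marker_pull_lift.
Qed.

Lemma circle_sign_pull s c :
  circle_sign (pull s c) =
  circle_sign s + (if [exists e, f e == None] then sgn_of c else 0).
Proof.
pose ka := fingraph.root (adj (marker s)).
have kP x y : connect (adj (marker s)) x y = (ka x == ka y).
  by apply/idP/eqP => /(fingraph.rootP (@connect_adj_sym _ _)).
have kP' x y : connect (adj (marker (pull s c))) x y = (omap ka (f x) == omap ka (f y)).
  by rewrite pull_connect; case: (f x) (f y) => [x'|] [y'|] //=; rewrite kP.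
rewrite (circle_sign_image kP) (circle_sign_image kP').
have im (P : pred bool) : #|[set omap ka (f e) | e in [pred e | P (label (pull s c) e)]]|
   = (([exists e, f e == None] && P c) + #|[set ka e | e in [pred e | P (label s e)]]|)%N.
  rewrite (cardsD1 None) -[in RHS](card_imset _ (@Some_inj _)); congr addn.
    congr nat_of_bool; apply/imsetP/andP.
      case=> e; rewrite inE label_pull; case Ee: (f e) => [e'|] // Pc _.
      by split=> //; apply/existsP; exists e; rewrite Ee.
    case=> /existsP[e /eqP Ee] Pc; exists e; last by rewrite Ee.
    by rewrite inE label_pull Ee.
  apply: eq_card => -[z|]; rewrite !inE /=; last first.
    by symmetry; apply/imsetP => -[].
  apply/imsetP/imsetP => [[e]|[z' /imsetP[x]]].
    rewrite inE label_pull; case: (f e) => [e'|] // Pe [->].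
    by exists (ka e') => //; apply: imset_f.
  rewrite inE => Px -> [->]; have [e Ee] := smS sm x.
  by exists e; rewrite ?Ee // inE label_pull Ee.
rewrite (im id) (im negb); case: [exists e, _] => /=; case: c {kP' im} => /=; lia.
Qed.

Lemma pull_touch s c e (es : seq E) (es' : seq E') : map f es = map Some es' ->
  has (connect (adj (marker (pull s c))) e) es =
  if f e is Some e' then has (connect (adj (marker s)) e') es' else false.
Proof.
move=> Ees; transitivity (has (orel (connect (adj (marker s))) (f e)) (map f es)).
  by rewrite has_map; apply: eq_has => x /=; rewrite marker_pull pull_connect.
rewrite Ees has_map; case: (f e) => [e'|]; last by elim: es' {Ees}.
by apply: eq_has.
Qed.

Lemma pull_agree_off s t c d es es' : map f es = map Some es' ->
  agree_off (marker (pull s c)) es (pull s c) (pull t d) =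
  agree_off (marker s) es' s t && ([exists e, f e == None] ==> (c == d)).
Proof.
move=> Ees; apply/forallP/andP.
  move=> H; split.
    apply/forallP => e'; have [e Ee] := smS sm e'.
    by have := H e; rewrite (pull_touch s c e Ees) !label_pull Ee.
  apply/implyP => /existsP[e /eqP Ee].
  by have := H e; rewrite (pull_touch s c e Ees) !label_pull Ee eq_sym.
case=> /forallP H1 H2 e; rewrite (pull_touch s c e Ees) !label_pull.
case Ee: (f e) => [e'|]; first exact: H1.
by rewrite eq_sym; apply: (implyP H2); apply/existsP; exists e; rewrite Ee.
Qed.

Lemma pull_marker_inj : injective pull_marker.
Proof.
move=> v w vw; apply/ffunP => k.
by rewrite -[LHS]pull_marker_lift vw pull_marker_lift.
Qed.

Lemma pull_times_X s t c d e e' : f e = Some e' ->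
  times_X e (pull s c) (pull t d) = times_X e' s t && ([exists e, f e == None] ==> (c == d)).
Proof.
move=> Ee; rewrite /times_X !label_pull Ee (@pull_agree_off s t c d _ [:: e']) ?Ee /= ?Ee //.
rewrite !marker_pull (inj_eq pull_marker_inj); case: (_ == _) => //=.
by rewrite !andbA.
Qed.

(** The cube of [D'] is a face of the cube of [D]. The circle split off meets none of the remaining
    crossings, so every arrow of the face preserves its sign. *)
Lemma pull_incident k s t c d :
  incident (sm_lift k) (pull s c) (pull t d) =
  incident k s t && ([exists e, f e == None] ==> (c == d)).
Proof.
rewrite !incidentE marker_pull_lift.
rewrite (@pull_agree_off s t c d _ (ends (arcs (xing k)))); last first.
  by rewrite -!ends_map sm_arcs_lift.
have -> : agree_except (sm_lift k) (pull s c) (pull t d) = agree_except k s t.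
  apply/forallP/forallP => H l.
    by have := H (sm_lift l); rewrite !marker_pull_lift (inj_eq sm_lift_inj).
  case: (smP_ l) => [->|l' ->]; first by rewrite !marker_pull_index [sm_index == _]eq_sym (negPf (sm_lift_index k)) orbF eqxx.
  by rewrite !marker_pull_lift (inj_eq sm_lift_inj).
case: (~~ _) => //=; case: (agree_except _ _ _) => //=; rewrite !circle_sign_pull.
case: [exists e, _] => /=; last by rewrite !addr0 !andbT.
case: eqP => [->|_]; last by rewrite !andbF.
rewrite !andbT; congr andb; rewrite addrAC.
exact: (inj_eq (addIr _)).
Qed.

Lemma incident_pullN k s t :
  marker s sm_index != marker t sm_index -> incident (sm_lift k) s t = false.
Proof.
move=> st; rewrite incidentE /agree_except; case: forallP => // [H|]; last by rewrite andbF.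
have := H sm_index; rewrite [sm_index == _]eq_sym (negPf (sm_lift_index k)) orbF.
by rewrite eq_sym (negPf st).
Qed.

End Smoothing.

(** * The diagrams of the twist region *)

(** The orientation is an arbitrary choice, on which heights, circle signs and [incident] do not
    depend. *)
Definition quad_crossing (E : Type) (a : quad E) : crossing E :=
  let: (a0, a1, a2, a3) := a in Crossing a0 a1 a2 a3 true true.

Lemma arcs_quad_crossing E (a : quad E) : arcs (quad_crossing a) = a.
Proof. by case: a => [[[? ?] ?] ?]. Qed.

(** The second twist region is empty, so [q side] is both ends of the outer edge ab. The edges are
    parameters because the same list describes [Kan], [CapKan] and the diagrams with numbered
    edges. *)
Definition two_figure_eights (E : Type) (inner : bool -> inner_edge -> E) (lo up : E)
    (u v q : bool -> E) : seq (quad E) :=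
  [:: (q false, lo, inner false Ead, inner false Eab);
      (inner false Eab, inner false Ebd, u false, q false);
      (inner false Ecd1, inner false Ecd2, up, v false);
      (inner false Ecd2, inner false Ecd1, inner false Ebd, inner false Ead);
      (q true, inner true Eab, inner true Ead, lo);
      (inner true Eab, q true, u true, inner true Ebd);
      (inner true Ecd1, v true, up, inner true Ecd2);
      (inner true Ecd2, inner true Ead, inner true Ebd, inner true Ecd1)].

Definition twist_quads (E : Type) (pos : nat -> bool -> E) (n : nat) : seq (quad E) :=
  [seq (pos k true, pos k false, pos k.+1 false, pos k.+1 true) | k <- iota 0 n].

Section Edges.
Variable n : nat.
Definition Ein side e : kanenobu_edge n 0 := inl (inl (side, e)).
Definition Esum b : kanenobu_edge n 0 := inl (inr b).
Definition Epos k side : kanenobu_edge n 0 := inr (inl (inord k, side)).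
Definition Eq side : kanenobu_edge n 0 := inr (inr (inord 0, side)).
(** At level [n] both sides are one edge, the cap; the name [Epos n n true] becomes free for the arc
    below it. *)
Definition Ecap k side : kanenobu_edge n 0 := Epos k (side && (k < n)%N).

Definition body (u v : bool -> kanenobu_edge n 0) :=
  two_figure_eights Ein (Esum false) (Esum true) u v Eq.
End Edges.
Arguments Ein n side e : clear implicits.
Arguments Esum n b : clear implicits.
Arguments Epos n k side : clear implicits.
Arguments Eq n side : clear implicits.
Arguments Ecap n k side : clear implicits.
Arguments body n u v : clear implicits.

Definition Kan (n : nat) : diagram := kanenobu n%:Z 0.

(** The diagram obtained from [Kan n.+1] by 0-smoothing the last crossing of the
    twist region; the edges of level [n] are now the cap closing the remaining
    twists ([false]) and the arc below it ([true]). *)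
Definition CapKan (n : nat) : diagram :=
  @Diagram (kanenobu_edge n 0) (map (@quad_crossing _)
    (body n (Ecap n 0) (fun=> Epos n n true) ++ twist_quads (Ecap n) n)).

Lemma arcs_Kan n : map (@arcs _) (crossings (Kan n)) =
  body n (Epos n 0) (Epos n n) ++ twist_quads (Epos n) n.
Proof.
rewrite /= cats0; do 8 congr (_ :: _).
by rewrite -map_comp; apply: eq_map.
Qed.

Lemma arcs_CapKan n : map (@arcs _) (crossings (CapKan n)) =
  body n (Ecap n 0) (fun=> Epos n n true) ++ twist_quads (Ecap n) n.
Proof. by rewrite -map_comp map_id_in // => a _; exact: arcs_quad_crossing. Qed.

Section EdgeMap.
Variables (n : nat) (g : nat -> bool -> option (nat * bool)).
(** Only twist edges move. As [g] sees just a level and a side, composites of such maps are compared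
    by a few cases on the level. *)
Definition edge_map (e : kanenobu_edge n.+1 0) : option (kanenobu_edge n 0) :=
  match e with
  | inl x => Some (inl x)
  | inr (inl (i, s)) => omap (fun p => Epos n p.1 p.2) (g i s)
  | inr (inr x) => Some (inr (inr x))
  end.

Lemma edge_map_Epos k s : (k <= n.+1)%N ->
  edge_map (Epos n.+1 k s) = omap (fun p => Epos n p.1 p.2) (g k s).
Proof. by move=> kn; rewrite /= inordK. Qed.

End EdgeMap.

Lemma Epos_inj n k l s t : (k <= n)%N -> (l <= n)%N ->
  (Epos n k s == Epos n l t) = (k == l) && (s == t).
Proof.
move=> kn ln; apply/eqP/andP => [[]|[/eqP-> /eqP->]//].
by move=> /(congr1 val); rewrite /= !inordK // => -> ->.
Qed.

Section EdgeMapSmoothing.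
Variables (n : nat) (g : nat -> bool -> option (nat * bool)).
Variables (X : seq (crossing (kanenobu_edge n.+1 0))) (X' : seq (crossing (kanenobu_edge n 0))).
Variables (L1 L2 : seq (quad (kanenobu_edge n.+1 0))) (a : quad (kanenobu_edge n.+1 0)) (b : bool).
Variable h : option (nat * bool) -> nat * bool.
Let f := edge_map g (n := n).

(** The function [h] picks one edge in every fibre; each edge equals the chosen one or is joined to
    it at the smoothed crossing, which gives the connected fibres of [smF]. *)
Lemma edge_map_smoothing L' :
  map (@arcs _) X = L1 ++ a :: L2 -> map (@arcs _) X' = L' ->
  map (quad_map Some) L' = map (quad_map f) (L1 ++ L2) ->
  (forall p, p \in joins a b -> f p.1 = f p.2) ->
  (forall k s, (k <= n.+1)%N -> if g k s is Some p then (p.1 <= n)%N else true) ->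
  (forall k s, (k <= n.+1)%N -> let: (l, t) := h (g k s) in
     let e := Epos n.+1 k s in let e' := Epos n.+1 l t in
     [|| e == e', (e, e') \in joins a b | (e', e) \in joins a b]) ->
  (forall k s, (k <= n)%N -> exists l t, (l <= n.+1)%N /\ g l t = Some (k, s)) ->
  @smoothing (@Diagram _ X) (@Diagram _ X') L1 L2 a b f.
Proof.
move=> HD HE HD' HP Hb Hh Hs; split=> //=; rewrite ?HE //; last first.
  move=> [x|[[i s]|x]]; [by exists (inl x) | | by exists (inr (inr x))].
  have [l [t [ln gl]]] := Hs i s (ltn_ord i); exists (Epos n.+1 l t).
  by rewrite /f edge_map_Epos // gl /= /Epos inord_val.
set r : rel (kanenobu_edge n.+1 0) := fun x y => _.
have rs : connect_sym r by apply: sym_connect_sym => x y; rewrite /r orbC.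
have H k s : (k <= n.+1)%N -> connect r (Epos n.+1 k s) (let: (l, t) := h (g k s) in Epos n.+1 l t).
  move=> kn; have := Hh k s kn; case: (h _) => l t /=.
  by case/predU1P => [->//|H]; apply: connect1.
move=> [x|[[i s]|x]] [y|[[j t]|y]] //=.
- by case=> ->.
- by case: (g j t).
- by case: (g i s).
- rewrite -[i]inord_val -[j]inord_val -!/(Epos _ _ _) => E0.
  have [in' jn] : (i <= n.+1)%N /\ (j <= n.+1)%N by split; rewrite -ltnS ltn_ord.
  apply: connect_trans (H _ _ in') _; rewrite rs; apply: connect_trans (H _ _ jn) _.
  suff -> : g i s = g j t by [].
  have := Hb i s in'; have := Hb j t jn; rewrite !inordK // in E0.
  case: (g i s) (g j t) E0 => [[i' s']|] [[j' t']|] //= E0 h1 h2.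
  by have /eqP := E0; rewrite (inj_eq Some_inj) Epos_inj // => /andP[/eqP -> /eqP ->].
- by case: (g i s).
- by case: (g j t).
- by case=> ->.
Qed.
End EdgeMapSmoothing.

Lemma twist_quads_recr E (pos : nat -> bool -> E) n :
  twist_quads pos n.+1 =
  twist_quads pos n ++ [:: (pos n true, pos n false, pos n.+1 false, pos n.+1 true)].
Proof. by rewrite /twist_quads -{1}[n.+1]addn1 iotaD map_cat. Qed.

Lemma twist_quads_map E F (f : E -> F) (pos : nat -> bool -> E) (pos' : nat -> bool -> F) n :
  (forall k s, (k <= n)%N -> f (pos k s) = pos' k s) ->
  map (quad_map f) (twist_quads pos n) = twist_quads pos' n.
Proof.
move=> H; rewrite /twist_quads -map_comp; apply/eq_in_map => k.
rewrite mem_iota add0n => /andP[_ kn] /=; rewrite !H //; exact: ltnW.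
Qed.

Lemma body_map n g u v u' v' :
  (forall s, edge_map (n := n) g (u s) = Some (u' s)) ->
  (forall s, edge_map (n := n) g (v s) = Some (v' s)) ->
  map (quad_map (edge_map g)) (body n.+1 u v) = map (quad_map Some) (body n u' v').
Proof. by move=> Hu Hv; rewrite /= !Hu !Hv. Qed.

Lemma quad_mapE (E F : Type) (f : E -> F) a0 a1 a2 a3 :
  quad_map f (a0, a1, a2, a3) = (f a0, f a1, f a2, f a3).
Proof. by []. Qed.

Section Maps.
Variable n : nat.

(** Where the smoothing of the last crossing of [Kan n.+1] (K) or [CapKan n.+1] (C)
    sends the edge of level [k] and side [s]. *)
Definition gK1 (k : nat) (s : bool) := Some (minn k n, s).
Definition gK0 (k : nat) (s : bool) :=
  if (k < n)%N then Some (k, s) else Some (n, n < k)%N.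
Definition gC1 (k : nat) (s : bool) :=
  if (k < n)%N then Some (k, s) else Some (n, (n < k)%N && s).
Definition gC0 (k : nat) (s : bool) :=
  if (k < n)%N then Some (k, s) else
  if (k == n)%N then Some (n, false) else if s then Some (n, true) else None.

Local Notation last_twist := (Epos n.+1 n true, Epos n.+1 n false, Epos n.+1 n.+1 false, Epos n.+1 n.+1 true).
Local Notation last_cap := (Epos n.+1 n true, Epos n.+1 n false, Epos n.+1 n.+1 false, Epos n.+1 n.+1 false).

Lemma mem_joins1 (T : eqType) (a0 a1 a2 a3 : T) p :
  p \in joins (a0, a1, a2, a3) true = (p == (a0, a3)) || (p == (a1, a2)).
Proof. by rewrite /= !inE. Qed.
Lemma mem_joins0 (T : eqType) (a0 a1 a2 a3 : T) p :
  p \in joins (a0, a1, a2, a3) false = (p == (a0, a1)) || (p == (a2, a3)).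
Proof. by rewrite /= !inE. Qed.

Lemma smooth_Kan1 :
  @smoothing (Kan n.+1) (Kan n) (body n.+1 (Epos n.+1 0) (Epos n.+1 n.+1) ++ twist_quads (Epos n.+1) n)
    [::] last_twist true (edge_map gK1).
Proof.
apply: (edge_map_smoothing (h := fun o => if o is Some p then p else (0%N, false))).
- by rewrite (arcs_Kan n.+1) twist_quads_recr catA.
- exact: arcs_Kan.
- rewrite cats0 !map_cat; congr (_ ++ _).
    by apply/esym/body_map => s; rewrite edge_map_Epos //= /gK1 /= ?min0n // (minn_idPr _).
  rewrite (twist_quads_map (pos' := fun k s => Some (Epos n k s))) //.
  by apply/esym/twist_quads_map => k s kn; rewrite edge_map_Epos ?leqW //= (minn_idPl kn).
- move=> p; rewrite mem_joins1 => /orP[] /eqP ->; rewrite !edge_map_Epos //= /gK1 minnn.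
    by rewrite (minn_idPr _).
  by rewrite (minn_idPr _).
- by move=> k s kn /=; apply: geq_minr.
- move=> k s kn /=; case: (ltngtP k n.+1) kn => // kn _.
    by rewrite (minn_idPl _) // eqxx.
  by rewrite kn (minn_idPr _) //; case: s; rewrite !inE !eqxx !orbT.
- by move=> k s kn; exists k, s; split; [apply: leqW | rewrite /gK1 (minn_idPl kn)].
Qed.

Lemma smooth_Kan0 :
  @smoothing (Kan n.+1) (CapKan n) (body n.+1 (Epos n.+1 0) (Epos n.+1 n.+1) ++ twist_quads (Epos n.+1) n)
    [::] last_twist false (edge_map gK0).
Proof.
(* The fibre of the cap consists of the two edges of level [n], that of the arc below it of the two
   edges of level [n.+1]. *)
apply: (edge_map_smoothing (h := fun o => if o is Some (k, s) then
   if (k == n) && s then (n.+1, false) else (k, s) else (0%N, false))).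
- by rewrite (arcs_Kan n.+1) twist_quads_recr catA.
- exact: arcs_CapKan.
- rewrite cats0 !map_cat; congr (_ ++ _).
    apply/esym/body_map => s; rewrite edge_map_Epos //= /gK0 /Ecap.
      by case: ltnP => /=; rewrite ?andbT ?andbF //= leqn0 => /eqP ->.
    by rewrite ltnNge leqnSn /= ltnSn.
  rewrite (twist_quads_map (pos' := fun k s => Some (Ecap n k s))) //.
  apply/esym/twist_quads_map => k s kn; rewrite edge_map_Epos ?leqW //= /gK0 /Ecap.
  by case: (ltngtP k n) kn => // [kn|->] _; rewrite ?andbT ?andbF.
- move=> p; rewrite mem_joins0 => /orP[] /eqP ->; rewrite !edge_map_Epos //= /gK0 ?ltnn ?eqxx ?(ltnNge _ n) ?leqnSn ?ltnSn ?gtn_eqF //.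
- by move=> k s kn; rewrite /gK0; case: ltnP => //=; apply: ltnW.
- move=> k s kn; rewrite /gK0; case: (ltngtP k n) => [kn'|kn'|->] /=.
  + by rewrite (ltn_eqF kn') /= eqxx.
  + have -> : k = n.+1 by lia.
    by rewrite eqxx /= !inE; case: s; rewrite !eqxx ?orbT.
  + by rewrite andbF /= !inE; case: s; rewrite !eqxx ?orbT.
- move=> k s; case: (ltngtP k n) => // [kn|->] _.
    by exists k, s; rewrite /gK0 kn; split=> //; apply: leqW; apply: ltnW.
  by case: s; [exists n.+1, true | exists n, false]; rewrite /gK0 ?ltnn ?leqnSn ?ltnSn // ltnNge leqnSn.
Qed.

(** The last crossing is a curl closed by the cap. Its 1-smoothing joins both upper edges to the
    cap, which thereby moves up one level. *)
Lemma smooth_CapKan1 :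
  @smoothing (CapKan n.+1) (CapKan n)
    (body n.+1 (Ecap n.+1 0) (fun=> Epos n.+1 n.+1 true) ++ twist_quads (Epos n.+1) n)
    [::] last_cap true (edge_map gC1).
Proof.
apply: (edge_map_smoothing (h := fun o => if o is Some (k, s) then
   if k == n then (n.+1, s) else (k, s) else (0%N, false))).
- rewrite (arcs_CapKan n.+1) twist_quads_recr -catA; congr (_ ++ _ ++ _).
    by apply/eq_in_map => k; rewrite mem_iota add0n => /= kn; have kn2 : (k.+1 < n.+1)%N by []; rewrite /Ecap kn2 ltnW.
  by rewrite /Ecap ltnSn ltnn.
- exact: arcs_CapKan.
- rewrite cats0 !map_cat; congr (_ ++ _).
    apply/esym/body_map => s; rewrite edge_map_Epos //= /gC1 /Ecap andbT.
      by case: ltnP => /=; rewrite ?andbT ?andbF //= leqn0 => /eqP ->.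
    by rewrite ltnNge leqnSn /= ltnSn.
  rewrite (twist_quads_map (pos' := fun k s => Some (Ecap n k s))) //.
  apply/esym/twist_quads_map => k s kn; rewrite edge_map_Epos ?leqW //= /gC1 /Ecap.
  by case: (ltngtP k n) kn => // [kn|->] _; rewrite ?andbT ?andbF.
- move=> p; rewrite mem_joins1 => /orP[] /eqP ->; rewrite !edge_map_Epos //= /gC1 ?ltnn ?eqxx ?(ltnNge _ n) ?leqnSn ?ltnSn ?gtn_eqF //.
- by move=> k s kn; rewrite /gC1; case: ltnP => //=; apply: ltnW.
- move=> k s kn; rewrite /gC1; case: (ltngtP k n) => [kn'|kn'|->] /=.
  + by rewrite (ltn_eqF kn') /= eqxx.
  + have -> : k = n.+1 by lia.
    by rewrite eqxx /= eqxx.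
  + by rewrite eqxx /= !inE; case: s; rewrite !eqxx ?orbT.
- move=> k s; case: (ltngtP k n) => // [kn|->] _.
    by exists k, s; rewrite /gC1 kn; split=> //; apply: leqW; apply: ltnW.
  by exists n.+1, s; split=> //; rewrite /gC1 ltnNge leqnSn ltnSn.
Qed.

(** The cap occupies both lower ends of the last crossing, so joining them closes it into a separate
    circle, sent to [None]; the two upper edges become the new cap. *)
Lemma smooth_CapKan0 :
  @smoothing (CapKan n.+1) (CapKan n)
    (body n.+1 (Ecap n.+1 0) (fun=> Epos n.+1 n.+1 true) ++ twist_quads (Epos n.+1) n)
    [::] last_cap false (edge_map gC0).
Proof.
apply: (edge_map_smoothing (h := fun o => if o is Some (k, s) then
   if (k == n) && s then (n.+1, true) else (k, s) else (n.+1, false))).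
- rewrite (arcs_CapKan n.+1) twist_quads_recr -catA; congr (_ ++ _ ++ _).
    by apply/eq_in_map => k; rewrite mem_iota add0n => /= kn; have kn2 : (k.+1 < n.+1)%N by []; rewrite /Ecap kn2 ltnW.
  by rewrite /Ecap ltnSn ltnn.
- exact: arcs_CapKan.
- rewrite cats0 !map_cat; congr (_ ++ _).
    apply/esym/body_map => s; rewrite edge_map_Epos //= /gC0 /Ecap.
      by case: ltnP => /=; rewrite ?andbT ?andbF //= leqn0 => /eqP ->.
    by rewrite ltnNge leqnSn /= gtn_eqF.
  rewrite (twist_quads_map (pos' := fun k s => Some (Ecap n k s))) //.
  apply/esym/twist_quads_map => k s kn; rewrite edge_map_Epos ?leqW //= /gC0 /Ecap.
  by case: (ltngtP k n) kn => // [kn|->] _; rewrite ?andbT ?andbF.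
- move=> p; rewrite mem_joins0 => /orP[] /eqP ->; rewrite !edge_map_Epos //= /gC0 ?ltnn ?eqxx ?(ltnNge _ n) ?leqnSn ?ltnSn ?gtn_eqF //.
- move=> k s kn; rewrite /gC0; case: ltnP => //= h; first exact: ltnW.
  by case: eqP => //= _; case: s.
- move=> k s kn; rewrite /gC0; case: (ltngtP k n) => [kn'|kn'|->] /=.
  + by rewrite (ltn_eqF kn') /= eqxx.
  + have -> : k = n.+1 by lia.
    by case: s; rewrite /= ?eqxx /= ?eqxx.
  + by rewrite andbF /= !inE; case: s; rewrite !eqxx ?orbT.
- move=> k s; case: (ltngtP k n) => // [kn|->] _.
    by exists k, s; rewrite /gC0 kn; split=> //; apply: leqW; apply: ltnW.
  by case: s; [exists n.+1, true | exists n, false]; split=> //; rewrite /gC0 ?ltnn ?eqxx // ltnNge leqnSn /= gtn_eqF.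
Qed.

End Maps.

Section Penultimate.
Variable n : nat.
Definition gP (k : nat) (s : bool) := Some ((k - (n < k))%N, s).

(** Removing the penultimate crossing turns the last crossing of [Kan n.+2] into that of [Kan n.+1]:
    this relates consecutive saddles. *)
Lemma smooth_penultimate :
  @smoothing (Kan n.+2) (Kan n.+1)
    (body n.+2 (Epos n.+2 0) (Epos n.+2 n.+2) ++ twist_quads (Epos n.+2) n)
    [:: (Epos n.+2 n.+1 true, Epos n.+2 n.+1 false, Epos n.+2 n.+2 false, Epos n.+2 n.+2 true)]
    (Epos n.+2 n true, Epos n.+2 n false, Epos n.+2 n.+1 false, Epos n.+2 n.+1 true) true (edge_map gP).
Proof.
apply: (edge_map_smoothing (h := fun o => if o is Some (k, s) then
   if k == n.+1 then (n.+2, s) else (k, s) else (0%N, false))).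
- by rewrite (arcs_Kan n.+2) !twist_quads_recr -!catA.
- exact: arcs_Kan.
- rewrite twist_quads_recr !map_cat -!catA; congr (_ ++ _).
    by apply/esym/body_map => s; rewrite edge_map_Epos //= /gP ?subSS ?subn0 // ltnS leqnSn subn1.
  congr (_ ++ _).
    rewrite (twist_quads_map (pos' := fun k s => Some (Epos n.+1 k s))) //.
    apply/esym/twist_quads_map => k s kn; rewrite edge_map_Epos ?leqW //= /gP.
    by rewrite ltnNge kn subn0.
  congr (_ :: _); rewrite !quad_mapE !edge_map_Epos // /gP ltnSn ltnS leqnSn /= !subn1.
  by [].
- move=> p; rewrite mem_joins1 => /orP[] /eqP ->; rewrite !edge_map_Epos //= /gP ?ltnn ?ltnSn ?subn0 ?subn1 //; lia.
- by move=> k s kn; rewrite /gP /=; lia.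
- move=> k s kn; rewrite /gP; case: (ltngtP n k) => [kn'|kn'|->].
  + rewrite subn1; case: (eqVneq k n.+1) => [->|kn1] /=.
      by rewrite ltn_eqF // !inE; case: s; rewrite !eqxx ?orbT.
    have -> : k = n.+2 by lia.
    by rewrite [_.-1]/= eqxx /= eqxx.
  + by rewrite subn0 ltn_eqF ?eqxx // leqW.
  + by rewrite subn0 ltn_eqF ?eqxx.
- move=> k s kn; case: (eqVneq k n.+1) => [->|kn1].
    by exists n.+2, s; rewrite /gP ltnS leqnSn subn1.
  by exists k, s; rewrite /gP; split; [lia|congr (Some (_, _)); lia].
Qed.
End Penultimate.

(** * Cube differentials under smoothing *)

Section Restrict.
Variables (D D' : diagram) (L1 L2 : seq (quad (edge D))) (a : quad (edge D)) (b : bool)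
  (f : edge D -> option (edge D')).
Hypothesis sm : @smoothing D D' L1 L2 a b f.
Local Notation idx := (sm_index sm).
Local Notation hit := [exists e, f e == None].

Definition restrict c (x : chain D) : chain D' := [ffun s => x (pull sm s c)].

Lemma pull_nohit s c d : ~~ hit -> pull sm s c = pull sm s d.
Proof.
move=> /existsPn nh; apply: state_ext => //; apply/ffunP => e; rewrite !label_pull.
by case Ee: (f e) => //; have := nh e; rewrite Ee.
Qed.

Lemma sum_lift (P : pred 'I_(size (crossings D))) (F : 'I_(size (crossings D)) -> rat) :
  \sum_(k | P k) F k = (if P idx then F idx else 0) + \sum_(k | P (sm_lift sm k)) F (sm_lift sm k).
Proof.
rewrite big_mkcond (bigD1 idx) //= [in RHS]big_mkcond /=; congr (_ + _).
rewrite -(big_imset (fun k => if P k then F k else 0) (in2W (@sm_lift_inj _ _ _ _ _ _ _ sm))) /=.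
apply: eq_bigl => k; case: (smP_ sm k) => [->|k' ->].
  by rewrite eqxx; apply/esym/imsetP => -[k' _ E0]; have := sm_lift_index sm k'; rewrite -E0 eqxx.
by rewrite sm_lift_index imset_f.
Qed.

Lemma sum_pull (F : enhanced_state D -> rat) :
  \sum_(s | marker s idx == b) F s =
  \sum_s F (pull sm s true) + (if hit then \sum_s F (pull sm s false) else 0).
Proof.
have pull_injc c : injective ((pull sm)^~ c) by move=> s t; apply: pull_inj.
case: ifP => [/existsP[e /eqP Ee]|/negbT nh].
  rewrite (bigID (fun s => label s e)) /=.
  rewrite -!(big_imset F (in2W (pull_injc _))) /=.
  congr (_ + _); apply: eq_bigl => s; apply/andP/imsetP => [[/eqP sj se]|[t _ ->]].
  - have [t [c E0]] := pull_surj sj; exists t => //; rewrite E0.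
    by move: se; rewrite E0 label_pull Ee => ->.
  - by rewrite marker_pull_index label_pull Ee.
  - have [t [c E0]] := pull_surj sj; exists t => //; rewrite E0.
    by move: se; rewrite E0 label_pull Ee => /negPf ->.
  - by rewrite marker_pull_index label_pull Ee.
rewrite addr0 -(big_imset F (in2W (pull_injc _))) /=; apply: eq_bigl => s.
apply/eqP/imsetP => [sj|[t _ ->]]; last exact: marker_pull_index.
by have [t [c ->]] := pull_surj sj; exists t => //; apply: pull_nohit.
Qed.

Hypothesis L2_nil : L2 = [::].

Lemma index_ltn (k : 'I_(size (crossings D'))) : (k < size L1)%N.
Proof. by have := ltn_ord k; rewrite [ltnRHS](sm_size' sm) (congr1 size L2_nil) addn0. Qed.

Lemma sm_lift_val k : sm_lift sm k = k :> nat.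
Proof.
by rewrite /= /bump leqNgt index_ltn.
Qed.

Lemma sm_lift_ltn_index k : (sm_lift sm k < idx)%N.
Proof. by rewrite sm_lift_val index_ltn. Qed.

(** The smoothed crossing comes last, so its marker does not enter the signs of the others. *)
Lemma cube_sign_lift k s c : cube_sign (sm_lift sm k) (pull sm s c) = cube_sign k s.
Proof.
rewrite /cube_sign; congr (_ ^+ _); rewrite -[RHS](card_imset _ (@sm_lift_inj _ _ _ _ _ _ _ sm)).
apply: eq_card => l; rewrite inE; apply/andP/imsetP => [[lk]|[l' + ->]].
  case: (smP_ sm l) lk => [->|l' ->].
    by rewrite ltnNge ltnW // sm_lift_ltn_index.
  by rewrite !sm_lift_val marker_pull_lift => lk ml; exists l'; rewrite // inE lk.
by rewrite inE => /andP[lk ml]; rewrite !sm_lift_val marker_pull_lift lk.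
Qed.

Lemma cube_sign_index s c : cube_sign idx (pull sm s c) = (-1) ^+ height s.
Proof.
rewrite /cube_sign /height; congr (_ ^+ _); rewrite -[RHS](card_imset _ (@sm_lift_inj _ _ _ _ _ _ _ sm)).
apply: eq_card => l; rewrite inE; apply/andP/imsetP => [[lk]|[l' + ->]].
  case: (smP_ sm l) lk => [->|l' ->]; first by rewrite ltnn.
  by rewrite marker_pull_lift => lk ml; exists l'; rewrite // inE.
by rewrite inE => ml; rewrite sm_lift_ltn_index marker_pull_lift.
Qed.

(** No arrow leads from the 1-face back to the 0-face: restriction to the 0-face commutes with the
    differential, while the 1-face also receives the arrows along the smoothed crossing. *)
Lemma diff_pull (x : chain D) t d :
  diff_fun x (pull sm t d) = diff_fun (restrict d x) t +
  (if b then \sum_(s | incident idx s (pull sm t d)) cube_sign idx s * x s else 0).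
Proof.
rewrite [LHS]ffunE.
under eq_bigr => s _ do rewrite sum_lift.
rewrite big_split /= addrC; congr (_ + _); last first.
  rewrite -big_mkcond /=; have [b1|b0] : b \/ b = false by case: (b); auto.
    by rewrite [RHS]ifT.
  rewrite [RHS]ifF //; apply: big_pred0 => s.
  rewrite incidentE; case: (boolP (~~ _)) => //= sk; apply: contraFF b0 => /and3P[/forallP/(_ idx)].
  by rewrite eqxx orbT marker_pull_index => /eqP.
rewrite [in RHS]ffunE (bigID (fun s => marker s idx == b)) /= [X in _ + X]big1 ?addr0; last first.
  move=> s sb; apply: big_pred0 => k; apply: incident_pullN.
  by rewrite marker_pull_index.
have body c s : \sum_(k | incident (sm_lift sm k) (pull sm s c) (pull sm t d))
    cube_sign (sm_lift sm k) (pull sm s c) * x (pull sm s c) =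
   if hit ==> (c == d) then \sum_(k | incident k s t) cube_sign k s * restrict c x s else 0.
  under eq_bigl => k do rewrite pull_incident.
  case: (_ ==> _); last by apply: big_pred0 => k; rewrite andbF.
  by apply: eq_big => [k|k _]; rewrite ?andbT ?cube_sign_lift ?ffunE.
rewrite sum_pull; case: (boolP hit) => [h|nh].
  under eq_bigr => s _ do rewrite body h /=.
  under [X in _ + X]eq_bigr => s _ do rewrite body h /=.
  by case: d {body} => /=; [rewrite big1_eq addr0 | rewrite big1_eq add0r].
rewrite addr0; apply: eq_bigr => s _; rewrite (pull_nohit s true d) // body.
by rewrite eqxx implybT.
Qed.
End Restrict.

Lemma agree_off_sym D (v : {ffun 'I_(size (crossings D)) -> bool}) es (s t : enhanced_state D) :
  agree_off v es s t = agree_off v es t s.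
Proof. by rewrite /agree_off; apply: eq_forallb => e; rewrite [label s e == _]eq_sym. Qed.

(** * A circle merging into another one *)

Section Merge.
Variables (D D' : diagram) (k : 'I_(size (crossings D))) (s t : enhanced_state D)
  (s' t' : enhanced_state D') (c : bool) (h : edge D -> option (edge D')) (e0 : edge D').
Hypotheses
  (sk : ~~ marker s k) (mst : agree_except k s t = (marker t' == marker s'))
  (ls : forall e, label s e = if h e is Some e' then label s' e' else c)
  (lt : forall e, label t e = label t' (odflt e0 (h e)))
  (cn : forall e1 e2, connect (adj (marker s)) e1 e2 =
                      orel (connect (adj (marker s'))) (h e1) (h e2))
  (hk : forall e, e \in ends (arcs (xing k)) -> h e = None \/ h e = Some e0)
  (hN : has (fun e => h e == None) (ends (arcs (xing k))))
  (hS : has (fun e => h e == Some e0) (ends (arcs (xing k))))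
  (cs : circle_sign s = circle_sign s' + sgn_of c) (ct : circle_sign t = circle_sign t')
  (hsurj : forall e', exists e, h e = Some e').

Lemma incident_merge : incident k s t = if c then s' == t' else times_X e0 s' t'.
Proof.
have touch e : has (connect (adj (marker s)) e) (ends (arcs (xing k))) =
    if h e is Some e' then connect (adj (marker s')) e' e0 else true.
  apply/hasP/idP => [[x xk]|].
    rewrite cn; case: (hk xk) => ->; first by case: (h e).
    by case: (h e).
  case Ee: (h e) => [e'|] H.
    by have /hasP[x xk /eqP hx] := hS; exists x; rewrite // cn Ee hx.
  by have /hasP[x xk /eqP hx] := hN; exists x; rewrite // cn Ee hx.
have ag : agree_off (marker s) (ends (arcs (xing k))) s t = agree_off (marker s') [:: e0] s' t'.
  apply/forallP/forallP => H e.
    have [x Ex] := hsurj e; have := H x.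
    by rewrite touch ls lt Ex /= orbF.
  rewrite touch ls lt; case Ee: (h e) => [e'|] //=.
  by have := H e'; rewrite /= orbF.
rewrite incidentE sk mst ag cs ct /=.
case: (eqVneq (marker t') (marker s')) => [Em|nm] /=; last first.
  rewrite /times_X (negPf nm) /=; case: c => //; apply/esym/eqP => E0.
  by rewrite E0 eqxx in nm.
case: (boolP (agree_off (marker s') [:: e0] s' t')) => [ago|nag] /=; last first.
  rewrite /times_X (negPf nag) !andbF; case: c => //; apply/esym/eqP => E0.
  by case/negP: nag; rewrite -E0; apply/forallP => e; rewrite eqxx implybT.
rewrite /times_X Em eqxx ago andbT /=.
(* The states agree away from [e0], so the two labels at [e0] decide; the circle signs select the
   pairs occurring in the product. *)
case: (boolP (label s' e0)) => ls0; case: (boolP (label t' e0)) => lt0 /=.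
- have -> : s' = t' by apply: (agree_off_eq Em ago); rewrite ls0 lt0.
  by rewrite eqxx; case: (c) => /=; apply/eqP; lia.
- have Ec := circle_sign_flip Em ago ls0 lt0.
  have -> : (s' == t') = false by apply: contraNF lt0 => /eqP <-.
  by case: (c) => /=; apply/eqP; lia.
- rewrite agree_off_sym -Em in ago.
  have Ec := circle_sign_flip (esym Em) ago lt0 ls0.
  have -> : (s' == t') = false by apply: contraNF ls0 => /eqP ->.
  by case: (c) => /=; apply/eqP; lia.
- have -> : s' = t' by apply: (agree_off_eq Em ago); rewrite (negPf ls0) (negPf lt0).
  by rewrite eqxx; case: (c) => /=; apply/eqP; lia.
Qed.
End Merge.

(** * Multiplication by X, signs and degrees *)

Section Operators.
Variable D : diagram.
Definition op_X (e : edge D) (x : chain D) : chain D :=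
  [ffun t => \sum_(s | times_X e s t) x s].
(** This is the cube sign at a last crossing, which all the others precede. *)
Definition esign (x : chain D) : chain D := [ffun s => (-1) ^+ height s * x s].
(** The homological and quantum degrees before the shifts by the numbers of positive and negative
    crossings. *)
Definition homog (h c : int) (x : chain D) : Prop :=
  forall s, x s != 0 -> (height s)%:Z = h /\ circle_sign s = c.
End Operators.

Section RestrictOperators.
Variables (D D' : diagram) (L1 L2 : seq (quad (edge D))) (a : quad (edge D)) (b : bool)
  (f : edge D -> option (edge D')).
Hypothesis sm : @smoothing D D' L1 L2 a b f.
Local Notation hit := [exists e, f e == None].

Lemma sum_marker (P : pred (enhanced_state D)) (F : enhanced_state D -> rat) :
  (forall s, P s -> marker s (sm_index sm) = b) ->
  \sum_(s | P s) F s =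
  \sum_(s | P (pull sm s true)) F (pull sm s true)
  + (if hit then \sum_(s | P (pull sm s false)) F (pull sm s false) else 0).
Proof.
move=> HP; rewrite big_mkcond.
rewrite (bigID (fun s => marker s (sm_index sm) == b)) /= [X in _ + X]big1 ?addr0; last first.
  by move=> s; apply: contraNeq; case: ifP => [/HP -> //|]; rewrite eqxx.
rewrite (sum_pull sm); congr (_ + _); first by rewrite -big_mkcond.
by case: ifP => // _; rewrite -big_mkcond.
Qed.

Lemma op_X_pull e e' x t d : f e = Some e' ->
  op_X e x (pull sm t d) = op_X e' (restrict sm d x) t.
Proof.
move=> Ee; rewrite [LHS]ffunE sum_marker => [|s]; last first.
  by rewrite /times_X => /andP[/eqP <- _]; rewrite marker_pull_index.
have red c : \sum_(s | times_X e (pull sm s c) (pull sm t d)) x (pull sm s c) =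
    if hit ==> (c == d) then op_X e' (restrict sm d x) t else 0.
  under eq_bigl => s do rewrite (pull_times_X sm _ _ _ _ Ee).
  case: (boolP hit) => [h|nh] /=.
    case: eqP => [->|_]; last by apply: big_pred0 => s; rewrite andbF.
    by rewrite ffunE; apply: eq_big => [s|s _]; rewrite ?andbT ?ffunE.
  by rewrite ffunE; apply: eq_big => [s|s _]; rewrite ?andbT ?ffunE // (pull_nohit sm s c d).
rewrite !red; case: hit => /=; last by rewrite addr0.
by case: d {red}; rewrite /= ?addr0 ?add0r.
Qed.

Lemma homog_restrict h c x d : homog h c x ->
  homog (h - b%:Z) (c - if hit then sgn_of d else 0) (restrict sm d x).
Proof.
move=> Hx s; rewrite ffunE => /Hx; rewrite height_pull circle_sign_pull => -[<- <-].
by split; [lia | rewrite addrK].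
Qed.

End RestrictOperators.

Lemma edge_map_nohit n g : (forall k s, (k <= n.+1)%N -> g k s != None) ->
  [exists e, edge_map (n := n) g e == None] = false.
Proof.
move=> H; apply/existsP => -[[x|[[i s]|x]]] //=.
by have := H i s (ltn_ord i); case: (g i s).
Qed.

Lemma nohit_K0 n : [exists e, @edge_map n (gK0 n) e == None] = false.
Proof. by apply: edge_map_nohit => k s _; rewrite /gK0; case: ifP. Qed.
Lemma nohit_K1 n : [exists e, @edge_map n (gK1 n) e == None] = false.
Proof. by apply: edge_map_nohit => k s _; rewrite /gK1. Qed.
Lemma nohit_C1 n : [exists e, @edge_map n (gC1 n) e == None] = false.
Proof. by apply: edge_map_nohit => k s _; rewrite /gC1; case: ifP. Qed.
Lemma gC0_None n : @edge_map n (gC0 n) (Epos n.+1 n.+1 false) = None.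
Proof. by rewrite edge_map_Epos // /gC0 ltnNge leqnSn /= gtn_eqF. Qed.
Lemma hit_C0 n : [exists e, @edge_map n (gC0 n) e == None] = true.
Proof. by apply/existsP; exists (Epos n.+1 n.+1 false); rewrite gC0_None. Qed.

(** The two sides of the saddle that leads from [CapKan n] to [Kan n]. *)
Definition cap_end n : edge (CapKan n) := Epos n n false.
Definition cap_bot n : edge (CapKan n) := Epos n n true.

Lemma gC1_end n : @edge_map n (gC1 n) (cap_end n.+1) = Some (cap_end n).
Proof. by rewrite /cap_end edge_map_Epos // /gC1 ltnNge leqnSn /= andbF. Qed.
Lemma gC1_bot n : @edge_map n (gC1 n) (cap_bot n.+1) = Some (cap_bot n).
Proof. by rewrite /cap_bot edge_map_Epos // /gC1 ltnNge leqnSn /= ltnSn. Qed.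
Lemma gC0_bot n : @edge_map n (gC0 n) (cap_bot n.+1) = Some (cap_bot n).
Proof. by rewrite /cap_bot edge_map_Epos // /gC0 ltnNge leqnSn /= gtn_eqF. Qed.

(** * The cones at the last crossing *)

Definition capP n : chain (CapKan n.+1) -> chain (CapKan n) := restrict (smooth_CapKan0 n) true.
Definition capM n : chain (CapKan n.+1) -> chain (CapKan n) := restrict (smooth_CapKan0 n) false.
Definition cap1 n : chain (CapKan n.+1) -> chain (CapKan n) := restrict (smooth_CapKan1 n) true.
Definition kan0 n : chain (Kan n.+1) -> chain (CapKan n) := restrict (smooth_Kan0 n) true.
Definition kan1 n : chain (Kan n.+1) -> chain (Kan n) := restrict (smooth_Kan1 n) true.

Lemma K0K1_index n : sm_index (smooth_Kan0 n) = sm_index (smooth_Kan1 n).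
Proof. exact: val_inj. Qed.
Lemma C0C1_index n : sm_index (smooth_CapKan0 n) = sm_index (smooth_CapKan1 n).
Proof. exact: val_inj. Qed.

(** Up to sign, the component of the differential of [Kan n.+1] from the 0-smoothing to
    the 1-smoothing of the last crossing. *)
Definition saddle n (x : chain (CapKan n)) : chain (Kan n) :=
  [ffun t => \sum_(s | incident (sm_index (smooth_Kan0 n)) (pull (smooth_Kan0 n) s true)
                                (pull (smooth_Kan1 n) t true)) (-1) ^+ height s * x s].

Lemma diff_kan0 n x : kan0 (diff_fun x) = diff_fun (kan0 x) :> chain (CapKan n).
Proof. by apply/ffunP => t; rewrite [LHS]ffunE diff_pull // addr0. Qed.

Lemma diff_kan1 n x :
  kan1 (diff_fun x) = diff_fun (kan1 x) + saddle (kan0 x) :> chain (Kan n).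
Proof.
apply/ffunP => t; rewrite [LHS]ffunE diff_pull // [RHS]ffunE; congr (_ + _).
rewrite (sum_marker (sm := smooth_Kan0 n)) => [|s].
  rewrite nohit_K0 addr0 [RHS]ffunE -K0K1_index; apply: eq_bigr => s _.
  by rewrite cube_sign_index // [kan0 _ _]ffunE.
by rewrite -K0K1_index incidentE => /andP[/negPf ->].
Qed.

Lemma diff_capP n x : capP (diff_fun x) = diff_fun (capP x) :> chain (CapKan n).
Proof. by apply/ffunP => t; rewrite [LHS]ffunE diff_pull // addr0. Qed.
Lemma diff_capM n x : capM (diff_fun x) = diff_fun (capM x) :> chain (CapKan n).
Proof. by apply/ffunP => t; rewrite [LHS]ffunE diff_pull // addr0. Qed.

Lemma gC01 n e : @edge_map n (gC1 n) e = Some (odflt (cap_end n) (@edge_map n (gC0 n) e)).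
Proof.
case: e => [x|[[i s]|x]] //; rewrite -[i]inord_val -/(Epos _ _ _).
have := ltn_ord i; rewrite ltnS => kn; rewrite !edge_map_Epos //.
by rewrite /gC0 /gC1; case: (ltngtP i n) => //= _; case: s.
Qed.

(** The 0-smoothing separates a small circle from the cap and the 1-smoothing reunites them, so the
    arrow between them is a merge. *)
Lemma incident_cap1 n s' t' c :
  incident (sm_index (smooth_CapKan0 n)) (pull (smooth_CapKan0 n) s' c)
     (pull (smooth_CapKan1 n) t' true)
  = if c then s' == t' else times_X (cap_end n) s' t'.
Proof.
apply: (@incident_merge (CapKan n.+1) (CapKan n) _ _ _ s' t' c (@edge_map n (gC0 n)) (cap_end n)).
- by rewrite marker_pull_index.
- apply/forallP/eqP => [H|E0 l].
    apply/ffunP => l; have := H (sm_lift (smooth_CapKan0 n) l).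
    rewrite (negPf (sm_lift_index _ _)) orbF marker_pull_lift => /eqP <-.
    rewrite -(marker_pull_lift (smooth_CapKan1 n) t' true); congr (marker _ _).
    by apply: ord_inj; rewrite !sm_lift_val.
  case: (smP_ (smooth_CapKan0 n) l) => [->|l' ->].
    by rewrite eqxx orbT C0C1_index marker_pull_index.
  rewrite (negPf (sm_lift_index _ _)) orbF marker_pull_lift -E0.
  rewrite -(marker_pull_lift (smooth_CapKan1 n) t' true); apply/eqP; congr (marker _ _).
  by apply: ord_inj; rewrite !sm_lift_val.
- by move=> e; rewrite label_pull.
- by move=> e; rewrite label_pull gC01.
- by move=> e1 e2; rewrite marker_pull pull_connect.
- rewrite sm_arcs_index => e; rewrite !inE => /or4P[] /eqP ->;
    rewrite ?gC0_None ?edge_map_Epos // /gC0 ?ltnn ?eqxx; by [left | right].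
- by rewrite sm_arcs_index; apply/hasP; exists (Epos n.+1 n.+1 false); rewrite ?inE ?eqxx ?orbT // gC0_None.
- by rewrite sm_arcs_index; apply/hasP; exists (Epos n.+1 n false); rewrite ?inE ?eqxx ?orbT // edge_map_Epos // /gC0 ltnn eqxx.
- by rewrite circle_sign_pull hit_C0.
- by rewrite circle_sign_pull nohit_C1 addr0.
- exact: smS (smooth_CapKan0 n).
Qed.

(** The complex of [CapKan n.+1] is the cone of the merge, whose restriction to the v_+ part [capP]
    is invertible. This is the algebra behind the first Reidemeister move. *)
Lemma diff_cap1 n x :
  cap1 (diff_fun x) = diff_fun (cap1 x) + esign (capP x + op_X (cap_end n) (capM x)).
Proof.
apply/ffunP => t; rewrite [LHS]ffunE diff_pull // [RHS]ffunE; congr (_ + _).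
rewrite (sum_marker (sm := smooth_CapKan0 n)) => [|s]; last first.
  by rewrite -C0C1_index incidentE => /andP[/negPf ->].
rewrite hit_C0 -C0C1_index.
under eq_bigl => s do rewrite incident_cap1.
under [X in _ + X]eq_bigl => s do rewrite incident_cap1.
rewrite big_pred1_eq cube_sign_index // ffunE ffunE mulrDr [capP _ _]ffunE; congr (_ + _).
rewrite [op_X _ _ _]ffunE mulr_sumr; apply: eq_bigr => s st.
rewrite cube_sign_index // [capM _ _]ffunE; congr (_ ^+ _ * _).
by rewrite /height; case/andP: st => /eqP ->.
Qed.

Lemma bot_capP n x : capP (op_X (cap_bot n.+1) x) = op_X (cap_bot n) (capP x).
Proof. by apply/ffunP => t; rewrite [LHS]ffunE (op_X_pull (smooth_CapKan0 n) _ _ _ (gC0_bot n)). Qed.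
Lemma bot_capM n x : capM (op_X (cap_bot n.+1) x) = op_X (cap_bot n) (capM x).
Proof. by apply/ffunP => t; rewrite [LHS]ffunE (op_X_pull (smooth_CapKan0 n) _ _ _ (gC0_bot n)). Qed.
Lemma bot_cap1 n x : cap1 (op_X (cap_bot n.+1) x) = op_X (cap_bot n) (cap1 x).
Proof. by apply/ffunP => t; rewrite [LHS]ffunE (op_X_pull (smooth_CapKan1 n) _ _ _ (gC1_bot n)). Qed.
Lemma end_cap1 n x : cap1 (op_X (cap_end n.+1) x) = op_X (cap_end n) (cap1 x).
Proof. by apply/ffunP => t; rewrite [LHS]ffunE (op_X_pull (smooth_CapKan1 n) _ _ _ (gC1_end n)). Qed.

(** After the 0-smoothing the cap of [CapKan n.+1] is the circle split off, so X there only carries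
    the v_+ part to the v_- part. *)
Lemma end_capP n x : capP (op_X (cap_end n.+1) x) = 0 :> chain (CapKan n).
Proof.
apply/ffunP => t; rewrite !ffunE; apply: big_pred0 => s.
by rewrite /times_X label_pull gC0_None /= !andbF.
Qed.

Lemma times_X_end n (s t : enhanced_state (CapKan n)) c :
  times_X (cap_end n.+1) (pull (smooth_CapKan0 n) s c) (pull (smooth_CapKan0 n) t false)
  = c && (s == t).
Proof.
rewrite /times_X !label_pull gC0_None; case: c => /=; last by rewrite andbF.
apply/andP/eqP => [[/eqP Em ag]|->]; last first.
  split=> //; apply/forallP => e; rewrite has_seq1 !label_pull marker_pull pull_connect gC0_None.
  by case: (edge_map _ e) => //= e'; rewrite eqxx.
apply: (@state_ext (CapKan n) s t); first by apply/esym/(@pull_marker_inj _ _ _ _ _ _ _ (smooth_CapKan0 n)).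
apply/ffunP => e'; have [e Ee] := smS (smooth_CapKan0 n) e'.
have /forallP/(_ e) := ag; rewrite has_seq1 !label_pull marker_pull pull_connect Ee gC0_None /=.
by move/eqP.
Qed.

Lemma end_capM n x : capM (op_X (cap_end n.+1) x) = capP x :> chain (CapKan n).
Proof.
apply/ffunP => t; rewrite !ffunE (sum_marker (sm := smooth_CapKan0 n)) => [|s]; last first.
  by rewrite /times_X => /andP[/eqP <- _]; rewrite marker_pull_index.
rewrite hit_C0.
under eq_bigl => s do rewrite times_X_end.
under [X in _ + X]eq_bigl => s do rewrite times_X_end.
by rewrite big_pred1_eq big_pred0_eq addr0.
Qed.

Section EdgeCases.
Variables (n : nat) (P : kanenobu_edge n 0 -> Prop).
Lemma edge_cases : (forall x, P (inl x)) -> (forall k s, (k <= n)%N -> P (Epos n k s)) ->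
  (forall x, P (inr (inr x))) -> forall e, P e.
Proof.
move=> H1 H2 H3 [x|[[i s]|x]] //; rewrite -[i]inord_val; apply: H2.
by rewrite -ltnS.
Qed.
End EdgeCases.

Lemma le2_cases n k : (k <= n.+2)%N -> [\/ (k < n)%N, k = n, k = n.+1 | k = n.+2].
Proof.
move=> kn; case: (ltnP k n) => [|h1]; first by constructor 1.
case: (eqVneq k n) => h2; first by constructor 2.
by case: (eqVneq k n.+1) => h3; [constructor 3 | constructor 4; lia].
Qed.

(** * Smoothing the last two crossings *)

Section Compose.
Variable n : nat.

Lemma gK0_lt k s : (k < n)%N -> gK0 n k s = Some (k, s).
Proof. by rewrite /gK0 => ->. Qed.
Lemma gK0_eq s : gK0 n n s = Some (n, false).
Proof. by rewrite /gK0 ltnn. Qed.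
Lemma gK0_S s : gK0 n n.+1 s = Some (n, true).
Proof. by rewrite /gK0 ltnNge leqnSn /= ltnSn. Qed.
Lemma gC1_lt k s : (k < n)%N -> gC1 n k s = Some (k, s).
Proof. by rewrite /gC1 => ->. Qed.
Lemma gC1_eq s : gC1 n n s = Some (n, false).
Proof. by rewrite /gC1 ltnn. Qed.
Lemma gC1_S s : gC1 n n.+1 s = Some (n, s).
Proof. by rewrite /gC1 ltnNge leqnSn /= ltnSn. Qed.
Lemma gC0_lt k s : (k < n)%N -> gC0 n k s = Some (k, s).
Proof. by rewrite /gC0 => ->. Qed.
Lemma gC0_eq s : gC0 n n s = Some (n, false).
Proof. by rewrite /gC0 ltnn eqxx. Qed.
Lemma gC0_S s : gC0 n n.+1 s = if s then Some (n, true) else None.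
Proof. by rewrite /gC0 ltnNge leqnSn /= gtn_eqF. Qed.
Lemma gK1_le k s : (k <= n)%N -> gK1 n k s = Some (k, s).
Proof. by rewrite /gK1 => /minn_idPl ->. Qed.
Lemma gK1_S s : gK1 n n.+1 s = Some (n, s).
Proof. by rewrite /gK1 (minn_idPr _). Qed.
Lemma gP_le k s : (k <= n)%N -> gP n k s = Some (k, s).
Proof. by rewrite /gP ltnNge => ->; rewrite subn0. Qed.
Lemma gP_gt k s : (n < k)%N -> gP n k s = Some (k.-1, s).
Proof. by rewrite /gP => ->; rewrite subn1. Qed.
End Compose.

Definition gE := (gK0_eq, gK0_S, gC1_eq, gC1_S, gC0_eq, gC0_S, gK1_S).

Lemma obind_Epos m T (F : kanenobu_edge m 0 -> option T) k s :
  obind F (omap (fun p => Epos m p.1 p.2) (Some (k, s))) = F (Epos m k s).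
Proof. by []. Qed.

Lemma gK0_gC1 n e :
  obind (@edge_map n (gC1 n)) (@edge_map n.+1 (gK0 n.+1) e) =
  obind (@edge_map n (gK0 n)) (@edge_map n.+1 (gP n) e).
Proof.
elim/edge_cases: e => // k s kn; rewrite !(edge_map_Epos (n := n.+1)) //.
case: (le2_cases kn) => [h|->|->|->].
- by rewrite gK0_lt ?gP_le ?(ltnW h) ?(leqW h) // !obind_Epos !edge_map_Epos ?gC1_lt ?gK0_lt // leqW // ltnW.
- by rewrite gK0_lt ?gP_le // !obind_Epos !edge_map_Epos // !gE.
- by rewrite gP_gt // !gE !obind_Epos !edge_map_Epos // !gE.
- by rewrite gP_gt // !gE !obind_Epos !edge_map_Epos // !gE.
Qed.

Lemma gK1_gK1 n e :
  obind (@edge_map n (gK1 n)) (@edge_map n.+1 (gK1 n.+1) e) =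
  obind (@edge_map n (gK1 n)) (@edge_map n.+1 (gP n) e).
Proof.
elim/edge_cases: e => // k s kn; rewrite !(edge_map_Epos (n := n.+1)) //.
case: (le2_cases kn) => [h|->|->|->].
- by rewrite gK1_le ?gP_le ?(ltnW h) ?(leqW (ltnW h)).
- by rewrite gK1_le ?gP_le.
- by rewrite gK1_le // gP_gt // !obind_Epos !edge_map_Epos // !gE gK1_le.
- by rewrite gP_gt // !gE.
Qed.

(** Both last crossings are 0-smoothed; the two edges between them close into a circle and go to
    [None]. *)
Definition merge_map n (e : kanenobu_edge n.+2 0) :=
  obind (@edge_map n (gC0 n)) (@edge_map n.+1 (gK0 n.+1) e).

Lemma gK1_gK0 n e :
  obind (@edge_map n (gK0 n)) (@edge_map n.+1 (gK1 n.+1) e) =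
  Some (odflt (cap_bot n) (merge_map e)).
Proof.
rewrite /merge_map.
elim/edge_cases: e => // k s kn; rewrite !(edge_map_Epos (n := n.+1)) //.
case: (le2_cases kn) => [h|->|->|->].
- by rewrite gK1_le ?gK0_lt ?(ltnW h) ?(leqW (ltnW h)) ?(leqW h) // !obind_Epos !edge_map_Epos ?gK0_lt ?gC0_lt // leqW // ltnW.
- by rewrite gK1_le ?gK0_lt // !obind_Epos !edge_map_Epos // !gE.
- by rewrite gK1_le // !gE !obind_Epos !edge_map_Epos // !gE.
- by rewrite !gE !obind_Epos !edge_map_Epos // !gE.
Qed.

Section PullPull.
Variables D A B D' : diagram.
Variables (L1 L2 : seq (quad (edge D))) (a : quad (edge D)) (b : bool) (f : edge D -> option (edge A)).
Variables (M1 M2 : seq (quad (edge A))) (m : quad (edge A)) (b' : bool) (f' : edge A -> option (edge D')).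
Variables (N1 N2 : seq (quad (edge D))) (o : quad (edge D)) (g : edge D -> option (edge B)).
Variables (P1 P2 : seq (quad (edge B))) (p : quad (edge B)) (g' : edge B -> option (edge D')).
Hypotheses (smA : @smoothing D A L1 L2 a b f) (smA' : @smoothing A D' M1 M2 m b' f').
Hypotheses (smB : @smoothing D B N1 N2 o b' g) (smB' : @smoothing B D' P1 P2 p b g').
Hypotheses (idxB : sm_lift smB (sm_index smB') = sm_index smA)
  (idxA : sm_lift smA (sm_index smA') = sm_index smB)
  (liftE : forall k, sm_lift smA (sm_lift smA' k) = sm_lift smB (sm_lift smB' k))
  (mapE : forall e, obind f' (f e) = obind g' (g e)).

(** Two crossings, one smoothed by [b] and the other by [b'], are removed in either order; [idxA]
    and [idxB] say that each side meets the other's crossing second. *)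
Lemma pull_pull s c : pull smA (pull smA' s c) c = pull smB (pull smB' s c) c.
Proof.
apply: state_ext; apply/ffunP.
  move=> k; case: (smP_ smA k) => [->|k' ->].
    by rewrite -{2}idxB marker_pull_lift !marker_pull_index.
  rewrite marker_pull_lift; case: (smP_ smA' k') => [->|k'' ->].
    by rewrite idxA !marker_pull_index.
  by rewrite liftE !marker_pull_lift.
have lab D1 D2 D3 (f1 : edge D1 -> option (edge D2)) (f2 : edge D2 -> option (edge D3)) l e :
    (if f1 e is Some e' then if f2 e' is Some e'' then l e'' else c else c)
    = if obind f2 (f1 e) is Some e'' then l e'' else c by case: (f1 e).
move=> e; rewrite !label_pull.
transitivity (if obind f' (f e) is Some e'' then label s e'' else c).
  by rewrite -lab; case: (f e) => // e'; rewrite label_pull.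
rewrite mapE -lab; case: (g e) => // e'; by rewrite label_pull.
Qed.
End PullPull.

Section SaddleRecursion.
Variable n : nat.

Lemma size_body_twists m u v (pos : nat -> bool -> kanenobu_edge m 0) k :
  size (body m u v ++ twist_quads pos k) = (8 + k)%N.
Proof. by rewrite size_cat size_map size_iota. Qed.

Lemma val_lift_penultimate k : sm_lift (smooth_penultimate n) k = bump (8 + n) k :> nat.
Proof. by rewrite [LHS]/(bump (size _) k) size_body_twists. Qed.

Lemma val_index_Kan0 m : sm_index (smooth_Kan0 m) = (8 + m)%N :> nat.
Proof. exact: size_body_twists. Qed.
Lemma val_index_Kan1 m : sm_index (smooth_Kan1 m) = (8 + m)%N :> nat.
Proof. exact: size_body_twists. Qed.
Lemma val_index_CapKan1 m : sm_index (smooth_CapKan1 m) = (8 + m)%N :> nat.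
Proof. exact: size_body_twists. Qed.
Lemma val_index_penultimate : sm_index (smooth_penultimate n) = (8 + n)%N :> nat.
Proof. exact: size_body_twists. Qed.

Lemma lift_penultimate :
  sm_lift (smooth_penultimate n) (sm_index (smooth_Kan0 n)) = sm_index (smooth_Kan0 n.+1).
Proof.
by apply: ord_inj; rewrite val_lift_penultimate !val_index_Kan0 /bump leqnn addnS.
Qed.

Lemma pull_K0_C1 (s : enhanced_state (CapKan n)) :
  pull (smooth_Kan0 n.+1) (pull (smooth_CapKan1 n) s true) true =
  pull (smooth_penultimate n) (pull (smooth_Kan0 n) s true) true.
Proof.
apply: pull_pull.
- exact: lift_penultimate.
- by apply: ord_inj; rewrite sm_lift_val // val_index_CapKan1 val_index_penultimate.
- move=> k; apply: ord_inj; rewrite val_lift_penultimate !sm_lift_val // /bump leqNgt.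
  by have := @sm_lift_ltn_index _ _ _ _ _ _ _ (smooth_Kan0 n) erefl k; rewrite sm_lift_val // val_index_Kan0 => ->.
- exact: gK0_gC1.
Qed.

Lemma pull_K1_K1 (s : enhanced_state (Kan n)) :
  pull (smooth_Kan1 n.+1) (pull (smooth_Kan1 n) s true) true =
  pull (smooth_penultimate n) (pull (smooth_Kan1 n) s true) true.
Proof.
apply: pull_pull.
- by rewrite -!K0K1_index lift_penultimate.
- by apply: ord_inj; rewrite sm_lift_val // val_index_Kan1 val_index_penultimate.
- move=> k; apply: ord_inj; rewrite val_lift_penultimate !sm_lift_val // /bump leqNgt.
  by have := @sm_lift_ltn_index _ _ _ _ _ _ _ (smooth_Kan1 n) erefl k; rewrite sm_lift_val // val_index_Kan1 => ->.
- exact: gK1_gK1.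
Qed.

(** Both states 1-smooth the penultimate crossing, which may therefore be removed first. *)
Lemma incident_saddle1 (s : enhanced_state (CapKan n)) (t : enhanced_state (Kan n)) :
  incident (sm_index (smooth_Kan0 n.+1))
    (pull (smooth_Kan0 n.+1) (pull (smooth_CapKan1 n) s true) true)
    (pull (smooth_Kan1 n.+1) (pull (smooth_Kan1 n) t true) true)
  = incident (sm_index (smooth_Kan0 n)) (pull (smooth_Kan0 n) s true) (pull (smooth_Kan1 n) t true).
Proof.
by rewrite pull_K0_C1 pull_K1_K1 -lift_penultimate pull_incident eqxx implybT andbT.
Qed.

Lemma incident_saddle_marker (s : enhanced_state (CapKan n.+1)) (t : enhanced_state (Kan n.+1)) :
  incident (sm_index (smooth_Kan0 n.+1)) (pull (smooth_Kan0 n.+1) s true) (pull (smooth_Kan1 n.+1) t true) ->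
  marker s (sm_index (smooth_CapKan0 n)) = marker t (sm_index (smooth_Kan0 n)).
Proof.
rewrite incidentE => /and3P[_ /forallP H _].
have := H (sm_lift (smooth_Kan0 n.+1) (sm_index (smooth_CapKan0 n))).
rewrite (negPf (sm_lift_index _ _)) orbF marker_pull_lift => /eqP <-.
rewrite -(marker_pull_lift (smooth_Kan1 n.+1) t true); congr (marker _ _).
apply: ord_inj; rewrite !sm_lift_val // val_index_Kan0; exact: val_index_CapKan1.
Qed.

(** The circle between the two 0-smoothed crossings merges downwards into [cap_bot] when the last
    crossing is switched. Switching the penultimate one merges the same circle upwards into
    [cap_end]: hence Y here and X in [diff_cap1]. *)
Lemma incident_saddle0 (s t : enhanced_state (CapKan n)) c :
  incident (sm_index (smooth_Kan0 n.+1))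
    (pull (smooth_Kan0 n.+1) (pull (smooth_CapKan0 n) s c) true)
    (pull (smooth_Kan1 n.+1) (pull (smooth_Kan0 n) t true) true)
  = if c then s == t else times_X (cap_bot n) s t.
Proof.
have nh e : exists e', @edge_map n.+1 (gK0 n.+1) e = Some e'.
  have : ~~ [exists e, @edge_map n.+1 (gK0 n.+1) e == None] by rewrite nohit_K0.
  by move=> /existsPn/(_ e); case: (edge_map _ e) => // e' _; exists e'.
apply: (@incident_merge (Kan n.+2) (CapKan n) _ _ _ s t c (@merge_map n) (cap_bot n)).
- by rewrite marker_pull_index.
- have lft k : sm_lift (smooth_Kan1 n.+1) (sm_lift (smooth_Kan0 n) k) =
               sm_lift (smooth_Kan0 n.+1) (sm_lift (smooth_CapKan0 n) k).
    by apply: ord_inj; rewrite !sm_lift_val // !sm_lift_val.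
  apply/forallP/eqP => [H|E0 l].
    apply/ffunP => l; have := H (sm_lift (smooth_Kan0 n.+1) (sm_lift (smooth_CapKan0 n) l)).
    rewrite (negPf (sm_lift_index _ _)) orbF !marker_pull_lift => /eqP <-.
    by rewrite -lft !marker_pull_lift.
  case: (smP_ (smooth_Kan0 n.+1) l) => [->|l' ->].
    by rewrite eqxx orbT K0K1_index marker_pull_index.
  rewrite (negPf (sm_lift_index _ _)) orbF marker_pull_lift.
  case: (smP_ (smooth_CapKan0 n) l') => [->|l'' ->].
    rewrite marker_pull_index.
    have -> : sm_lift (smooth_Kan0 n.+1) (sm_index (smooth_CapKan0 n)) =
              sm_lift (smooth_Kan1 n.+1) (sm_index (smooth_Kan0 n)).
      by apply: ord_inj; rewrite !sm_lift_val // val_index_Kan0; exact: val_index_CapKan1.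
    by rewrite marker_pull_lift marker_pull_index.
  by rewrite -lft !marker_pull_lift E0.
- by move=> e; rewrite label_pull /merge_map; have [e' ->] := nh e; rewrite label_pull.
- move=> e; rewrite label_pull; have := gK1_gK0 e.
  by case: (@edge_map n.+1 (gK1 n.+1) e) => // e' E0; rewrite label_pull (E0 : @edge_map n (gK0 n) e' = _).
- move=> e1 e2; rewrite marker_pull pull_connect /merge_map.
  have [x1 ->] := nh e1; have [x2 ->] := nh e2.
  change (connect (adj (marker (pull (smooth_CapKan0 n) s c))) x1 x2 =
    orel (connect (adj (marker s))) (@edge_map n (gC0 n) x1) (@edge_map n (gC0 n) x2)).
  by rewrite marker_pull pull_connect.
- rewrite sm_arcs_index => e; rewrite !inE => /or4P[] /eqP ->;
    rewrite /merge_map edge_map_Epos // ?gE !obind_Epos edge_map_Epos // !gE; by [left | right].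
- rewrite sm_arcs_index; apply/hasP; exists (Epos n.+2 n.+1 true).
    by rewrite ?inE ?eqxx ?orbT.
  by rewrite /merge_map edge_map_Epos // ?gE !obind_Epos edge_map_Epos // !gE.
- rewrite sm_arcs_index; apply/hasP; exists (Epos n.+2 n.+2 true).
    by rewrite ?inE ?eqxx ?orbT.
  by rewrite /merge_map edge_map_Epos // ?gE !obind_Epos edge_map_Epos // !gE.
- by rewrite !circle_sign_pull hit_C0 nohit_K0 addr0.
- by rewrite !circle_sign_pull nohit_K1 nohit_K0 !addr0.
- move=> e'; have [e1 E1] := smS (smooth_CapKan0 n) e'.
  have [e E0] := smS (smooth_Kan0 n.+1) e1; exists e.
  by rewrite /merge_map E0 /= E1.
Qed.

Lemma saddle_kan0 x :
  kan0 (saddle x) = esign (capP x + op_X (cap_bot n) (capM x)) :> chain (CapKan n).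
Proof.
apply/ffunP => t; rewrite [LHS]ffunE [LHS]ffunE.
rewrite (sum_marker (sm := smooth_CapKan0 n)) => [|s /incident_saddle_marker ->]; last first.
  by rewrite marker_pull_index.
rewrite hit_C0.
under eq_bigl => s do rewrite incident_saddle0.
under [X in _ + X]eq_bigl => s do rewrite incident_saddle0.
rewrite big_pred1_eq height_pull [RHS]ffunE.
have -> : (capP x + op_X (cap_bot n) (capM x)) t = capP x t + op_X (cap_bot n) (capM x) t.
  by rewrite ffunE.
rewrite mulrDr; congr (_ + _); first by rewrite ffunE.
rewrite [op_X _ _ _]ffunE mulr_sumr; apply: eq_bigr => s st.
rewrite height_pull [capM _ _]ffunE; congr (_ ^+ _ * _).
by rewrite /height; case/andP: st => /eqP ->.
Qed.

Lemma saddle_kan1 (x : chain (CapKan n.+1)) : kan1 (saddle x) = - saddle (cap1 x) :> chain (Kan n).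
Proof.
apply/ffunP => t; rewrite [LHS]ffunE [LHS]ffunE [RHS]ffunE [saddle _ _]ffunE.
rewrite (sum_marker (sm := smooth_CapKan1 n)) => [|s]; last first.
  rewrite -C0C1_index => /incident_saddle_marker ->.
  by rewrite K0K1_index marker_pull_index.
rewrite nohit_C1 addr0 -sumrN; apply: eq_big => [s|s _]; first exact: incident_saddle1.
(* The 1-smoothed penultimate crossing adds one to the height, whence the sign. *)
by rewrite height_pull add1n exprS mulN1r mulNr; congr (- (_ * _)); rewrite ffunE.
Qed.
End SaddleRecursion.

Section Additive.
Variables (D D' : diagram) (L1 L2 : seq (quad (edge D))) (a : quad (edge D)) (b : bool)
  (f : edge D -> option (edge D')).
Hypothesis sm : @smoothing D D' L1 L2 a b f.

Fact restrict_is_additive c : zmod_morphism (restrict sm c).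
Proof. by move=> x y; apply/ffunP => s; rewrite !ffunE. Qed.
Fact op_X_is_additive (e : edge D) : zmod_morphism (op_X e).
Proof.
move=> x y; apply/ffunP => s; rewrite !ffunE -sumrB.
by apply: eq_bigr => t _; rewrite !ffunE.
Qed.
Fact esign_is_additive : zmod_morphism (@esign D).
Proof. by move=> x y; apply/ffunP => s; rewrite !ffunE mulrBr. Qed.
End Additive.
Fact saddle_is_additive n : zmod_morphism (@saddle n).
Proof.
move=> x y; apply/ffunP => s; rewrite !ffunE -sumrB.
by apply: eq_bigr => t _; rewrite !ffunE mulrBr.
Qed.

HB.instance Definition _ D D' L1 L2 a b f sm c := GRing.isZmodMorphism.Build _ _ _
  (@restrict_is_additive D D' L1 L2 a b f sm c).
HB.instance Definition _ D e := GRing.isZmodMorphism.Build _ _ _ (@op_X_is_additive D e).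
HB.instance Definition _ D := GRing.isZmodMorphism.Build _ _ _ (@esign_is_additive D).
HB.instance Definition _ n := GRing.isZmodMorphism.Build _ _ _ (@saddle_is_additive n).
HB.instance Definition _ n := GRing.Additive.copy (@capP n) (restrict (smooth_CapKan0 n) true).

HB.instance Definition _ n := GRing.Additive.copy (@capM n) (restrict (smooth_CapKan0 n) false).
HB.instance Definition _ n := GRing.Additive.copy (@cap1 n) (restrict (smooth_CapKan1 n) true).
HB.instance Definition _ n := GRing.Additive.copy (@kan0 n) (restrict (smooth_Kan0 n) true).
HB.instance Definition _ n := GRing.Additive.copy (@kan1 n) (restrict (smooth_Kan1 n) true).

(** * Degrees and sign rules of the operators *)

Section Homog.
Variable D : diagram.
Implicit Types (x y : chain D) (s t : enhanced_state D).

Lemma incident_height k s t : incident k s t -> height t = (height s).+1.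
Proof.
rewrite incidentE => /and3P[sk /forallP mt _].
rewrite /height (cardsD1 k [set l | marker t l]) !inE (eqP (mt k)) eqxx orbT add1n.
congr _.+1; apply: eq_card => l; rewrite !inE (eqP (mt l)).
by case: eqP => [->|]; rewrite ?orbF // (negPf sk).
Qed.

Lemma incident_circle_sign k s t : incident k s t -> circle_sign t + 1 = circle_sign s.
Proof. by rewrite incidentE => /and4P[_ _ _ /eqP]. Qed.

Lemma homogP h c x : homog h c x <->
  forall s, ((height s)%:Z == h) && (circle_sign s == c) = false -> x s = 0.
Proof.
split=> H s; first by move=> /negbT; apply: contraNeq => /H[-> ->]; rewrite !eqxx.
move=> xs; case E0: (((height s)%:Z == h) && (circle_sign s == c)).
  by case/andP: E0 => /eqP -> /eqP ->.
by rewrite H ?eqxx // in xs.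
Qed.

Lemma homog0 h c : homog h c (0 : chain D).
Proof. by move=> s; rewrite ffunE eqxx. Qed.

Lemma homogD h c x y : homog h c x -> homog h c y -> homog h c (x + y).
Proof.
move=> /homogP Hx /homogP Hy; apply/homogP => s hs.
by rewrite ffunE Hx // Hy // addr0.
Qed.

Lemma homogN h c x : homog h c x -> homog h c (- x).
Proof. by move=> Hx s; rewrite ffunE oppr_eq0; apply: Hx. Qed.

Lemma homogB h c x y : homog h c x -> homog h c y -> homog h c (x - y).
Proof. by move=> Hx Hy; apply/homogD/homogN. Qed.

Lemma homog_diff h c x : homog h c x -> homog (h + 1) (c - 1) (diff_fun x).
Proof.
move=> Hx t; rewrite ffunE => /eqP H.
have [s /existsP[k /andP[inc xs]]] : exists s, [exists k, incident k s t && (x s != 0)].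
  apply/existsP; apply: contra_notT H => /existsPn nex; apply: big1 => s _.
  apply: big1 => k inc; have := nex s; rewrite negb_exists => /forallP/(_ k).
  by rewrite inc /= negbK => /eqP ->; rewrite mulr0.
have [<- <-] := Hx _ xs.
by rewrite (incident_height inc) -(incident_circle_sign inc) addrK; split; lia.
Qed.

Lemma homog_op_X h c e x : homog h c x -> homog h (c - 2) (op_X e x).
Proof.
move=> Hx t; rewrite ffunE => /eqP H.
have [s /andP[inc xs]] : exists s, times_X e s t && (x s != 0).
  apply/existsP; apply: contra_notT H => /existsPn nex; apply: big1 => s inc.
  by have := nex s; rewrite inc /= negbK => /eqP.
have [<- <-] := Hx _ xs; case/and4P: inc => /eqP Em ls lt ag.
split; first by rewrite /height Em.
by rewrite -(circle_sign_flip Em ag ls lt) addrK.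
Qed.

Lemma homog_esign h c x : homog h c x -> homog h c (esign x).
Proof. by move=> Hx s; rewrite ffunE mulf_eq0 negb_or => /andP[_]; apply: Hx. Qed.

Lemma esignK x : esign (esign x) = x.
Proof. by apply/ffunP => s; rewrite !ffunE mulrA -exprD addnn -mul2n exprM sqrrN expr1n mul1r. Qed.

Lemma esign_diff x : esign (diff_fun x) = - diff_fun (esign x).
Proof.
apply/ffunP => t; rewrite !ffunE mulr_sumr -sumrN; apply: eq_bigr => s _.
rewrite mulr_sumr -sumrN; apply: eq_bigr => k inc.
rewrite ffunE (incident_height inc) exprS; ring.
Qed.

Lemma esign_op_X e x : esign (op_X e x) = op_X e (esign x).
Proof.
apply/ffunP => t; rewrite !ffunE mulr_sumr; apply: eq_bigr => s /and4P[/eqP Em _ _ _].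
by rewrite ffunE /height Em.
Qed.

Lemma op_X2 e x : op_X e (op_X e x) = 0.
Proof.
apply/ffunP => t; rewrite !ffunE; apply: big1 => s /and4P[_ se _ _].
by rewrite ffunE; apply: big_pred0 => u; rewrite /times_X se !andbF.
Qed.
End Homog.

Lemma homog_saddle n h c x : homog h c x -> homog h (c - 1) (@saddle n x).
Proof.
move=> Hx t; rewrite ffunE => /eqP H.
have [s /andP[inc xs]] : exists s,
   incident (sm_index (smooth_Kan0 n)) (pull (smooth_Kan0 n) s true)
                                (pull (smooth_Kan1 n) t true) && (x s != 0).
  apply/existsP; apply: contra_notT H => /existsPn nex; apply: big1 => s inc.
  by have := nex s; rewrite inc /= negbK => /eqP ->; rewrite mulr0.
have [<- <-] := Hx _ xs.
have := incident_height inc; have := incident_circle_sign inc.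
rewrite !height_pull !circle_sign_pull nohit_K0 nohit_K1; lia.
Qed.

(** * Chains given by their components at the last crossing *)

Section Parts.
Variable n : nat.

Lemma Kan_state (s : enhanced_state (Kan n.+1)) :
  (exists s', s = pull (smooth_Kan0 n) s' true) \/ (exists s', s = pull (smooth_Kan1 n) s' true).
Proof.
case E0: (marker s (sm_index (smooth_Kan0 n))); [right|left].
  rewrite K0K1_index in E0; have [s' [c ->]] := pull_surj E0.
  by exists s'; apply: pull_nohit; rewrite nohit_K1.
have [s' [c ->]] := pull_surj E0.
by exists s'; apply: pull_nohit; rewrite nohit_K0.
Qed.

Lemma CapKan_state (s : enhanced_state (CapKan n.+1)) :
  (exists s' c, s = pull (smooth_CapKan0 n) s' c) \/ (exists s', s = pull (smooth_CapKan1 n) s' true).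
Proof.
case E0: (marker s (sm_index (smooth_CapKan0 n))); [right|left]; last exact: pull_surj.
rewrite C0C1_index in E0; have [s' [c ->]] := pull_surj E0.
by exists s'; apply: pull_nohit; rewrite nohit_C1.
Qed.

Lemma Kan_ext (x y : chain (Kan n.+1)) : kan0 x = kan0 y -> kan1 x = kan1 y -> x = y.
Proof.
move=> /ffunP H0 /ffunP H1; apply/ffunP => s.
case: (Kan_state s) => -[s' ->]; first by have := H0 s'; rewrite !ffunE.
by have := H1 s'; rewrite !ffunE.
Qed.

Lemma CapKan_ext (x y : chain (CapKan n.+1)) :
  capP x = capP y -> capM x = capM y -> cap1 x = cap1 y -> x = y.
Proof.
move=> /ffunP H0 /ffunP H1 /ffunP H2; apply/ffunP => s.
case: (CapKan_state s) => -[s']; last by move=> ->; have := H2 s'; rewrite !ffunE.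
by case=> -[] ->; [have := H0 s' | have := H1 s']; rewrite !ffunE.
Qed.

Lemma homog_Kan h c (x : chain (Kan n.+1)) :
  homog h c x <-> homog h c (kan0 x) /\ homog (h - 1) c (kan1 x).
Proof.
split=> [Hx|[H0 H1] s].
  have := homog_restrict (sm := smooth_Kan0 n) (d := true) Hx; rewrite nohit_K0 !subr0.
  have := homog_restrict (sm := smooth_Kan1 n) (d := true) Hx; rewrite nohit_K1 !subr0.
  by [].
case: (Kan_state s) => -[s' ->]; rewrite height_pull circle_sign_pull.
  rewrite nohit_K0 addr0 => xs; have [|<- <- //] := H0 s'; rewrite ffunE //.
rewrite nohit_K1 addr0 => xs; have [|h1 <-] := H1 s'; rewrite ?ffunE //; lia.
Qed.

Lemma homog_CapKan h c (x : chain (CapKan n.+1)) :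
  homog h c x <-> [/\ homog h (c - 1) (capP x), homog h (c + 1) (capM x) & homog (h - 1) c (cap1 x)].
Proof.
split=> [Hx|[H0 H1 H2] s].
  have := homog_restrict (sm := smooth_CapKan0 n) (d := true) Hx; rewrite hit_C0 subr0.
  have := homog_restrict (sm := smooth_CapKan0 n) (d := false) Hx; rewrite hit_C0 subr0 opprK.
  have := homog_restrict (sm := smooth_CapKan1 n) (d := true) Hx; rewrite nohit_C1 subr0.
  by [].
case: (CapKan_state s) => -[s']; last first.
  move=> ->; rewrite height_pull circle_sign_pull nohit_C1 addr0 => xs.
  by have [|h1 <-] := H2 s'; rewrite ?ffunE //; lia.
case=> -[] ->; rewrite height_pull circle_sign_pull hit_C0 => xs.
  by have [|h1 h2] := H0 s'; rewrite ?ffunE //=; lia.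
by have [|h1 h2] := H1 s'; rewrite ?ffunE //=; lia.
Qed.

Lemma Kan_glue (x0 : chain (CapKan n)) (x1 : chain (Kan n)) :
  exists x : chain (Kan n.+1), kan0 x = x0 /\ kan1 x = x1.
Proof.
exists [ffun s => if [pick s' | pull (smooth_Kan0 n) s' true == s] is Some s' then x0 s'
  else if [pick s' | pull (smooth_Kan1 n) s' true == s] is Some s' then x1 s' else 0].
split; apply/ffunP => s; rewrite !ffunE.
  by case: pickP => [s' /eqP/pull_inj -> //|/(_ s)]; rewrite eqxx.
case: pickP => [s' /eqP E0|_].
  have := congr1 (fun s => marker s (sm_index (smooth_Kan0 n))) E0.
  by rewrite marker_pull_index K0K1_index marker_pull_index.
by case: pickP => [s' /eqP/pull_inj -> //|/(_ s)]; rewrite eqxx.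
Qed.

Lemma pull_C0_inj s t c d : pull (smooth_CapKan0 n) s c = pull (smooth_CapKan0 n) t d -> c = d.
Proof.
move=> /(congr1 (fun s => label s (cap_end n.+1))).
by rewrite !label_pull gC0_None.
Qed.

Lemma CapKan_glue (a b c : chain (CapKan n)) :
  exists x : chain (CapKan n.+1), [/\ capP x = a, capM x = b & cap1 x = c].
Proof.
exists [ffun s => if [pick s' | pull (smooth_CapKan0 n) s' true == s] is Some s' then a s'
  else if [pick s' | pull (smooth_CapKan0 n) s' false == s] is Some s' then b s'
  else if [pick s' | pull (smooth_CapKan1 n) s' true == s] is Some s' then c s' else 0].
split; apply/ffunP => s; rewrite !ffunE.
- by case: pickP => [s' /eqP/pull_inj -> //|/(_ s)]; rewrite eqxx.
- case: pickP => [s' /eqP/pull_C0_inj //|_].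
  by case: pickP => [s' /eqP/pull_inj -> //|/(_ s)]; rewrite eqxx.
have no s' d : pull (smooth_CapKan0 n) s' d == pull (smooth_CapKan1 n) s true = false.
  apply/eqP => E0.
  have := congr1 (fun s => marker s (sm_index (smooth_CapKan0 n))) E0.
  by rewrite marker_pull_index C0C1_index marker_pull_index.
case: pickP => [s'|_]; first by rewrite no.
case: pickP => [s'|_]; first by rewrite no.
by case: pickP => [s' /eqP/pull_inj -> //|/(_ s)]; rewrite eqxx.
Qed.
End Parts.

(** * Propagation of exactness along the twists *)

Section SaddleAlgebra.
Definition exact (D : diagram) (h c : int) : Prop :=
  forall x : chain D, homog h c x -> diff_fun x = 0 ->
  exists2 y, homog (h - 1) (c + 1) y & diff_fun y = x.

Local Notation X n := (op_X (cap_end n)).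
Local Notation Y n := (op_X (cap_bot n)).
Local Notation d := (@diff_fun _).
Local Notation sg := (@esign _).

Lemma diff_funD D (x y : chain D) : d (x + y) = d x + d y. Proof. exact: raddfD. Qed.
Lemma diff_funN D (x : chain D) : d (- x) = - d x. Proof. exact: raddfN. Qed.
Lemma op_XD D (e : edge D) (x y : chain D) : op_X e (x + y) = op_X e x + op_X e y.
Proof. exact: raddfD. Qed.
Lemma esignD D (x y : chain D) : sg (x + y) = sg x + sg y. Proof. exact: raddfD. Qed.
Lemma esignN D (x : chain D) : sg (- x) = - sg x. Proof. exact: raddfN. Qed.
Lemma saddleD n (x y : chain (CapKan n)) : saddle (x + y) = saddle x + saddle y.
Proof. exact: raddfD. Qed.
Lemma kan0N n x : kan0 (- x) = - kan0 x :> chain (CapKan n). Proof. exact: raddfN. Qed.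
Lemma kan1N n x : kan1 (- x) = - kan1 x :> chain (Kan n). Proof. exact: raddfN. Qed.
Lemma capMD n x y : capM (x + y) = capM x + capM y :> chain (CapKan n). Proof. exact: raddfD. Qed.

(** General properties of Khovanov complexes, here part of the induction: the recursion for the
    components reproduces them from [n] to [n.+1]. *)
Record cap_laws (n : nat) : Prop := CapLaws {
  cap_dd : forall x : chain (CapKan n), d (d x) = 0;
  cap_dX : forall x, d (X n x) = X n (d x);
  cap_dY : forall x, d (Y n x) = Y n (d x);
  cap_XY : forall x, X n (Y n x) = Y n (X n x) }.

(** The saddle fuses its two sides, so multiplying by X on either side beforehand has the same
    effect. *)
Record saddle_laws (n : nat) : Prop := SaddleLaws {
  kan_dd : forall x : chain (Kan n), d (d x) = 0;
  saddle_d : forall x : chain (CapKan n), saddle (d x) = - d (saddle x);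
  saddle_XY : forall x : chain (CapKan n), saddle (X n x) = saddle (Y n x) }.

(** Only the component [cap1] contains the merge; its term X [capM] is compatible with everything
    since [X n] commutes with d and [Y n] and has square zero. *)
Lemma cap_lawsS n : cap_laws n -> cap_laws n.+1.
Proof.
case=> dd dX dY XY; split=> x; apply: CapKan_ext.
- by rewrite !diff_capP dd raddf0.
- by rewrite !diff_capM dd raddf0.
- rewrite diff_cap1 diff_cap1 diff_capP diff_capM diff_funD dd add0r.
  by rewrite -dX -diff_funD esign_diff addrN raddf0.
- by rewrite diff_capP !end_capP raddf0.
- by rewrite diff_capM !end_capM diff_capP.
- rewrite diff_cap1 !end_cap1 end_capP end_capM diff_cap1 add0r dX.
  by rewrite op_XD -esign_op_X op_XD op_X2 addr0.
- by rewrite diff_capP !bot_capP diff_capP dY.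
- by rewrite diff_capM !bot_capM diff_capM dY.
- rewrite diff_cap1 !bot_cap1 bot_capP bot_capM diff_cap1 dY.
  by rewrite op_XD -esign_op_X op_XD XY.
- by rewrite end_capP bot_capP end_capP raddf0.
- by rewrite end_capM bot_capP bot_capM end_capM.
- by rewrite end_cap1 !bot_cap1 end_cap1 XY.
Qed.

(** Both sides are compared at the two smoothings of the last crossing of [Kan n.+1]: on the
    0-smoothing the saddle is explicit, on the 1-smoothing it is the preceding saddle up to sign. *)
Lemma saddle_lawsS n : cap_laws n -> saddle_laws n -> saddle_laws n.+1.
Proof.
move=> [dd dX dY XY] [kdd sd sXY]; split=> x; apply: Kan_ext.
- by rewrite !diff_kan0 dd raddf0.
- by rewrite !(diff_kan0, diff_kan1) diff_funD kdd add0r sd addrN raddf0.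
- rewrite saddle_kan0 kan0N diff_kan0 saddle_kan0 diff_capP diff_capM -dY.
  by rewrite -diff_funD esign_diff.
- rewrite saddle_kan1 kan1N diff_kan1 saddle_kan1 saddle_kan0 diff_cap1.
  rewrite saddleD sd diff_funN !opprD !opprK; congr (_ - _).
  by rewrite !esignD !saddleD !esign_op_X sXY.
- by rewrite !saddle_kan0 end_capP end_capM bot_capP bot_capM op_X2 addr0 add0r.
- by rewrite !saddle_kan1 end_cap1 bot_cap1 sXY.
Qed.

(** The parts [capP] and [cap1] cancel each other, so a cycle bounds as soon as its part [capM]
    does. *)
Lemma cap_boundary n h c (x : chain (CapKan n.+1)) (b : chain (CapKan n)) :
  cap_laws n -> homog h c x -> d x = 0 -> homog (h - 1) (c + 2) b -> d b = capM x ->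
  exists2 y, homog (h - 1) (c + 1) y & d y = x.
Proof.
move=> [dd dX dY XY] /homog_CapKan[Ha Hb Hc] dx Hb' db.
have dc : d (cap1 x) = - sg (capP x + X n (capM x)).
  by apply/eqP; rewrite -addr_eq0 -diff_cap1 dx raddf0.
(* With [cap1 y = 0] and [capM y = b], the equation for [cap1 (d y)] reads sg ([capP y] + X b) =
   [cap1 x] and determines [capP y]. *)
have [y [ya yb yc]] := CapKan_glue (- X n b + sg (cap1 x)) b 0.
exists y.
  apply/homog_CapKan; rewrite ya yb yc; split; last exact: homog0.
    apply: homogD; last by rewrite addrK; apply: homog_esign.
    by rewrite addrK; apply: homogN; rewrite -[c](addrK 2); apply: homog_op_X.
  by rewrite -addrA.
apply: CapKan_ext; rewrite ?diff_capP ?diff_capM ?diff_cap1 ?ya ?yb ?yc //.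
  rewrite diff_funD diff_funN dX db -[d (sg _)]opprK -esign_diff dc esignN opprK esignK.
  by rewrite addrC addrK.
by rewrite raddf0 add0r addrAC addNr add0r esignK.
Qed.

(** The homology of the two-component unlink in quantum degrees 2, 0, -2. Four negative crossings
    place it at height 4, and each of the [n] curls lowers the circle sign of the surviving classes
    by one. *)
Definition cap_exact n : Prop := forall h c,
  ~ (h = 4 /\ [\/ c + n%:Z = 2, c + n%:Z = 0 | c + n%:Z = -2]) -> exact (CapKan n) h c.

(** On homology, Y + X and Y - X are injective in the top degree. *)
Definition cap_top n (s : bool) : Prop := forall b u : chain (CapKan n),
  homog 4 (2 - n%:Z) b -> homog 3 (1 - n%:Z) u -> d b = 0 ->
  Y n b + (-1) ^+ s *: X n b = d u ->
  exists2 b', homog 3 (3 - n%:Z) b' & d b' = b.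

Lemma cap_exactS n : cap_laws n -> cap_exact n -> cap_exact n.+1.
Proof.
move=> L ex h c hc x Hx dx; have [_ Hb _] := (homog_CapKan _ _ _).1 Hx.
have [||b Hb' db] := ex h (c + 1) _ (capM x) Hb.
- by case=> h4 H; apply: hc; split=> //; case: H => H; [constructor 1|constructor 2|constructor 3]; lia.
- by rewrite -diff_capM dx raddf0.
by apply: (cap_boundary L Hx dx (b := b)); rewrite // -addrA in Hb'.
Qed.

(** Passing a curl changes the sign of X: [capM] takes X at the cap to [capP x], which for a cycle
    is - X [capM x] up to the boundary of [sg (cap1 x)]. The correction of [u] accounts for that
    boundary. *)
Lemma cap_topS n s : cap_laws n -> cap_top n (~~ s) -> cap_top n.+1 s.
Proof.
move=> L top x u Hx Hu dx Hd.
have [Ha Hb Hc] := (homog_CapKan _ _ _).1 Hx.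
have [Hua Hub Huc] := (homog_CapKan _ _ _).1 Hu.
have dc : d (cap1 x) = - sg (capP x + X n (capM x)).
  by apply/eqP; rewrite -addr_eq0 -diff_cap1 dx raddf0.
have [||||b Hb' db] := top (capM x) (capM u - (-1) ^+ s *: sg (cap1 x)).
- by have -> : 2 - n%:Z = 2 - n.+1%:Z + 1 by lia.
- apply: homogB; first by have -> : 1 - n%:Z = 1 - n.+1%:Z + 1 by lia.
  have -> : 1 - n%:Z = 2 - n.+1%:Z by lia.
  by move=> t; rewrite ffunE mulf_eq0 negb_or => /andP[_]; apply: (homog_esign Hc).
- by rewrite -diff_capM dx raddf0.
- have := congr1 (@capM n) Hd.
  have scal y : capM ((-1) ^+ s *: y) = (-1) ^+ s *: capM y.
    by apply/ffunP => t; rewrite !ffunE.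
  have dscal (y : chain (CapKan n)) : d ((-1) ^+ s *: y) = (-1) ^+ s *: d y.
    by case: (s); rewrite ?scale1r // expr1 !scaleN1r diff_funN.
  rewrite capMD scal bot_capM end_capM diff_capM => E0.
  rewrite diff_funD diff_funN dscal -E0 -[d (sg _)]opprK -esign_diff dc esignN opprK esignK.
  rewrite scalerDr opprD addrA addrK; congr (_ + _).
  by rewrite -scaleNr; congr (_ *: _); case: (s); rewrite ?opprK.
have [|y Hy dy] := cap_boundary (b := b) L Hx dx _ db.
  by have -> : 2 - n.+1%:Z + 2 = 3 - n%:Z by lia.
by exists y; rewrite // (_ : 3 - n.+1%:Z = 2 - n.+1%:Z + 1) //; lia.
Qed.

(** With 4 negative and n + 4 positive crossings, c - h + n + 4 is j - 2i. *)
Definition kan_exact n : Prop := forall h c,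
  ~ (c - h + n%:Z + 4 = 1 \/ c - h + n%:Z + 4 = -1) -> exact (Kan n) h c.

(** The long exact sequence of the cone, written out on chains. It settles every degree except that
    of the top class of the unlink, where the recursion for the saddle is applied once more. *)
Lemma kan_exactS n : cap_laws n -> cap_laws n.+1 -> saddle_laws n -> saddle_laws n.+1 ->
  cap_exact n.+1 -> cap_top n true -> kan_exact n.+1 -> kan_exact n.+2.
Proof.
move=> L L1 S S1 Hcap Htop IH h c hc x Hx dx.
have [H0 H1] := (homog_Kan _ _ _).1 Hx.
have d0 : d (kan0 x) = 0 by rewrite -diff_kan0 dx raddf0.
have d1 : d (kan1 x) = - saddle (kan0 x).
  by apply/eqP; rewrite -addr_eq0 -diff_kan1 dx raddf0.
(* Given a primitive [y0] of the 0-part, subtracting its saddle leaves a cycle of [Kan n.+1] with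
   the same value of j - 2i, so induction applies. *)
suff [y0 Hy0 dy0] : exists2 y, homog (h - 1) (c + 1) y & d y = kan0 x.
  have [|||y1 Hy1 dy1] := IH (h - 1) c _ (kan1 x - saddle y0).
  - lia.
  - by apply: homogB => //; rewrite -[c](addrK 1); apply: homog_saddle.
  - by rewrite diff_funD diff_funN d1 -dy0 (saddle_d S1) opprK addrN.
  have [y [ey0 ey1]] := Kan_glue y0 y1.
  exists y.
    by apply/homog_Kan; rewrite ey0 ey1.
  apply: Kan_ext; first by rewrite diff_kan0 ey0.
  by rewrite diff_kan1 ey0 ey1 dy1 subrK.
(* The three degrees with cap homology have j - 2i = 3, 1 and -1; only the first is off the
   diagonals. *)
have [[h4 c2]|nt] : (h = 4 /\ c = 2 - n.+1%:Z) \/ ~ (h = 4 /\ c = 2 - n.+1%:Z).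
  by case: (eqVneq h 4) => [->|/eqP h4]; [case: (eqVneq c (2 - n.+1%:Z)) => [->|/eqP c2]|]; [left|right; case|right; case].
  subst h c.
  have [Ha Hb Hc] := (homog_CapKan _ _ _).1 H0.
  have [Ka Kb] := (homog_Kan _ _ _).1 H1.
  have dc : d (cap1 (kan0 x)) = - sg (capP (kan0 x) + X n (capM (kan0 x))).
    by apply/eqP; rewrite -addr_eq0 -diff_cap1 d0 raddf0.
  (* The 0-part of [d1] exhibits [capP] + Y [capM] as a boundary and [dc] exhibits [capP] + X [capM]
     as one. Their difference eliminates [capP] and leaves (Y - X) [capM]. *)
  have [||||b Hb' db] := Htop (capM (kan0 x)) (sg (kan0 (kan1 x) - cap1 (kan0 x))).
  - by have -> : 2 - n%:Z = 2 - n.+1%:Z + 1 by lia.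
  - have -> : 1 - n%:Z = 2 - n.+1%:Z by lia.
    by apply/homog_esign/homogB.
  - by rewrite -diff_capM d0 raddf0.
  - have := congr1 (@kan0 n) d1; rewrite kan0N saddle_kan0 diff_kan0 => E0.
    rewrite expr1 scaleN1r -[d (sg _)]opprK -esign_diff diff_funD diff_funN E0 dc opprK.
    by rewrite esignD esignN !esignK opprD opprK opprD addrACA addrN add0r.
  have [|y Hy dy] := cap_boundary (b := b) L H0 d0 _ db; last by exists y.
  by have -> : 2 - n.+1%:Z + 2 = 3 - n%:Z by lia.
apply: (Hcap h c) => //; case=> h4 [] c4; [apply: nt; split=> //; lia | apply: hc; left; lia | apply: hc; right; lia].
Qed.
End SaddleAlgebra.

(** * Certified computation of exactness *)

(** Tries indexed by bit strings keep sparse linear algebra on enhanced states cheap to evaluate. *)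
Inductive trie (A : Type) := Leaf | Node of option A & trie A & trie A.
Arguments Leaf {A}.

Fixpoint tfind (A : Type) (k : seq bool) (t : trie A) : option A :=
  match t with
  | Leaf => None
  | Node o l r => match k with
                  | [::] => o
                  | b :: k' => if b then tfind k' r else tfind k' l
                  end
  end.

Fixpoint tset (A : Type) (k : seq bool) (f : option A -> option A) (t : trie A) : trie A :=
  match k with
  | [::] => match t with Leaf => Node (f None) Leaf Leaf | Node o l r => Node (f o) l r end
  | b :: k' =>
    match t with
    | Leaf => if b then Node None Leaf (tset k' f Leaf) else Node None (tset k' f Leaf) Leaf
    | Node o l r => if b then Node o l (tset k' f r) else Node o (tset k' f l) r
    end
  end.

Fixpoint tall (A : Type) (P : pred A) (t : trie A) : bool :=
  if t is Node o l r then [&& (if o is Some a then P a else true), tall P l & tall P r] else true.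

Fixpoint tpick (A : Type) (P : pred A) (t : trie A) : option (seq bool * A) :=
  if t is Node o l r then
    match o with
    | Some a => if P a then Some ([::], a) else
       (if tpick P l is Some (k, x) then Some (false :: k, x) else
        if tpick P r is Some (k, x) then Some (true :: k, x) else None)
    | None => (if tpick P l is Some (k, x) then Some (false :: k, x) else
        if tpick P r is Some (k, x) then Some (true :: k, x) else None)
    end
  else None.

(** A state is written as the bits of its markers followed by the labels of all edges. *)
Definition key := seq bool.
Definition lvec := seq (key * int).
Definition tvec := trie int.

Definition tadd (p : key * int) (t : tvec) : tvec :=
  tset p.1 (fun o => Some (if o is Some x then p.2 + x else p.2)) t.
Definition tvec_of (L : lvec) : tvec := foldr tadd Leaf L.
Definition is_zero (L : lvec) : bool := tall (fun x => x == 0) (tvec_of L).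

Definition lin (T : key -> lvec) (L : lvec) : lvec :=
  flatten [seq [seq (q.1, p.2 * q.2) | q <- T p.1] | p <- L].
Definition lopp (L : lvec) : lvec := [seq (p.1, - p.2) | p <- L].

Definition lookup (t : trie lvec) (k : key) : lvec := if tfind k t is Some L then L else [::].
(** Keeping the smaller representative ensures that every edge refers to an earlier one or to
    itself. *)
Definition fuse (p : nat * nat) (r : seq nat) : seq nat :=
  let x := nth 0%N r p.1 in let y := nth 0%N r p.2 in
  if x == y then r else
  let m := minn x y in let M := maxn x y in [seq if z == M then m else z | z <- r].

(** Labels are filled in by increasing edge, so an edge that is not a root copies a label already
    present in [pre]. *)
Fixpoint labelings (pre : seq bool) (ch : seq (nat + bool)) (l : seq bool) : seq (seq bool) :=
  match ch with
  | [::] => [:: pre]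
  | inl i :: ch' => labelings (rcons pre (nth false pre i)) ch' (behead l)
  | inr true :: ch' =>
    labelings (rcons pre true) ch' (behead l) ++ labelings (rcons pre false) ch' (behead l)
  | inr false :: ch' => labelings (rcons pre (head false l)) ch' (behead l)
  end.

(** The mask [m] marks the roots, so each circle is counted once. *)
Fixpoint lsign (m l : seq bool) : int :=
  match m, l with
  | a :: m', b :: l' => if a then (if b then 1 else -1) + lsign m' l' else lsign m' l'
  | _, _ => 0
  end.

Fixpoint agree (w l l' : seq bool) : bool :=
  match w, l, l' with
  | t :: w', a :: l1, b :: l1' => (t || (a == b)) && agree w' l1 l1'
  | _, _, _ => true
  end.

Section Code.
Variables (ne : nat) (A : seq (quad nat)).

(** The [i]-th entry is the least edge of the circle of the edge [i]. *)
Definition table (v : seq bool) : seq nat :=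
  foldr fuse (iota 0 ne) (flatten [seq joins p.1 p.2 | p <- zip A v]).

Definition is_root (r : seq nat) (i : nat) : bool := nth 0%N r i == i.
Definition mask_of (r : seq nat) : seq bool := [seq is_root r i | i <- iota 0 ne].
(** [inl i]: the label of the root [i]; [inr true]: any label; [inr false]: the old label. *)
Definition choices (r : seq nat) (touched : seq bool) : seq (nat + bool) :=
  [seq (if is_root r i then inr (nth false touched i) else inl (nth 0%N r i)) | i <- iota 0 ne].

(** The data that depend on the smoothing alone, computed once for all its labelings. Each entry of
    [vi_next] is an outgoing cube edge: new smoothing, touched edges, roots, admissible labels and
    sign. *)
Record vinfo := VInfo {
  vi_mask : seq bool; vi_root : seq nat; vi_all : seq (nat + bool);
  vi_next : seq (seq bool * (seq bool * seq bool * seq (nat + bool) * int)) }.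

Definition vinfo_of (v : seq bool) : vinfo :=
  let r := table v in
  VInfo (mask_of r) r (choices r (nseq ne true))
    (flatten [seq (if nth false v j then [::] else
       let v' := set_nth false v j true in let r' := table v' in
       let es := [seq nth 0%N r e | e <- ends (nth (0, 0, 0, 0)%N A j)] in
       let w := [seq nth 0%N r i \in es | i <- iota 0 ne] in
       [:: (v', (w, mask_of r', choices r' w, if odd (count id (take j v)) then -1 else 1))])
     | j <- iota 0 (size A)]).

Fixpoint bits (n : nat) : seq (seq bool) :=
  if n is n'.+1 then [seq true :: v | v <- bits n'] ++ [seq false :: v | v <- bits n']
  else [:: [::]].

Definition kdiff_of (vi : vinfo) (l : seq bool) : lvec :=
  let c := lsign (vi_mask vi) l in
  flatten [seq (let: (v', (w, m, ch, s)) := n in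
     [seq (v' ++ l', s) | l' <- labelings [::] ch l & agree w l l' && (lsign m l' + 1 == c)])
   | n <- vi_next vi].

Definition ktimes_of (e : nat) (v : seq bool) (r : seq nat) (l : seq bool) : lvec :=
  if nth false l e then
    let re := nth 0%N r e in
    [:: (v ++ [seq (p.1 != re) && p.2 | p <- zip r l], 1)]
  else [::].

Record kinfo := KInfo { ki_key : key; ki_height : nat; ki_sign : int; ki_diff : lvec; ki_v : seq bool;
  ki_root : seq nat; ki_lab : seq bool }.

Definition kinfo_of (v : seq bool) (vi : vinfo) (l : seq bool) : kinfo :=
  KInfo (v ++ l) (count id v) (lsign (vi_mask vi) l) (kdiff_of vi l) v (vi_root vi) l.

Definition kinfos : seq kinfo :=
  flatten [seq (let vi := vinfo_of v in [seq kinfo_of v vi l | l <- labelings [::] (vi_all vi) [::]])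
   | v <- bits (size A)].

End Code.

(** Nothing is proved about the elimination: [homotopy_check] tests its output. *)
Definition tscale_add (c : int) : tvec -> tvec -> tvec :=
  (fix add (R x : tvec) {struct R} : tvec :=
    match R with
    | Leaf => x
    | Node o l r => match x with
       | Leaf => Node (if o is Some a then Some (c * a) else None) (add l Leaf) (add r Leaf)
       | Node o' l' r' =>
         Node (match o, o' with
               | Some a, Some b => let z := c * a + b in if z == 0 then None else Some z
               | Some a, None => Some (c * a)
               | None, _ => o' end) (add l l') (add r r')
       end
    end).

Fixpoint tlist (t : tvec) : lvec :=
  if t is Node o l r then
    (if o is Some a then [:: ([::], a)] else [::])
    ++ [seq (false :: p.1, p.2) | p <- tlist l] ++ [seq (true :: p.1, p.2) | p <- tlist r]
  else [::].

Definition is_unit_int (x : int) := (x == 1) || (x == -1).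

(** The pivots are listed in order of creation. *)
Definition reduce (piv : seq (key * (tvec * tvec))) (x V : tvec) : tvec * tvec :=
  foldl (fun xV p => if tfind p.1 xV.1 is Some c then
     (if c == 0 then xV else (tscale_add (- c) p.2.1 xV.1, tscale_add (- c) p.2.2 xV.2)) else xV) (x, V) piv.

(** Gaussian elimination over the integers with pivots 1 and -1. A pivot records a key, an image
    normalized to coefficient 1 at that key, and a preimage of it. *)
Definition column (T : key -> lvec) (piv : seq (key * (tvec * tvec))) (s : key) :=
  let: (x, V) := reduce piv (tvec_of (T s)) (tvec_of [:: (s, 1)]) in
  if tpick is_unit_int x is Some (t, c) then
    rcons piv (t, (tscale_add c x Leaf, tscale_add c V Leaf))
  else piv.

(** The levels are listed from the lowest homological degree to the highest. *)
Fixpoint solve (T : key -> lvec) (prev : trie unit) (levels : seq (seq key)) : seq (key * lvec) :=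
  if levels is L :: levels' then
    (* The states that were pivots for the level below are already hit by the differential; the
       remaining ones are paired with the next level. *)
    let piv := foldl (column T) [::] [seq s <- L | ~~ isSome (tfind s prev)] in
    let next := foldr (fun p => tset p.1 (fun=> Some tt)) Leaf piv in
    [seq (p.1, lopp (tlist (reduce piv (tvec_of [:: (p.1, 1)]) Leaf).2)) | p <- piv] ++ solve T next levels'
  else [::].

Definition homotopy T (chains : seq (seq (seq key))) : trie lvec :=
  foldr (fun p => tset p.1 (fun=> Some p.2)) Leaf (flatten [seq solve T Leaf c | c <- chains]).

Definition homotopy_check (T Th : key -> lvec) (k : key) : bool :=
  is_zero (lin T (Th k) ++ lin Th (T k) ++ [:: (k, -1)]).

Definition ttab (f : kinfo -> lvec) (ks : seq kinfo) : trie lvec :=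
  foldr (fun k => tset (ki_key k) (fun=> Some (f k))) Leaf ks.
(** Quantum degrees are shifted by 10 to make them natural numbers. *)
Definition kbuckets (n : nat) (ks : seq kinfo) : seq (seq (seq kinfo)) :=
  let bh := [seq [seq k <- ks | ki_height k == h] | h <- iota 0 n.+1] in
  [seq [seq [seq k <- b | (ki_height k)%:Z + ki_sign k == q%:Z - 10] | b <- bh] | q <- iota 0 30].

(** The table produced by the elimination is untrusted; cutting it down to keys of actual states
    turns it into an operator on chains. *)
Definition guard (t h : trie lvec) (k : key) : lvec :=
  if isSome (tfind k t) then lookup h k else [::].

(** Mapping cone of [Tm]: the leading bit is [false] on the source and [true] on the target. The
    first [n] bits of [k'] are the markers, and the sign by height makes an operator commuting with
    the differential anticommute with it. *)
Definition cone (n : nat) (T Tm : key -> lvec) (k : key) : lvec :=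
  if k is b :: k' then
    if b then [seq (true :: p.1, p.2) | p <- T k']
    else [seq (false :: p.1, p.2) | p <- T k'] ++
         [seq (true :: p.1, if odd (count id (take n k')) then - p.2 else p.2) | p <- Tm k']
  else [::].

Definition twisted_sum (s : bool) (T T' : key -> lvec) (k : key) : lvec :=
  T k ++ (if s then lopp (T' k) else T' k).

Definition guard_cone (t h : trie lvec) (k : key) : lvec :=
  if k is _ :: k' then (if isSome (tfind k' t) then lookup h k else [::]) else [::].

(** * Correctness of the sparse vectors *)

Section Tries.
Variable A : Type.

Lemma tfind_tset k k' f (t : trie A) :
  tfind k (tset k' f t) = if k == k' then f (tfind k t) else tfind k t.
Proof.
elim: k' k t => [|b k' IH] k t; first by case: k t => [|b' k] [|o l r] //=; case: b' => //; case: k.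
case: k t => [|b' k] t; first by case: t => [|o l r] /=; case: b.
have fL : tfind k (@Leaf A) = None by case: k.
rewrite eqseq_cons; case: t => [|o l r] /=; case: b => /=; case: b' => //=;
  by rewrite ?IH ?fL.
Qed.

Lemma tall_find (P : pred A) k a (t : trie A) : tall P t -> tfind k t = Some a -> P a.
Proof.
elim: k t => [|b k IH] [|o l r] //= /and3P[Po Pl Pr]; first by move=> E0; rewrite E0 in Po.
by case: b; apply: IH.
Qed.

Lemma tfind_tabulate (T : Type) (f : T -> key) (g : T -> A) (s : seq T) k :
  tfind k (foldr (fun x => tset (f x) (fun=> Some (g x))) Leaf s) =
  omap g (ohead [seq x <- s | k == f x]).
Proof. by elim: s => [|x s IH] /=; [case: k | rewrite tfind_tset IH; case: eqP]. Qed.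
End Tries.

Definition coef (L : lvec) (k : key) : int := \sum_(p <- L | p.1 == k) p.2.

Lemma coef_cat L L' k : coef (L ++ L') k = coef L k + coef L' k.
Proof. exact: big_cat. Qed.
Lemma coef_lopp L k : coef (lopp L) k = - coef L k.
Proof. by rewrite /coef big_map /= sumrN. Qed.
Lemma coef_lin T L k : coef (lin T L) k = \sum_(p <- L) p.2 * coef (T p.1) k.
Proof.
rewrite /coef /lin big_flatten big_map; apply: eq_bigr => p _.
by rewrite big_map /= mulr_sumr.
Qed.

Lemma is_zeroP L k : is_zero L -> coef L k = 0.
Proof.
have F : tfind k (tvec_of L) = if has (fun p => p.1 == k) L then Some (coef L k) else None.
  rewrite /tvec_of; elim: L => [|p L IH] /=; first by case: k.
  rewrite /tadd tfind_tset IH /coef big_cons eq_sym; case: eqP => //= _.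
  case: ifP => // /negbT; rewrite -all_predC => /allP H.
  by rewrite big1_seq ?addr0 // => q /andP[qk /H]; rewrite /= qk.
move=> Z; case E0 : (has (fun p => p.1 == k) L); rewrite E0 in F.
  exact/eqP/(tall_find Z F).
move/negbT: E0; rewrite -all_predC => /allP H'.
by rewrite /coef big1_seq // => q /andP[qk /H']; rewrite /= qk.
Qed.

(** * Operators represented by tables of keys *)

Section LinearCode.
Variables (S : finType) (code : S -> key).
Hypothesis code_inj : injective code.
Local Notation C := {ffun S -> rat^o}.

Definition mxop (a : S -> S -> rat) (x : C) : C := [ffun t => \sum_s a s t * x s].

(** Keys that are not codes are sent to zero, so stray keys in a product contribute nothing. *)
Definition codes (T : key -> lvec) (a : S -> S -> rat) : Prop :=
  (forall s t, a s t = (coef (T (code s)) (code t))%:~R) /\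
  (forall k, k \notin codom code -> T k = [::]).

Lemma codes_comp Ta Tb a b s t : codes Ta a -> codes Tb b ->
  \sum_u b s u * a u t = (coef (lin Ta (Tb (code s))) (code t))%:~R.
Proof.
move=> [Ha Na] [Hb _]; rewrite coef_lin rmorph_sum /=.
under eq_bigr => u _ do rewrite Hb Ha /coef rmorph_sum /= big_distrl /=.
rewrite (exchange_big_dep xpredT) //=; apply: eq_bigr => p _.
case: (boolP (p.1 \in codom code)) => [/codomP[u0 Eu]|nc]; last first.
  rewrite big_pred0 => [|u]; last by apply: contraNF nc => /eqP ->; apply: codom_f.
  by rewrite (Na _ nc) /coef big_nil mulr0.
rewrite (big_pred1 u0) => [|u]; first by rewrite Eu rmorphM.
by rewrite Eu (inj_eq code_inj) eq_sym.
Qed.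

Lemma mxop_comp a b x t :
  mxop a (mxop b x) t = \sum_s (\sum_u b s u * a u t) * x s.
Proof.
rewrite ffunE; under eq_bigr => u _ do rewrite ffunE mulr_sumr.
rewrite exchange_big /=; apply: eq_bigr => s _; rewrite mulr_suml.
by apply: eq_bigr => u _; ring.
Qed.

Lemma codes_square T a : codes T a -> (forall s, is_zero (lin T (T (code s)))) ->
  forall x, mxop a (mxop a x) = 0.
Proof.
move=> H Z x; apply/ffunP => t; rewrite mxop_comp ffunE; apply: big1 => s _.
by rewrite (codes_comp _ _ H H) (is_zeroP _ (Z s)) mul0r.
Qed.

Lemma codes_commute Ta Tb a b : codes Ta a -> codes Tb b ->
  (forall s, is_zero (lin Ta (Tb (code s)) ++ lopp (lin Tb (Ta (code s))))) ->
  forall x, mxop a (mxop b x) = mxop b (mxop a x).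
Proof.
move=> Ha Hb Z x; apply/ffunP => t; rewrite !mxop_comp; apply: eq_bigr => s _.
rewrite (codes_comp _ _ Ha Hb) (codes_comp _ _ Hb Ha); congr (_%:~R * _).
by apply/eqP; rewrite -subr_eq0 -coef_lopp -coef_cat (is_zeroP _ (Z s)).
Qed.

Definition hcoef (Th : key -> lvec) (s t : S) : rat := (coef (Th (code s)) (code t))%:~R.

(** If a h + h a = 1 on the states in the support of the cycle [x], then a (h x) = x - h (a x) =
    x. *)
Lemma codes_homotopy T Th a (x : C) : codes T a -> (forall k, k \notin codom code -> Th k = [::]) ->
  (forall s, x s != 0 -> homotopy_check T Th (code s)) ->
  mxop a x = 0 ->
  mxop a (mxop (hcoef Th) x) = x.
Proof.
move=> Ha Nh Z ax0; have Hh : codes Th (hcoef Th) by [].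
apply/ffunP => t; rewrite mxop_comp.
transitivity (\sum_s ((s == t)%:R - \sum_u a s u * hcoef Th u t) * x s).
  apply: eq_bigr => s _; case: (eqVneq (x s) 0) => [->|xs]; first by rewrite !mulr0.
  congr (_ * _); apply/eqP; rewrite eq_sym subr_eq; apply/eqP.
  rewrite (codes_comp _ _ Ha Hh) (codes_comp _ _ Hh Ha) -rmorphD /= -coef_cat.
  have := is_zeroP (code t) (Z s xs); rewrite catA coef_cat => /eqP; rewrite addr_eq0 => /eqP ->.
  rewrite /coef big_cons big_nil /= (inj_eq code_inj).
  by case: eqP => _ /=; rewrite ?addr0 ?opprK ?oppr0.
have -> : \sum_s ((s == t)%:R - \sum_u a s u * hcoef Th u t) * x s =
    x t - mxop (hcoef Th) (mxop a x) t.
  rewrite mxop_comp; under eq_bigr => s _ do rewrite mulrBl.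
  rewrite sumrB (bigD1 t) //= eqxx mul1r; congr (_ - _).
  by rewrite big1 ?addr0 // => s /negPf ->; rewrite mul0r.
by rewrite ax0 ffunE big1 ?subr0 // => s _; rewrite ffunE mulr0.
Qed.

End LinearCode.

(** A test for membership in [labelings], from which the conditions on the single edges are
    extracted. *)
Fixpoint fits (pre : seq bool) (ch : seq (nat + bool)) (l w : seq bool) : bool :=
  match ch, w with
  | [::], [::] => true
  | c :: ch', b :: w' =>
    (match c with inl i => b == nth false pre i | inr t => t || (b == head false l) end)
    && fits (rcons pre b) ch' (behead l) w'
  | _, _ => false
  end.

Lemma labelings_cat ch pre l l' : l' \in labelings pre ch l -> l' = pre ++ drop (size pre) l'.
Proof.
have H ch' pr b m : (forall pre' l1, l' \in labelings pre' ch' l1 -> l' = pre' ++ drop (size pre') l') ->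
    l' \in labelings (rcons pr b) ch' m -> l' = pr ++ drop (size pr) l'.
  move=> IH /IH; move: (drop _ _) => X ->.
  by rewrite -cats1 -catA drop_size_cat.
elim: ch pre l => [|[i|[]] ch IH] pre l /=.
- by rewrite inE => /eqP ->; rewrite drop_size cats0.
- exact: H.
- by rewrite mem_cat => /orP[]; apply: H.
- exact: H.
Qed.

Lemma mem_labelings ch pre l w : (pre ++ w \in labelings pre ch l) = fits pre ch l w.
Proof.
have no b b' ch' pr m w' : (pr ++ b :: w' \in labelings (rcons pr b') ch' m) =
   (b == b') && (pr ++ b :: w' \in labelings (rcons pr b') ch' m).
  case: eqP => //= nb; apply/negP => /labelings_cat/(congr1 (fun s => nth false s (size pr))).
  by rewrite -cats1 -catA /= !nth_cat ltnn subnn /=; apply: nb.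
elim: ch pre l w => [|c ch IH] pre l w /=.
  rewrite inE -{2}[pre]cats0 eqseq_cat // eqxx /=; by case: w.
case: w => [|b w].
  have no0 b' m : (pre ++ [::] \in labelings (rcons pre b') ch m) = false.
    apply/negP => /labelings_cat /(congr1 size).
    by rewrite cats0 size_cat size_rcons; move: (size (drop _ _)) => x; move: (size pre) => y; lia.
  by case: c => [i|[]]; rewrite ?mem_cat ?no0.
rewrite -[pre ++ b :: w]cat_rcons.
have IH' m b' : (rcons pre b ++ w \in labelings (rcons pre b') ch m) =
   (b == b') && fits (rcons pre b) ch m w.
  by rewrite cat_rcons no -cat_rcons; case: eqP => //= <-; rewrite IH.
case: c => [i|[]]; rewrite ?mem_cat !IH' //.
by case: b {IH'} => //=; rewrite ?orbF.
Qed.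

Lemma labelings_uniq ch pre l : uniq (labelings pre ch l).
Proof.
elim: ch pre l => [|[i|[]] ch IH] pre l //=.
rewrite cat_uniq !IH andbT /=; apply/hasPn => l' /labelings_cat H.
apply/negP => /labelings_cat; rewrite H => /(congr1 (fun s => nth false s (size pre))).
by rewrite -!cats1 -!catA /= !nth_cat ltnn subnn.
Qed.

(** References point backwards, so the growing prefix can be replaced by the complete string and the
    conditions become independent. *)
Lemma fitsE ch pre l w : size w = size ch ->
  (forall i j, nth (inr true) ch i = inl j -> (j < size pre + i)%N) ->
  fits pre ch l w = [forall i : 'I_(size ch),
    match nth (inr true) ch i with
    | inl j => nth false w i == nth false (pre ++ w) j
    | inr t => t || (nth false w i == nth false l i) end].
Proof.
elim: ch pre l w => [|c ch IH] pre l [|b w] //= => [_ _|[sw] Hj].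
  by apply/esym/forallP => -[].
rewrite IH // => [|i j E0]; last by rewrite size_rcons addSnnS; apply: (Hj i.+1).
have Hc : (match c with inl i => b == nth false pre i | inr t => t || (b == head false l) end)
  = match c with inl i => b == nth false (pre ++ b :: w) i | inr t => t || (b == nth false l 0) end.
  case: c Hj => [j|t] Hj; last by rewrite nth0.
  by have := Hj 0%N j erefl; rewrite addn0 nth_cat => ->.
rewrite Hc; apply/andP/forallP => [[H0 /forallP H1] [[|i] /= lt]|H] //.
- by have := H1 (Ordinal (lt : (i < size ch)%N)); rewrite /= cat_rcons nth_behead.
- split; first exact: (H ord0).
  by apply/forallP => i; have := H (lift ord0 i); rewrite /= /bump /= add1n /= cat_rcons nth_behead.
Qed.

Lemma agreeE w l l' : size w = size l -> size w = size l' ->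
  agree w l l' = [forall i : 'I_(size w), nth false w i || (nth false l i == nth false l' i)].
Proof.
elim: w l l' => [|t w IH] [|a l] [|b l'] //= => [_ _|[s1] [s2]].
  by apply/esym/forallP => -[].
rewrite IH //; apply/andP/forallP => [[H0 /forallP H1] [[|i] /= lt]|H] //.
- exact: (H1 (Ordinal (lt : (i < size w)%N))).
- by split; [exact: (H ord0) | apply/forallP => i; exact: (H (lift ord0 i))].
Qed.

(** * Connected components by successive fusion *)

Section TableSpec.
Variables (E : finType) (ne : nat) (enc : E -> nat).
Hypothesis enc_lt : forall e, (enc e < ne)%N.
Implicit Type J : seq (E * E).

Definition jrel J : rel E := fun e f => ((e, f) \in J) || ((f, e) \in J).
Definition jtable J : seq nat := foldr fuse (iota 0 ne) [seq (enc p.1, enc p.2) | p <- J].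

(** Induction on the joins: a fusion redirects the larger of two representatives, both fixed by the
    table, to the smaller one. *)
Lemma jtable_spec J :
  [/\ size (jtable J) = ne,
      forall i, (i < ne)%N -> (nth 0%N (jtable J) i <= i)%N,
      forall i, (i < ne)%N -> nth 0%N (jtable J) (nth 0%N (jtable J) i) = nth 0%N (jtable J) i &
      injective enc -> forall e f, connect (jrel J) e f =
        (nth 0%N (jtable J) (enc e) == nth 0%N (jtable J) (enc f))].
Proof.
elim: J => [|[a b] J [sz le rt cn]].
  rewrite /jtable /=; split; first by rewrite size_iota.
  - by move=> i ilt; rewrite nth_iota.
  - by move=> i ilt; rewrite !nth_iota.
  move=> inj e f; rewrite !nth_iota ?enc_lt // !add0n (inj_eq inj).
  by apply/idP/eqP => [/connectP[[|x p]] /= |->] //.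
have jsym K : connect_sym (jrel K).
  by apply: sym_connect_sym => x y; rewrite /jrel orbC.
have sub e f : connect (jrel J) e f -> connect (jrel ((a, b) :: J)) e f.
  apply: connect_sub => x y xy; apply: connect1; rewrite /jrel !inE.
  by case/orP: xy => ->; rewrite !orbT.
have ab : connect (jrel ((a, b) :: J)) a b by apply: connect1; rewrite /jrel inE eqxx.
rewrite /jtable /= -/(jtable J) /fuse /=; set r := jtable J in sz le rt cn *.
set x := nth 0%N r (enc a); set y := nth 0%N r (enc b).
have rlt i : (i < ne)%N -> (nth 0%N r i < ne)%N by move=> ilt; exact: leq_ltn_trans (le i ilt) ilt.
case: eqP => xy.
  split=> // inj e f; rewrite -cn //; apply/idP/idP; last exact: sub.
  apply: connect_sub => u w; rewrite /jrel !inE => H.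
  have abJ : connect (jrel J) a b by rewrite cn // -/x -/y xy.
  case/orP: H => /orP[/eqP[-> ->]|H] //; rewrite ?(jsym J b) //.
  - by apply: connect1; rewrite /jrel H.
  - by apply: connect1; rewrite /jrel H orbT.
set m := minn x y; set M := maxn x y.
have mM : (m < M)%N by rewrite /m /M; case: (ltngtP x y) xy.
have nthr i : (i < ne)%N -> nth 0%N [seq if z == M then m else z | z <- r] i =
    if nth 0%N r i == M then m else nth 0%N r i.
  by move=> ilt; rewrite (nth_map 0%N) ?sz.
have rM : nth 0%N r M = M by rewrite /M /maxn; case: ifP => _; rewrite rt.
have rm : nth 0%N r m = m by rewrite /m /minn; case: ifP => _; rewrite rt.
have mlt : (m < ne)%N by rewrite /m /minn; case: ifP => _; rewrite rlt.
split; first by rewrite size_map.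
- move=> i ilt; rewrite nthr //; case: eqP => [E0|_]; last exact: le.
  by apply: leq_trans (le i ilt); rewrite E0 ltnW.
- move=> i ilt; rewrite (nthr i ilt); case: eqP => E0.
    by rewrite nthr // rm (ltn_eqF mM).
  by rewrite nthr ?rlt // rt // (introF eqP E0).
move=> inj e f; rewrite !nthr //.
have kap u w : jrel ((a, b) :: J) u w ->
   (if nth 0%N r (enc u) == M then m else nth 0%N r (enc u)) =
   (if nth 0%N r (enc w) == M then m else nth 0%N r (enc w)).
  have kab : (if x == M then m else x) = (if y == M then m else y).
    by rewrite /m /M; case: (ltngtP x y) xy => //= h _; rewrite eqxx ?(ltn_eqF h) ?(gtn_eqF h).
  have kJ u' w' : ((u', w') \in J) -> nth 0%N r (enc u') = nth 0%N r (enc w').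
    by move=> H; apply/eqP; rewrite -cn // connect1 // /jrel H.
  rewrite /jrel !inE => /orP[] /orP[/eqP[-> ->]|/kJ ->] //; exact: esym.
apply/idP/eqP => [/connectP[p]|].
  elim: p e => [|u p IH] e /=; first by move=> _ ->.
  by case/andP=> /kap -> /IH.
have key u w : nth 0%N r (enc u) = M -> nth 0%N r (enc w) = m -> connect (jrel ((a, b) :: J)) u w.
  move=> uM wm.
  have cnM z : nth 0%N r (enc u) = nth 0%N r (enc z) -> connect (jrel ((a, b) :: J)) u z.
    by move=> E0; apply: sub; rewrite cn // E0.
  have cnm z : nth 0%N r (enc z) = nth 0%N r (enc w) -> connect (jrel ((a, b) :: J)) z w.
    by move=> E0; apply: sub; rewrite cn // E0.
  have [[hM hm]|[hM hm]] : (M = y /\ m = x) \/ (M = x /\ m = y).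
    by rewrite /M /m; case: (ltngtP x y) xy => //; auto.
    apply: connect_trans (cnM b _) _; first by rewrite uM hM.
    rewrite (jsym _ b); apply: connect_trans ab.
    by rewrite (jsym _ w); apply: cnm; rewrite wm hm.
  apply: connect_trans (cnM a _) _; first by rewrite uM hM.
  by apply: connect_trans ab _; apply: cnm; rewrite wm hm.
case: eqP => eM; case: eqP => fM.
- by move=> _; apply: sub; rewrite cn // eM fM.
- by move=> E0; apply: key.
- by move=> E0; rewrite (jsym _ e); apply: key.
- by move=> E0; apply: sub; rewrite cn // E0.
Qed.
End TableSpec.

Lemma count_enum (T : finType) (p : pred T) : count p (enum T) = #|p|.
Proof. by rewrite -size_filter cardE enumT /enum_mem; congr size; apply: eq_filter. Qed.

(** * Enhanced states as bit strings *)

Section DCode.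
Variables (D : diagram) (ne : nat) (enc : edge D -> nat) (dec : nat -> edge D) (A : seq (quad nat)).
Local Notation E := (edge D).
Local Notation X := 'I_(size (crossings D)).
Hypotheses (encK : cancel enc dec) (enc_lt : forall e, (enc e < ne)%N)
  (decK : forall i, (i < ne)%N -> enc (dec i) = i)
  (HA : map (quad_map enc) (map (@arcs E) (crossings D)) = A).
Implicit Types (v : {ffun X -> bool}) (s t : enhanced_state D).

Definition mbits v : seq bool := [seq v k | k <- enum 'I_(size (crossings D))].
Definition lbits (l : {ffun E -> bool}) : seq bool := [seq l (dec i) | i <- iota 0 ne].
Definition code s : key := mbits (marker s) ++ lbits (label s).

Lemma size_A : size A = size (crossings D).
Proof. by rewrite -HA !size_map. Qed.
Lemma size_mbits v : size (mbits v) = size A.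
Proof. by rewrite size_A size_map size_enum_ord. Qed.
Lemma size_lbits l : size (lbits l) = ne.
Proof. by rewrite size_map size_iota. Qed.
Lemma nth_mbits v k : nth false (mbits v) (nat_of_ord k) = v k.
Proof. by rewrite (nth_map k) ?size_enum_ord // nth_ord_enum. Qed.
Lemma nth_lbits l i : (i < ne)%N -> nth false (lbits l) i = l (dec i).
Proof. by move=> ilt; rewrite (nth_map 0%N) ?size_iota // nth_iota. Qed.
Lemma enc_inj : injective enc. Proof. exact: can_inj encK. Qed.

Lemma mbits_inj : injective mbits.
Proof. by move=> v w vw; apply/ffunP => k; rewrite -!nth_mbits vw. Qed.
Lemma lbits_inj : injective lbits.
Proof. by move=> l m lm; apply/ffunP => e; rewrite -[e]encK -!nth_lbits ?lm. Qed.
Lemma code_inj : injective code.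
Proof.
move=> s t /eqP; rewrite eqseq_cat ?size_mbits // => /andP[/eqP/mbits_inj Em /eqP/lbits_inj El].
exact: state_ext.
Qed.

Definition adjoined v : seq (E * E) :=
  flatten [seq joins p.1 p.2 | p <- zip (map (@arcs E) (crossings D)) (mbits v)].

Lemma adj_jrel v : adj v =2 jrel (adjoined v).
Proof.
have H e f : ((e, f) \in adjoined v) = [exists k, (e, f) \in joins (arcs (xing k)) (v k)].
  have -> : adjoined v = flatten [seq joins (arcs (xing k)) (v k) | k <- enum 'I_(size (crossings D))].
    rewrite /adjoined /mbits.
    have -> : map (@arcs E) (crossings D) = [seq arcs (xing k) | k <- enum 'I_(size (crossings D))].
      by rewrite [RHS](map_comp (@arcs E) (@xing D)); congr map; rewrite -[LHS](map_tnth_enum (in_tuple _)).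
    by rewrite zip_map -map_comp.
  apply/flatten_mapP/existsP => [[k _ /= H]|[k H]]; exists k => //.
  by rewrite mem_enum.
move=> e f; rewrite /jrel !H /adj; apply/existsP/orP => [[k /orP[H1|H1]]|[|] /existsP[k H1]].
- by left; apply/existsP; exists k.
- by right; apply/existsP; exists k.
- by exists k; rewrite !smoothedE H1.
- by exists k; rewrite !smoothedE H1 orbT.
Qed.

Lemma table_mbits v : table ne A (mbits v) = jtable ne enc (adjoined v).
Proof.
rewrite /table /jtable /adjoined -HA; congr foldr.
elim: (map (@arcs E) (crossings D)) (mbits v) => [|a L IH] [|b w] //=.
by rewrite map_cat -IH joins_map.
Qed.

Lemma table_connect v e f : connect (adj v) e f =
  (nth 0%N (table ne A (mbits v)) (enc e) == nth 0%N (table ne A (mbits v)) (enc f)).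
Proof.
rewrite (eq_connect (adj_jrel v)) table_mbits.
by have [_ _ _ ->] := jtable_spec enc_lt (adjoined v); last exact: enc_inj.
Qed.

Section Table.
Variable v : {ffun X -> bool}.
Local Notation r := (table ne A (mbits v)).
Lemma table_size : size r = ne.
Proof. by rewrite table_mbits; case: (jtable_spec enc_lt (adjoined v)). Qed.
Lemma table_le i : (i < ne)%N -> (nth 0%N r i <= i)%N.
Proof. by rewrite table_mbits; case: (jtable_spec enc_lt (adjoined v)) => _ H _ _; apply: H. Qed.
Lemma table_idem i : (i < ne)%N -> nth 0%N r (nth 0%N r i) = nth 0%N r i.
Proof. by rewrite table_mbits; case: (jtable_spec enc_lt (adjoined v)) => _ _ H _; apply: H. Qed.
Lemma table_lt i : (i < ne)%N -> (nth 0%N r i < ne)%N.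
Proof. by move=> ilt; apply: leq_ltn_trans (table_le ilt) ilt. Qed.
End Table.

Lemma perm_enc : perm_eq (map enc (enum E)) (iota 0 ne).
Proof.
apply: uniq_perm; rewrite ?iota_uniq ?(map_inj_uniq enc_inj) ?enum_uniq // => i.
rewrite mem_iota add0n; apply/mapP/idP => [[e _ ->]|ilt] /=; first exact: enc_lt.
by exists (dec i); rewrite ?mem_enum // decK.
Qed.

Lemma circle_sign_lsign s :
  circle_sign s = lsign (mask_of ne (table ne A (mbits (marker s)))) (lbits (label s)).
Proof.
set r := table _ _ _.
have kP x y : connect (adj (marker s)) x y = (dec (nth 0%N r (enc x)) == dec (nth 0%N r (enc y))).
  rewrite table_connect -/r; apply/eqP/eqP => [-> //|/(congr1 enc)].
  by rewrite !decK // table_lt ?enc_lt.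
have cnt (P : pred bool) :
    #|[set dec (nth 0%N r (enc e)) | e in [pred e | P (label s e)]]|
    = count (fun i => is_root r i && P (label s (dec i))) (iota 0 ne).
  rewrite -(permP perm_enc) count_map count_enum; apply: eq_card => e.
  rewrite [RHS]unfold_in /=; apply/imsetP/andP => [[x + ->]|[/eqP er Pe]].
    rewrite inE => Px; rewrite decK ?table_lt ?enc_lt // /is_root table_idem ?enc_lt //; split=> //.
    have -> // : label s (dec (nth 0%N r (enc x))) = label s x.
    apply/esym/label_connect; rewrite table_connect -/r decK ?table_lt ?enc_lt //.
    by rewrite table_idem ?enc_lt.
  by exists e; [rewrite inE -{1}[e]encK | rewrite er encK].
rewrite (circle_sign_image kP) (cnt id) (cnt negb) /mask_of /lbits.
elim: (iota 0 ne) => [|i L IH] //=.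
by case: (is_root r i) => /=; rewrite -IH //; case: (label s (dec i)) => /=; lia.
Qed.

Lemma kheight_mbits s : count id (mbits (marker s)) = height s.
Proof.
by rewrite /mbits /height count_map count_enum; apply: eq_card => k; rewrite inE.
Qed.

Lemma size_choices r w : size (choices ne r w) = ne.
Proof. by rewrite size_map size_iota. Qed.
Lemma nth_choices r w i : (i < ne)%N -> nth (inr true) (choices ne r w) i =
  if is_root r i then inr (nth false w i) else inl (nth 0%N r i).
Proof. by move=> ilt; rewrite (nth_map 0%N) ?size_iota // nth_iota. Qed.

Lemma choices_spec v w l l' : size l' = ne ->
  (l' \in labelings [::] (choices ne (table ne A (mbits v)) w) l) =
  [forall i : 'I_ne, let r := table ne A (mbits v) in
    (nth false l' i == nth false l' (nth 0%N r i)) &&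
    (is_root r i ==> nth false w i || (nth false l' i == nth false l i))].
Proof.
move=> sl; rewrite -[l']cat0s mem_labelings fitsE ?size_choices //; last first.
  move=> i j; case: (ltnP i ne) => ilt; last by rewrite nth_default ?size_choices.
  rewrite nth_choices // /is_root; case: eqP => // nr [<-] /=.
  by have := table_le v ilt; rewrite add0n; case: ltngtP nr.
apply/forallP/forallP => H i; have := H i; rewrite /= nth_choices // /is_root.
  by case: eqP => [->|_]; rewrite /= ?eqxx //= andbT.
by case: (nth 0%N _ i == i) => /= /andP[].
Qed.

Lemma label_table s i : (i < ne)%N ->
  nth false (lbits (label s)) i = nth false (lbits (label s)) (nth 0%N (table ne A (mbits (marker s))) i).
Proof.
move=> ilt; rewrite !nth_lbits ?table_lt //; apply: label_connect.
by rewrite table_connect !decK ?table_lt // table_idem.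
Qed.

Lemma decode v l : size l = ne ->
  (forall i, (i < ne)%N -> nth false l i = nth false l (nth 0%N (table ne A (mbits v)) i)) ->
  exists s, mbits (marker s) = mbits v /\ lbits (label s) = l.
Proof.
move=> sl Hl; pose lf : {ffun E -> bool} := [ffun e => nth false l (enc e)].
have P : [forall e, forall f, adj v e f ==> (lf e == lf f)].
  apply/forallP => e; apply/forallP => f; apply/implyP => /connect1.
  by rewrite table_connect !ffunE (Hl _ (enc_lt e)) (Hl _ (enc_lt f)) => /eqP ->.
exists (exist _ (v, lf) P); split=> //.
apply: (@eq_from_nth _ false); rewrite size_lbits // => i ilt.
by rewrite nth_lbits // /label /= ffunE decK.
Qed.

End DCode.

Lemma mem_bits n w : (w \in bits n) = (size w == n).
Proof.
elim: n w => [|n IH] w; first by rewrite inE; case: w.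
rewrite mem_cat; apply/orP/idP => [[] /mapP[u]|].
- by rewrite IH => us ->.
- by rewrite IH => us ->.
case: w => // b u; rewrite eqSS -IH => us.
by case: b; [left | right]; apply/mapP; exists u.
Qed.

Section DCode.
Variables (D : diagram) (ne : nat) (enc : edge D -> nat) (dec : nat -> edge D) (A : seq (quad nat)).
Local Notation E := (edge D).
Local Notation X := 'I_(size (crossings D)).
Hypotheses (encK : cancel enc dec) (enc_lt : forall e, (enc e < ne)%N)
  (decK : forall i, (i < ne)%N -> enc (dec i) = i)
  (HA : map (quad_map enc) (map (@arcs E) (crossings D)) = A).
Implicit Types (v : {ffun X -> bool}) (s t : enhanced_state D).
Local Notation lbits := (lbits ne dec).
Local Notation code := (code ne dec).
Local Notation tab v := (table ne A (mbits v)).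

Definition diff_coef s t : rat := \sum_(k | incident k s t) cube_sign k s.

Lemma diff_mxop : @diff_fun D =1 mxop diff_coef.
Proof.
by move=> x; apply/ffunP => t; rewrite !ffunE; apply: eq_bigr => s _; rewrite /diff_coef mulr_suml.
Qed.

Lemma op_X_mxop e : @op_X D e =1 mxop (fun s t => (times_X e s t)%:R).
Proof.
move=> x; apply/ffunP => t; rewrite !ffunE big_mkcond; apply: eq_bigr => s _.
by case: (times_X e s t); rewrite ?mul1r ?mul0r.
Qed.

Lemma sum_iota n (F : nat -> int) : \sum_(j <- iota 0 n) F j = \sum_(k < n) F k.
Proof. by rewrite -{1}[n]subn0 -/(index_iota 0 n) big_mkord. Qed.

Lemma agree_except_mbits k s t : ~~ marker s k ->
  agree_except k s t = (set_nth false (mbits (marker s)) k true == mbits (marker t)).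
Proof.
move=> sk; apply/forallP/eqP => [H|E0 l].
  apply: (@eq_from_nth _ false).
    rewrite size_set_nth !(size_mbits HA); apply/maxn_idPr; rewrite (size_A HA); exact: ltn_ord.
  move=> i _; rewrite nth_set_nth /=; case: (ltnP i (size (crossings D))) => ilt.
    rewrite -[i]/(nat_of_ord (Ordinal ilt)) !nth_mbits (eqP (H _)).
    by rewrite -(inj_eq val_inj) /=; case: eqP => _; rewrite ?orbT ?orbF.
  rewrite !nth_default ?(size_mbits HA) ?(size_A HA) //.
  by rewrite gtn_eqF //; apply: leq_trans ilt.
have := congr1 (fun w => nth false w l) E0; rewrite /= nth_set_nth /= !nth_mbits => <-.
rewrite -[nat_of_ord l == _]/(l == k).
by case: (l == k); rewrite ?orbT ?orbF //; case: (marker s l).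
Qed.

Lemma count_take k v :
  count id (take k (mbits v)) = #|[set l : X | (l < k)%N && v l]|.
Proof.
have -> : #|[set l : X | (l < k)%N && v l]| =
    count (fun i => (i < k)%N && nth false (mbits v) i) (iota 0 (size (crossings D))).
  rewrite -val_enum_ord count_map count_enum; apply: eq_card => l.
  by rewrite !inE [in RHS]/= nth_mbits.
have {1}-> : mbits v = [seq nth false (mbits v) i | i <- iota 0 (size (crossings D))].
  apply: (@eq_from_nth _ false); first by rewrite (size_mbits HA) (size_A HA) size_map size_iota.
  rewrite (size_mbits HA) (size_A HA) => i ilt.
  by rewrite (nth_map 0%N) ?size_iota // nth_iota.
rewrite -map_take take_iota count_map; case: (leqP k (size (crossings D))) => hk.
  rewrite -[size (crossings D) in RHS](subnKC hk) iotaD count_cat [X in _ = (_ + X)%N](_ : _ = 0)%N ?addn0.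
    by apply: eq_in_count => i; rewrite mem_iota add0n /= => ->.
  apply/eqP; rewrite -leqn0 leqNgt -has_count; apply/hasPn => i.
  by rewrite mem_iota add0n => /andP[ki _] /=; rewrite ltnNge ki.
apply: eq_in_count => i; rewrite mem_iota add0n /= => ilt.
by rewrite (ltn_trans ilt hk).
Qed.

Section Touched.
Variables (k : X) (s t : enhanced_state D).
Let r := tab (marker s).
Let w := [seq nth 0%N r i \in [seq nth 0%N r e | e <- ends (nth (0, 0, 0, 0)%N A k)] | i <- iota 0 ne].

Lemma nth_touched i : (i < ne)%N ->
  nth false w i = has (connect (adj (marker s)) (dec i)) (ends (arcs (xing k))).
Proof.
move=> ilt; rewrite (nth_map 0%N) ?size_iota // nth_iota // add0n.
have -> : nth (0, 0, 0, 0)%N A k = quad_map enc (arcs (xing k)).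
  rewrite -HA (nth_map (arcs (xing k))) ?size_map //; congr quad_map.
  exact/esym/arcs_xing.
rewrite ends_map -map_comp; apply/mapP/hasP => -[e ek H]; exists e => //.
  by rewrite (table_connect encK enc_lt HA) decK // -/r; apply/eqP.
by move: H; rewrite (table_connect encK enc_lt HA) decK // -/r => /eqP.
Qed.

Lemma agree_lbits : agree w (lbits (label s)) (lbits (label t)) =
  agree_off (marker s) (ends (arcs (xing k))) s t.
Proof.
have sw : size w = ne by rewrite size_map size_iota.
rewrite agreeE ?size_lbits ?sw //; apply/forallP/forallP => H.
  move=> e; have := H (Ordinal (enc_lt e)); rewrite /= nth_touched // !nth_lbits // encK.
  by rewrite implybE negbK eq_sym.
move=> i; have := H (dec i); rewrite nth_touched // !nth_lbits //.
by rewrite implybE negbK eq_sym.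
Qed.

Lemma agree_labelings : agree w (lbits (label s)) (lbits (label t)) ->
  lbits (label t) \in labelings [::] (choices ne (tab (marker t)) w) (lbits (label s)).
Proof.
have sw : size w = ne by rewrite size_map size_iota.
rewrite agreeE ?size_lbits ?sw // => /forallP H.
rewrite (choices_spec enc_lt HA) ?size_lbits //; apply/forallP => i /=.
rewrite -(label_table encK enc_lt decK HA t) ?ltn_ord // eqxx /=; apply/implyP => _.
by have := H i; rewrite [X in _ || X]eq_sym.
Qed.
End Touched.

(** A crossing determines the markers of the target, and the labelings are enumerated without
    repetition, so every arrow is counted exactly once with its cube sign. *)
Lemma kdiff_correct s t :
  diff_coef s t = (coef (kdiff_of (vinfo_of ne A (mbits (marker s))) (lbits (label s))) (code t))%:~R.
Proof.
rewrite /coef /kdiff_of /= big_flatten big_map big_flatten big_map /= sum_iota (size_A HA).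
rewrite rmorph_sum /= /diff_coef big_mkcond; apply: eq_bigr => k _.
rewrite nth_mbits; case: (boolP (marker s k)) => sk.
  by rewrite big_nil incidentE sk.
rewrite big_seq1 big_map /=.
case: (eqVneq (set_nth false (mbits (marker s)) k true) (mbits (marker t))) => Ev; last first.
  rewrite incidentE agree_except_mbits // (negPf Ev) andbF big_pred0 // => l.
  rewrite /code eqseq_cat ?(negPf Ev) // size_set_nth !(size_mbits HA).
  by apply/maxn_idPr; rewrite (size_A HA); exact: ltn_ord.
rewrite Ev.
under eq_bigl => l do rewrite /code eqseq_cat // eqxx /=.
rewrite incidentE sk (agree_except_mbits _ sk) Ev eqxx /= -agree_lbits.
rewrite -(circle_sign_lsign encK enc_lt decK HA s).
set w := [seq _ \in _ | _ <- _].
set sg := if odd _ then _ else _.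
have -> : cube_sign k s = sg%:~R :> rat.
  rewrite /sg count_take /cube_sign -signr_odd.
  by case: (odd _); rewrite ?expr0 ?expr1.
set L := labelings _ _ _.
have -> : \sum_(l <- [seq l' <- L | agree w (lbits (label s)) l' &
      lsign (mask_of ne (tab (marker t))) l' + 1 == circle_sign s] | l == lbits (label t)) sg =
   if agree w (lbits (label s)) (lbits (label t)) && (circle_sign t + 1 == circle_sign s) then sg else 0.
  rewrite (circle_sign_lsign encK enc_lt decK HA t).
  case: ifP => [/andP[ag cs]|nag].
    rewrite -big_filter (filter_pred1_uniq (s := [seq l' <- L | _])) ?big_seq1 //.
      by rewrite filter_uniq // labelings_uniq.
    by rewrite mem_filter ag cs /=; apply: agree_labelings.
  rewrite big_seq_cond big_pred0 // => l; apply/andP => -[].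
  by rewrite mem_filter => /andP[H _] /eqP El; rewrite -El H in nag.
by case: ifP.
Qed.

Lemma ktimes_correct e s t :
  (times_X e s t)%:R = (coef (ktimes_of (enc e) (mbits (marker s)) (tab (marker s)) (lbits (label s))) (code t))%:~R :> rat.
Proof.
rewrite /ktimes_of nth_lbits // encK /times_X; case: (boolP (label s e)) => se; last first.
  by rewrite andbF /coef big_nil.
rewrite /coef big_cons big_nil /code eqseq_cat ?(size_mbits HA) // /=.
rewrite (inj_eq (@mbits_inj D)) eq_sym; case: eqP => //= Em.
set r := tab _; set l := [seq _ | _ <- _].
have sr : size r = ne by rewrite (table_size enc_lt HA).
have sl : size l = ne by rewrite size_map size_zip sr size_lbits minnn.
have nl i : (i < ne)%N -> nth false l i =
    (nth 0%N r i != nth 0%N r (enc e)) && label s (dec i).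
  move=> ilt; rewrite (nth_map (0%N, false)) ?size_zip ?sr ?size_lbits ?minnn //.
  by rewrite nth_zip ?sr ?size_lbits //= nth_lbits.
have -> : (~~ label t e && agree_off (marker s) [:: e] s t) = (l == lbits (label t)).
  apply/andP/eqP => [[te /forallP ag]|El].
    apply: (@eq_from_nth _ false); rewrite ?size_lbits sl // => i ilt.
    rewrite nl // nth_lbits //; have := ag (dec i).
    rewrite has_seq1 (table_connect encK enc_lt HA) -/r decK //.
    case: eqP => [ie _|_ /eqP -> //] /=.
    apply/esym/negbTE; rewrite (@label_connect _ t _ e) // -Em.
    by rewrite (table_connect encK enc_lt HA) -/r decK // ie.
  have lt f : label t f = (nth 0%N r (enc f) != nth 0%N r (enc e)) && label s f.
    have := nth_lbits dec (label t) (enc_lt f); rewrite encK => <-.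
    by rewrite -El nl // encK.
  split; first by rewrite lt eqxx.
  apply/forallP => f; rewrite has_seq1 (table_connect encK enc_lt HA) -/r lt.
  by case: (_ == nth 0%N r (enc e)) => //=.
by case: eqP.
Qed.
End DCode.

Lemma fits_size pre ch l w : fits pre ch l w -> size w = size ch.
Proof. by elim: ch pre l w => [|c ch IH] pre l [|b w] //= /andP[_ /IH ->]. Qed.

Section Project.
Variable D : diagram.
(** An untrusted homotopy need not respect degrees. The differential does, so projecting a primitive
    to the expected degree leaves a primitive. *)
Lemma exact_project h c (x y : chain D) : homog h c x -> diff_fun y = x ->
  exists2 z, homog (h - 1) (c + 1) z & diff_fun z = x.
Proof.
move=> Hx dy.
pose z : chain D := [ffun s => if ((height s)%:Z == h - 1) && (circle_sign s == c + 1) then y s else 0].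
exists z; first by move=> s; rewrite ffunE; case: ifP => [/andP[/eqP -> /eqP ->]|]; rewrite ?eqxx.
apply/ffunP => t.
case E0 : (((height t)%:Z == h) && (circle_sign t == c)).
  rewrite -dy !ffunE; apply: eq_bigr => s _; apply: eq_bigr => k inc; congr (_ * _).
  rewrite ffunE; case/andP: E0 => /eqP ht /eqP ct.
  have := incident_height inc; have := incident_circle_sign inc => h1 h2.
  by rewrite ifT //; apply/andP; split; apply/eqP; lia.
have Hz : homog (h - 1) (c + 1) z.
  by move=> s; rewrite ffunE; case: ifP => [/andP[/eqP -> /eqP ->]|]; rewrite ?eqxx.
have /homogP -> // := homog_diff Hz; last by rewrite subrK addrK.
by move/homogP: Hx => ->.
Qed.
End Project.

Section DCode.
Variables (D : diagram) (ne : nat) (enc : edge D -> nat) (dec : nat -> edge D) (A : seq (quad nat)).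
Local Notation E := (edge D).
Hypotheses (encK : cancel enc dec) (enc_lt : forall e, (enc e < ne)%N)
  (decK : forall i, (i < ne)%N -> enc (dec i) = i)
  (HA : map (quad_map enc) (map (@arcs E) (crossings D)) = A).
Implicit Types (s t : enhanced_state D).
Local Notation lbits := (lbits ne dec).
Local Notation code := (code ne dec).
Local Notation tab v := (table ne A (mbits v)).
Local Notation ks := (kinfos ne A).

Definition st_info s : kinfo :=
  kinfo_of (mbits (marker s)) (vinfo_of ne A (mbits (marker s))) (lbits (label s)).

Definition pairs : seq (seq bool * seq bool) :=
  flatten [seq [seq (v, l) | l <- labelings [::] (vi_all (vinfo_of ne A v)) [::]] | v <- bits (size A)].

Lemma kinfosE : ks = [seq kinfo_of p.1 (vinfo_of ne A p.1) p.2 | p <- pairs].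
Proof.
rewrite /kinfos /pairs map_flatten -map_comp; congr flatten; apply: eq_map => v /=.
by rewrite -map_comp.
Qed.

Lemma mem_pairs p : p \in pairs <-> exists s, p = (mbits (marker s), lbits (label s)).
Proof.
split.
  case/flatten_mapP => w; rewrite mem_bits => /eqP sw /mapP[l lw ->].
  pose v : {ffun 'I_(size (crossings D)) -> bool} := [ffun k => nth false w (nat_of_ord k)].
  have Ew : w = mbits v.
    apply: (@eq_from_nth _ false); first by rewrite (size_mbits HA).
    rewrite sw (size_A HA) => i ilt; rewrite -[i]/(nat_of_ord (Ordinal ilt)) nth_mbits.
    by rewrite ffunE.
  rewrite Ew in lw *.
  have sl : size l = ne.
    by move: lw; rewrite -[l]cat0s mem_labelings => /fits_size ->; rewrite size_choices.
  have [s [Es El]] : exists s, mbits (marker s) = mbits v /\ lbits (label s) = l.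
    apply: (decode encK enc_lt decK HA) => // i ilt; move: lw.
    rewrite (choices_spec enc_lt HA) // => /forallP/(_ (Ordinal ilt)) /andP[/eqP //].
  by exists s; rewrite Es El.
case=> s ->; apply/flatten_mapP; exists (mbits (marker s)).
  by rewrite mem_bits (size_mbits HA).
apply/map_f; rewrite (choices_spec enc_lt HA) ?size_lbits //; apply/forallP => i /=.
rewrite -(label_table encK enc_lt decK HA s) ?ltn_ord // eqxx /=.
by rewrite nth_nseq ltn_ord implybT.
Qed.

Lemma all_kinfos (P : pred kinfo) s : all P ks -> P (st_info s).
Proof.
rewrite kinfosE all_map => /allP H; apply: (H (_, _)).
by apply/mem_pairs; exists s.
Qed.

Lemma tfind_ttab f s : tfind (code s) (ttab f ks) = Some (f (st_info s)).
Proof.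
rewrite /ttab tfind_tabulate kinfosE filter_map /=.
set L := [seq p <- pairs | _].
have HL p : p \in L -> p = (mbits (marker s), lbits (label s)).
  rewrite mem_filter /= => /andP[/eqP E0 /mem_pairs[t Et]]; move: E0; rewrite Et /= => /(code_inj encK enc_lt HA).
  by move=> ->.
have : (mbits (marker s), lbits (label s)) \in L.
  by rewrite mem_filter /= eqxx; apply/mem_pairs; exists s.
case: L HL => [|p L] // HL _; rewrite /= (HL p) //.
by rewrite inE eqxx.
Qed.

Lemma tfind_ttab_none f k : k \notin codom code -> tfind k (ttab f ks) = None.
Proof.
move=> nk; rewrite /ttab tfind_tabulate kinfosE filter_map /=.
set L := [seq p <- pairs | _].
have : forall p, p \in L -> False.
  move=> p; rewrite mem_filter /= => /andP[/eqP E0 /mem_pairs[t Et]]; case/negP: nk.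
  by apply/codomP; exists t; rewrite E0 Et.
by case: L => [|p L] // /(_ p); rewrite inE eqxx => /(_ isT).
Qed.

Lemma codes_ttab f a : (forall s t, a s t = (coef (f (st_info s)) (code t))%:~R) ->
  codes code (lookup (ttab f ks)) a.
Proof.
move=> H; split=> [s t|k nk]; first by rewrite /lookup tfind_ttab H.
by rewrite /lookup tfind_ttab_none.
Qed.

Lemma codes_diff : codes code (lookup (ttab ki_diff ks)) (@diff_coef D).
Proof. by apply: codes_ttab => s t; rewrite (kdiff_correct encK enc_lt decK HA). Qed.

Definition ktimes (i : nat) (k : kinfo) : lvec := ktimes_of i (ki_v k) (ki_root k) (ki_lab k).

Lemma codes_times e : codes code (lookup (ttab (ktimes (enc e)) ks))
  (fun s t => (times_X e s t)%:R).
Proof. by apply: codes_ttab => s t; rewrite (ktimes_correct encK enc_lt decK HA). Qed.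

Lemma guard_notin f h k : k \notin codom code -> guard (ttab f ks) h k = [::].
Proof. by move=> nk; rewrite /guard tfind_ttab_none. Qed.

Lemma st_info_height s : ki_height (st_info s) = height s.
Proof. exact: kheight_mbits. Qed.
Lemma st_info_sign s : ki_sign (st_info s) = circle_sign s.
Proof. by rewrite (circle_sign_lsign encK enc_lt decK HA). Qed.

Lemma exact_of_check h c f th :
  (forall s, (height s)%:Z = h -> circle_sign s = c ->
     homotopy_check (lookup (ttab ki_diff ks)) (guard (ttab f ks) th) (code s)) ->
  exact D h c.
Proof.
move=> H x Hx dx; apply: (exact_project (y := mxop (hcoef code (guard (ttab f ks) th)) x) Hx).
rewrite diff_mxop; apply: (codes_homotopy (code_inj encK enc_lt HA) codes_diff).
- by move=> k; apply: guard_notin.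
- by move=> s /Hx[hs cs]; apply: H.
- by rewrite -diff_mxop.
Qed.

Lemma square_of_check : all (fun k => is_zero (lin (lookup (ttab ki_diff ks)) (ki_diff k))) ks ->
  forall x : chain D, diff_fun (diff_fun x) = 0.
Proof.
move=> H x; rewrite !diff_mxop; apply: (codes_square (code_inj encK enc_lt HA) codes_diff) => s.
by have := all_kinfos s H; rewrite /lookup tfind_ttab.
Qed.

Definition commute_check (T T' : key -> lvec) (k : key) : bool :=
  is_zero (lin T (T' k) ++ lopp (lin T' (T k))).

Lemma commute_diff_of_check e :
  all (fun k => commute_check (lookup (ttab ki_diff ks)) (lookup (ttab (ktimes (enc e)) ks)) (ki_key k)) ks ->
  forall x : chain D, diff_fun (op_X e x) = op_X e (diff_fun x).
Proof.
move=> H x; rewrite !diff_mxop !op_X_mxop.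
apply: (codes_commute (code_inj encK enc_lt HA) codes_diff (codes_times e)) => s.
exact: (all_kinfos s H).
Qed.

Lemma commute_times_of_check e e' :
  all (fun k => commute_check (lookup (ttab (ktimes (enc e)) ks)) (lookup (ttab (ktimes (enc e')) ks)) (ki_key k)) ks ->
  forall x : chain D, op_X e (op_X e' x) = op_X e' (op_X e x).
Proof.
move=> H x; rewrite !op_X_mxop.
apply: (codes_commute (code_inj encK enc_lt HA) (codes_times e) (codes_times e')) => s.
exact: (all_kinfos s H).
Qed.
End DCode.

Lemma coef_map_cons b b' (g : key * int -> int) L k :
  coef [seq (b :: p.1, g p) | p <- L] (b' :: k) = if b == b' then \sum_(p <- L | p.1 == k) g p else 0.
Proof.
rewrite /coef big_map /=; case: eqP => [->|nb].
  by apply: eq_bigl => p; rewrite eqseq_cons eqxx.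
by apply: big_pred0 => p; rewrite eqseq_cons (introF eqP nb).
Qed.

(** * The cone of Y + X or Y - X *)

Section Cone.
Variables (D : diagram) (ne : nat) (enc : edge D -> nat) (dec : nat -> edge D) (A : seq (quad nat)).
Local Notation E := (edge D).
Hypotheses (encK : cancel enc dec) (enc_lt : forall e, (enc e < ne)%N)
  (decK : forall i, (i < ne)%N -> enc (dec i) = i)
  (HA : map (quad_map enc) (map (@arcs E) (crossings D)) = A).
Local Notation S := (enhanced_state D).
Local Notation code := (code ne dec).
Local Notation ks := (kinfos ne A).

Definition cone_code (p : bool * S) : key := p.1 :: code p.2.
Lemma cone_code_inj : injective cone_code.
Proof. by move=> [b s] [b' s'] [-> /(code_inj encK enc_lt HA) ->]. Qed.

Definition cone_coef (M : S -> S -> rat) (p q : bool * S) : rat :=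
  if p.1 == q.1 then diff_coef p.2 q.2
  else if p.1 then 0 else (-1) ^+ height p.2 * M p.2 q.2.

Lemma codes_cone T Tm M : codes code T (@diff_coef D) -> codes code Tm M ->
  codes cone_code (cone (size A) T Tm) (cone_coef M).
Proof.
move=> [HT NT] [HM NM]; split=> [[b s] [b' t]|[|b k] //]; last first.
  move=> nk; have nk' : k \notin codom code.
    by apply: contra nk => /codomP[s ->]; apply/codomP; exists (b, s).
  by rewrite /cone NT // NM //=; case: b {nk}.
have th : take (size A) (code s) = mbits (marker s).
  by rewrite /code take_size_cat // (size_mbits HA).
rewrite /cone_coef /cone /cone_code /=; case: b.
  by rewrite coef_map_cons /=; case: b' => //=; rewrite HT.
rewrite coef_cat !coef_map_cons th kheight_mbits; case: b' => /=; last by rewrite addr0 HT.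
rewrite add0r HM -signr_odd; case: (odd _) => /=; last by rewrite expr0 mul1r.
by rewrite expr1 mulN1r sumrN rmorphN.
Qed.

Lemma codes_twisted_sum s T T' a a' : codes code T a -> codes code T' a' ->
  codes code (twisted_sum s T T') (fun x y => a x y + (-1) ^+ s * a' x y).
Proof.
move=> [HT NT] [HT' NT']; split=> [x y|k nk]; rewrite /twisted_sum; last first.
  by rewrite NT // NT' //; case: s.
rewrite HT HT' coef_cat rmorphD /=; congr (_ + _).
by case: s => /=; rewrite ?expr0 ?expr1 ?mul1r // coef_lopp mulN1r rmorphN.
Qed.

Lemma sum_bool_pair (F : bool * S -> rat) : \sum_p F p = \sum_s F (true, s) + \sum_s F (false, s).
Proof.
rewrite (eq_bigr (fun p => F (p.1, p.2))) => [|[]//].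
by rewrite -(pair_bigA _ (fun b s => F (b, s))) /= big_bool.
Qed.

(** A cycle [x] whose image is the boundary of [u] extends to a cycle of the cone. Contracting the
    cone on its support yields a primitive, whose source component is a primitive of [x]. *)
Lemma top_of_check e e' sgn h c f th (x u : chain D) :
  (forall s, (height s)%:Z = h -> circle_sign s = c ->
     homotopy_check (cone (size A) (lookup (ttab ki_diff ks))
       (twisted_sum sgn (lookup (ttab (ktimes (enc e)) ks)) (lookup (ttab (ktimes (enc e')) ks))))
       (guard_cone (ttab f ks) th) (false :: code s)) ->
  (forall s, (height s)%:Z = h - 1 -> circle_sign s = c - 1 ->
     homotopy_check (cone (size A) (lookup (ttab ki_diff ks))
       (twisted_sum sgn (lookup (ttab (ktimes (enc e)) ks)) (lookup (ttab (ktimes (enc e')) ks))))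
       (guard_cone (ttab f ks) th) (true :: code s)) ->
  homog h c x -> homog (h - 1) (c - 1) u -> diff_fun x = 0 ->
  op_X e x + (-1) ^+ sgn *: op_X e' x = diff_fun u ->
  exists2 y, homog (h - 1) (c + 1) y & diff_fun y = x.
Proof.
move=> H0 H1 Hx Hu dx Eu.
pose a := cone_coef (fun s t => (times_X e s t)%:R + (-1) ^+ sgn * (times_X e' s t)%:R).
(* As [esign] anticommutes with d, [esign u] cancels the signed image of [x] in the target. *)
pose z : {ffun bool * S -> rat^o} := [ffun p => if p.1 then esign u p.2 else x p.2].
have az : mxop a z = 0.
  have dxE t : \sum_s diff_coef s t * x s = 0 by move/ffunP/(_ t): dx; rewrite diff_mxop !ffunE.
  apply/ffunP => -[[] t]; rewrite !ffunE sum_bool_pair /a /cone_coef /=; last first.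
    rewrite big1 ?add0r => [|s _]; last by rewrite mul0r.
    by under eq_bigr => s _ do rewrite ffunE; rewrite dxE.
  under eq_bigr => s _ do rewrite ffunE /=.
  under [X in _ + X]eq_bigr => s _ do rewrite ffunE /=.
  have -> : \sum_s diff_coef s t * esign u s = - esign (diff_fun u) t.
    by rewrite esign_diff ffunE opprK diff_mxop [RHS]ffunE.
  rewrite -Eu [X in - X]ffunE; apply/eqP; rewrite addrC subr_eq0; apply/eqP.
  have -> : (op_X e x + (-1) ^+ sgn *: op_X e' x) t =
     \sum_s ((times_X e s t)%:R + (-1) ^+ sgn * (times_X e' s t)%:R) * x s.
    under eq_bigr => s _ do rewrite mulrDl -mulrA.
    by rewrite big_split /= -mulr_sumr !op_X_mxop !ffunE.
  rewrite mulr_sumr; apply: eq_bigr => s _; rewrite mulrA.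
  have ht e1 : times_X e1 s t -> height s = height t by move=> /andP[/eqP Em _]; rewrite /height Em.
  case h1 : (times_X e s t); first by rewrite (ht e h1).
  case h2 : (times_X e' s t); first by rewrite (ht e' h2).
  by rewrite mulr0 addr0 !mulr0 !mul0r.
have : mxop a (mxop (hcoef cone_code (guard_cone (ttab f ks) th)) z) = z.
  apply: (codes_homotopy cone_code_inj (T := cone (size A) (lookup (ttab ki_diff ks))
       (twisted_sum sgn (lookup (ttab (ktimes (enc e)) ks)) (lookup (ttab (ktimes (enc e')) ks))))) => //.
  - apply: codes_cone; first exact: codes_diff.
    by apply: codes_twisted_sum; apply: codes_times.
  - move=> [|b k] // nk; rewrite /guard_cone (tfind_ttab_none encK enc_lt decK HA) //.
    by apply: contra nk => /codomP[s ->]; apply/codomP; exists (b, s).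
  - move=> [[] s]; rewrite ffunE /=.
      by move=> /(homog_esign Hu)[hs cs]; apply: H1.
    by move=> /Hx[hs cs]; apply: H0.
move=> /ffunP az2; apply: (exact_project (y := [ffun s => mxop (hcoef cone_code (guard_cone (ttab f ks) th)) z (false, s)]) Hx).
apply/ffunP => t; have := az2 (false, t); rewrite [RHS]ffunE /= => <-.
rewrite diff_mxop [LHS]ffunE [RHS]ffunE sum_bool_pair [X in _ = X + _]big1 ?add0r => [|s _].
  by apply: eq_bigr => s _; rewrite ffunE.
by rewrite /a /cone_coef /= mul0r.
Qed.
End Cone.

(** * Numbering the edges *)

Section EdgeCode.
Variable n : nat.
Local Notation E := (kanenobu_edge n 0).
Local Notation ne := (16 + n.*2)%N.

Definition edge_code (e : E) : nat :=
  match e with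
  | inl (inl (s, e)) => (if s then 5 else 0) + inner_code e
  | inl (inr b) => 10 + b
  | inr (inl (i, s)) => 12 + i.*2 + s
  | inr (inr (_, s)) => 12 + n.+1.*2 + s
  end.

Lemma edge_code_lt e : (edge_code e < ne)%N.
Proof.
case: e => [[[s e]|b]|[[i s]|[j s]]] /=.
- by have := ltn_ord (inner_code e); case: s; lia.
- by case: b; lia.
- by have := ltn_ord i; case: s; lia.
- by case: s; lia.
Qed.

Lemma edge_code_inj : injective edge_code.
Proof.
have ib e := ltn_ord (inner_code e).
move=> [[[s e]|b]|[[i s]|[j s]]] [[[s' e']|b']|[[i' s']|[j' s']]] /= H.
- have := ib e; have := ib e' => h1 h2.
  have [-> E0] : s = s' /\ inner_code e = inner_code e' :> nat.
    by case: s s' H => -[] H; split=> //; lia.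
  by have := can_inj inner_codeK (val_inj E0) => ->.
- by exfalso; have := ib e; case: s b' H => -[]; lia.
- by exfalso; have := ib e; case: s H; lia.
- by exfalso; have := ib e; case: s H; lia.
- by exfalso; have := ib e'; case: b s' H => -[]; lia.
- by case: b b' H => -[].
- by exfalso; case: b H; lia.
- by exfalso; case: b H; lia.
- by exfalso; have := ib e'; case: s' H; lia.
- by exfalso; case: b' H; lia.
- have [-> /val_inj ->] // : s = s' /\ i = i' :> nat.
  by case: s s' H => -[] H; split=> //; lia.
- by exfalso; have := ltn_ord i; case: s s' H => -[]; lia.
- by exfalso; have := ib e'; case: s' H; lia.
- by exfalso; case: b' H; lia.
- by exfalso; have := ltn_ord i'; case: s s' H => -[]; lia.
- have -> : s = s' by case: s s' H => -[] H //; lia.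
  by rewrite (ord1 j) (ord1 j').
Qed.

Lemma card_edge : #|{: E}| = ne.
Proof.
have c5 : #|{: inner_edge}| = 5.
  by rewrite -[RHS]card_ord; apply: bij_eq_card; exists inner_decode; [exact: inner_codeK | case=> -[|[|[|[|[|[]]]]]] // ?; exact: val_inj].
by rewrite !card_sum !card_prod !card_ord card_bool c5; lia.
Qed.

Definition edge_decode (i : nat) : E := odflt (inl (inr false)) [pick e | edge_code e == i].

Lemma edge_codeK : cancel edge_code edge_decode.
Proof.
by move=> e; rewrite /edge_decode; case: pickP => [e' /eqP/edge_code_inj|/(_ e)/eqP].
Qed.

(** An injection into a set of the same cardinality is onto. *)
Lemma edge_decodeK i : (i < ne)%N -> edge_code (edge_decode i) = i.
Proof.
move=> ilt; rewrite /edge_decode; case: pickP => [e /eqP //|none]; exfalso.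
have sub : {subset map edge_code (enum {: E}) <= iota 0 ne}.
  by move=> _ /mapP[e _ ->]; rewrite mem_iota edge_code_lt.
have u : uniq (map edge_code (enum {: E})) by rewrite map_inj_uniq ?enum_uniq //; exact: edge_code_inj.
have sz : (size (iota 0 ne) <= size (map edge_code (enum {: E})))%N.
  by rewrite size_map size_iota -cardE card_edge.
have [_ /(_ i)] := uniq_min_size u sub sz.
by rewrite mem_iota ilt => /mapP[e _ E0]; have := none e; rewrite -E0 eqxx.
Qed.

Lemma edge_code_Epos k s : (k <= n)%N -> edge_code (Epos n k s) = (12 + k.*2 + s)%N.
Proof. by move=> kn; rewrite /= inordK. Qed.
End EdgeCode.

Definition num_pos (k : nat) (s : bool) : nat := (12 + k.*2 + s)%N.
Definition num_body (n : nat) (u v : bool -> nat) : seq (quad nat) :=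
  two_figure_eights (fun (s : bool) e => (if s then 5 else 0) + nat_of_ord (inner_code e))%N
    10%N 11%N u v (fun s => 12 + n.+1.*2 + nat_of_bool s)%N.
(** With [n = 0] edge 12 is the cap and edge 13 the arc below it. *)
Definition num_cap : seq (quad nat) := num_body 0 (fun=> 12%N) (fun=> 13%N).
Definition num_kan : seq (quad nat) := num_body 1 (num_pos 0) (num_pos 1) ++ twist_quads num_pos 1.

Lemma num_capE : map (quad_map (@edge_code 0)) (map (@arcs _) (crossings (CapKan 0))) = num_cap.
Proof.
by rewrite arcs_CapKan /= !inordK.
Qed.

Lemma num_kanE : map (quad_map (@edge_code 1)) (map (@arcs _) (crossings (Kan 1))) = num_kan.
Proof. by rewrite arcs_Kan /= !inordK. Qed.

(** Both signs are tested because they alternate along the twists. In each level of the cone the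
    target has height and circle sign one less than the source; height 9, impossible with eight
    crossings, makes the target part of the lowest level empty. *)
Definition cap_check (ne : nat) (A : seq (quad nat)) (x y : nat) : bool :=
  let ks := kinfos ne A in
  let t := ttab ki_diff ks in let T := lookup t in
  let tX := ttab (ktimes x) ks in let tY := ttab (ktimes y) ks in
  let TX := lookup tX in let TY := lookup tY in
  let h := homotopy T (map (map (map ki_key)) (kbuckets (size A) ks)) in
  let Th := guard t h in
  let cone_ok s :=
    let TC := cone (size A) T (twisted_sum s TY TX) in
    let at_deg a (b : int) := [seq k <- ks | (ki_height k == a) && (ki_sign k == b)] in
    let level p := [seq false :: ki_key k | k <- at_deg p.1.1 p.1.2]
                ++ [seq true :: ki_key k | k <- at_deg p.2.1 p.2.2] in
    let hc := homotopy TC [:: map level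
       [:: ((0%N, 6), (9%N, 0)); ((1%N, 5), (0%N, 4)); ((2%N, 4), (1%N, 3)); ((3%N, 3), (2%N, 2)); ((4%N, 2), (3%N, 1))]] in
    let ThC := guard_cone t hc in
    all (fun k => (if (ki_height k == 4%N) && (ki_sign k == 2) then homotopy_check TC ThC (false :: ki_key k) else true)
      && (if (ki_height k == 3%N) && (ki_sign k == 1) then homotopy_check TC ThC (true :: ki_key k) else true)) ks in
  [&& all (fun k => commute_check TX TY (ki_key k)) ks,
      all (fun k => if (ki_height k == 4%N) && (ki_sign k \in [:: 2; 0; -2]) then true
         else homotopy_check T Th (ki_key k)) ks,
      cone_ok true & cone_ok false].

(** The constant 5 is n + 4 for n = 1, so the degrees left out are those on the two diagonals. *)
Definition kan_check (ne : nat) (A : seq (quad nat)) (x y : nat) : bool :=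
  let ks := kinfos ne A in
  let t := ttab ki_diff ks in let T := lookup t in
  let h := homotopy T (map (map (map ki_key)) (kbuckets (size A) ks)) in
  let Th := guard t h in
  let commutes i := let tX := ttab (ktimes i) ks in let TX := lookup tX in
    all (fun k => commute_check T TX (ki_key k)) ks in
  [&& all (fun k => is_zero (lin T (ki_diff k))) ks,
      commutes x, commutes y &
      all (fun k => if ki_sign k - (ki_height k)%:Z + 5 \in [:: 1; -1] then true
         else homotopy_check T Th (ki_key k)) ks].

Section Soundness.
Variables (D : diagram) (ne : nat) (enc : edge D -> nat) (dec : nat -> edge D) (A : seq (quad nat)).
Hypotheses (encK : cancel enc dec) (enc_lt : forall e, (enc e < ne)%N)
  (decK : forall i, (i < ne)%N -> enc (dec i) = i)
  (HA : map (quad_map enc) (map (@arcs (edge D)) (crossings D)) = A).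
Variables e e' : edge D.

Lemma cap_check_sound : cap_check ne A (enc e) (enc e') ->
  [/\ forall x : chain D, op_X e (op_X e' x) = op_X e' (op_X e x),
      forall h c, ~ (h = 4 /\ [\/ c = 2, c = 0 | c = -2]) -> exact D h c &
      forall (s : bool) (x u : chain D), homog 4 2 x -> homog 3 1 u -> diff_fun x = 0 ->
        op_X e' x + (-1) ^+ s *: op_X e x = diff_fun u ->
        exists2 y, homog 3 3 y & diff_fun y = x].
Proof.
have all_st := all_kinfos encK enc_lt decK HA.
have hs := st_info_height ne dec A; have ss := st_info_sign encK enc_lt decK HA.
rewrite /cap_check; cbv zeta => /and4P[H1 H2 H3 H4]; split.
- exact: (commute_times_of_check encK enc_lt decK HA H1).
- move=> h c hc; apply: (exact_of_check encK enc_lt decK HA) => s Hs Hc.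
  have := all_st _ s H2; rewrite hs ss; case: ifP => [/andP[/eqP h4]|_ H]; last exact: H.
  by rewrite !inE => H; exfalso; apply: hc; split; [rewrite -Hs h4 | rewrite -Hc; case/or3P: H => /eqP ->; [constructor 1|constructor 2|constructor 3]].
move=> s x u Hx Hu dx Eu.
have [y Hy dy] : exists2 y, homog (4 - 1) (2 + 1) y & diff_fun y = x; last by exists y.
(* The homotopy stays abstract: all that counts is that it passes the checks. *)
have [th Hth] : exists th, forall s0,
  (if (height s0 == 4%N) && (circle_sign s0 == 2) then
     homotopy_check (cone (size A) (lookup (ttab ki_diff (kinfos ne A)))
       (twisted_sum s (lookup (ttab (ktimes (enc e')) (kinfos ne A))) (lookup (ttab (ktimes (enc e)) (kinfos ne A)))))
       (guard_cone (ttab ki_diff (kinfos ne A)) th) (false :: code ne dec s0) else true) &&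
  (if (height s0 == 3%N) && (circle_sign s0 == 1) then
     homotopy_check (cone (size A) (lookup (ttab ki_diff (kinfos ne A)))
       (twisted_sum s (lookup (ttab (ktimes (enc e')) (kinfos ne A))) (lookup (ttab (ktimes (enc e)) (kinfos ne A)))))
       (guard_cone (ttab ki_diff (kinfos ne A)) th) (true :: code ne dec s0) else true).
  case: s {Eu}; eexists => s0; [have := all_st _ s0 H3 | have := all_st _ s0 H4]; rewrite hs ss; exact: id.
apply: (top_of_check encK enc_lt decK HA (e := e') (e' := e) (sgn := s) (f := ki_diff) (th := th) _ _ Hx Hu dx Eu).
- move=> s0 h4 c2; have /andP[+ _] := Hth s0; rewrite c2 eqxx andbT ifT //.
  by apply/eqP; case: h4.
- move=> s0 h3 c1; have /andP[_] := Hth s0; rewrite c1 eqxx andbT ifT //.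
  by apply/eqP; case: h3.
Qed.

Lemma kan_check_sound : kan_check ne A (enc e) (enc e') ->
  [/\ forall x : chain D, diff_fun (diff_fun x) = 0,
      forall x : chain D, diff_fun (op_X e x) = op_X e (diff_fun x),
      forall x : chain D, diff_fun (op_X e' x) = op_X e' (diff_fun x) &
      forall h c, ~ (c - h + 5 = 1 \/ c - h + 5 = -1) -> exact D h c].
Proof.
have all_st := all_kinfos encK enc_lt decK HA.
have hs := st_info_height ne dec A; have ss := st_info_sign encK enc_lt decK HA.
rewrite /kan_check; cbv zeta => /and4P[H1 H2 H3 H4]; split.
- exact: (square_of_check encK enc_lt decK HA H1).
- exact: (commute_diff_of_check encK enc_lt decK HA H2).
- exact: (commute_diff_of_check encK enc_lt decK HA H3).
move=> h c hc; apply: (exact_of_check encK enc_lt decK HA) => s Hs Hc.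
have := all_st _ s H4; rewrite hs ss Hs Hc; case: ifP => [|_ H]; last exact: H.
by rewrite !inE => H; exfalso; apply: hc; case/orP: H => /eqP ->; [left|right].
Qed.
End Soundness.

Lemma cap_check_true : cap_check 16 num_cap 12 13.
Proof. by vm_compute. Qed.
Lemma kan_check_true : kan_check 18 num_kan 12 14.
Proof. by vm_compute. Qed.

Lemma cap_check_kan0 :
  [/\ forall x : chain (CapKan 0), op_X (cap_end 0) (op_X (cap_bot 0) x) = op_X (cap_bot 0) (op_X (cap_end 0) x),
      cap_exact 0 & forall s, cap_top 0 s].
Proof.
have e1 : edge_code (cap_end 0) = 12%N by rewrite /cap_end edge_code_Epos.
have e2 : edge_code (cap_bot 0) = 13%N by rewrite /cap_bot edge_code_Epos.
have [] := @cap_check_sound (CapKan 0) 16 (@edge_code 0) (@edge_decode 0) num_cap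
  (@edge_codeK 0) (@edge_code_lt 0) (@edge_decodeK 0) num_capE (cap_end 0) (cap_bot 0).
  by rewrite e1 e2; exact: cap_check_true.
move=> h1 h2 h3; split; first exact: h1.
  by move=> h c hc; apply: h2; rewrite !addr0 in hc.
by move=> s b u; rewrite !subr0; apply: h3.
Qed.

(** The edges above and below the only twist crossing become the cap and the lower arc of its
    0-smoothing, but one and the same edge of its 1-smoothing. *)
Definition kan_high : edge (Kan 1) := Epos 1 0 false.
Definition kan_low : edge (Kan 1) := Epos 1 1 false.

Lemma kan_check_kan1 :
  [/\ forall x : chain (Kan 1), diff_fun (diff_fun x) = 0,
      forall x : chain (Kan 1), diff_fun (op_X kan_high x) = op_X kan_high (diff_fun x),
      forall x : chain (Kan 1), diff_fun (op_X kan_low x) = op_X kan_low (diff_fun x) &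
      kan_exact 1].
Proof.
have e1 : edge_code kan_high = 12%N by rewrite edge_code_Epos.
have e2 : edge_code kan_low = 14%N by rewrite edge_code_Epos.
have [] := @kan_check_sound (Kan 1) 18 (@edge_code 1) (@edge_decode 1) num_kan
  (@edge_codeK 1) (@edge_code_lt 1) (@edge_decodeK 1) num_kanE kan_high kan_low.
  by rewrite e1 e2; exact: kan_check_true.
move=> h1 h2 h3 h4; split; [exact: h1|exact: h2|exact: h3|].
by move=> h c hc; apply: h4 => H; apply: hc; lia.
Qed.

(** * Khovanov homology off the two diagonals *)

Section Induction.
Local Notation d := (@diff_fun _).

Definition kan_base : edge (Kan 0) := Epos 0 0 false.

Lemma kan0_high x : kan0 (op_X kan_high x) = op_X (cap_end 0) (kan0 x).
Proof.
apply/ffunP => t; rewrite [LHS]ffunE; apply: (op_X_pull (smooth_Kan0 0) (e' := cap_end 0)).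
by rewrite /kan_high edge_map_Epos.
Qed.
Lemma kan0_low x : kan0 (op_X kan_low x) = op_X (cap_bot 0) (kan0 x).
Proof.
apply/ffunP => t; rewrite [LHS]ffunE; apply: (op_X_pull (smooth_Kan0 0) (e' := cap_bot 0)).
by rewrite /kan_low edge_map_Epos.
Qed.
Lemma kan1_high x : kan1 (op_X kan_high x) = op_X kan_base (kan1 x).
Proof.
apply/ffunP => t; rewrite [LHS]ffunE; apply: (op_X_pull (smooth_Kan1 0) (e' := kan_base)).
by rewrite /kan_high edge_map_Epos.
Qed.
Lemma kan1_low x : kan1 (op_X kan_low x) = op_X kan_base (kan1 x).
Proof.
apply/ffunP => t; rewrite [LHS]ffunE; apply: (op_X_pull (smooth_Kan1 0) (e' := kan_base)).
by rewrite /kan_low edge_map_Epos.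
Qed.

(** The complex of [CapKan 0] is a quotient of that of [Kan 1], so its identities are images of the
    computed ones. *)
Lemma cap_laws0 : cap_laws 0.
Proof.
have [dd hi lo _] := kan_check_kan1; have [XY _ _] := cap_check_kan0.
split=> x; last exact: XY.
- have [z [z0 _]] := Kan_glue x 0; by rewrite -z0 -!diff_kan0 dd raddf0.
- have [z [z0 _]] := Kan_glue x 0; by rewrite -z0 -kan0_high -!diff_kan0 hi kan0_high.
- have [z [z0 _]] := Kan_glue x 0; by rewrite -z0 -kan0_low -!diff_kan0 lo kan0_low.
Qed.

(** The complex of [Kan 0] is a subcomplex of that of [Kan 1], and the mixed component of d d = 0 is
    the rule for the saddle. *)
Lemma saddle_laws0 : saddle_laws 0.
Proof.
have [dd hi lo _] := kan_check_kan1; split=> x.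
- have [z [z0 z1]] := Kan_glue 0 x; have := congr1 (@kan1 0) (dd z).
  by rewrite !diff_kan1 diff_kan0 z0 z1 !raddf0 !addr0.
- have [z [z0 z1]] := Kan_glue x 0; have := congr1 (@kan1 0) (dd z).
  rewrite !diff_kan1 diff_kan0 z0 z1 !raddf0 add0r => /eqP; rewrite addrC addr_eq0 => /eqP.
  by [].
(* X at [kan_high] and at [kan_low] restrict to the same operator on [Kan 0], but to X and Y on
   [CapKan 0]. *)
have [z [z0 z1]] := Kan_glue x 0.
have := congr1 (@kan1 0) (hi z); have := congr1 (@kan1 0) (lo z).
rewrite !(diff_kan1, kan1_high, kan1_low, kan0_high, kan0_low) z0 z1 !raddf0 !add0r.
by move=> -> ->.
Qed.

Lemma cap_lawsP n : cap_laws n.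
Proof. by elim: n => [|n]; [exact: cap_laws0 | exact: cap_lawsS]. Qed.
Lemma saddle_lawsP n : saddle_laws n.
Proof.
by elim: n => [|n]; [exact: saddle_laws0 | apply: saddle_lawsS; apply: cap_lawsP].
Qed.
Lemma cap_exactP n : cap_exact n.
Proof.
elim: n => [|n]; first by have [_ H _] := cap_check_kan0.
by apply: cap_exactS; apply: cap_lawsP.
Qed.
Lemma cap_topP n s : cap_top n s.
Proof.
elim: n s => [|n IH] s; first by have [_ _ H] := cap_check_kan0; exact: H.
by apply: cap_topS; [apply: cap_lawsP | apply: IH].
Qed.
Lemma kan_exactP n : kan_exact n.+1.
Proof.
elim: n => [|n IH]; first by have [_ _ _ H] := kan_check_kan1.
by apply: kan_exactS => //; auto using cap_lawsP, saddle_lawsP, cap_exactP, cap_topP.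
Qed.

End Induction.

(** * From exactness to vanishing homology *)

Section Homology.
Variable D : diagram.
Local Open Scope quotient_scope.

Lemma mem_chain_group i j (x : chain D) :
  (x \in chain_group D i j) <-> (forall s, x s != 0 -> hom_deg s = i /\ q_deg s = j).
Proof.
split=> [xij s|H].
  move: xij => /coord_span ->; rewrite sum_ffunE => nz.
  have [k nzk] : exists k : 'I_#|[pred s : enhanced_state D | (hom_deg s == i) && (q_deg s == j)]|,
      (image (@delta D) [pred s | (hom_deg s == i) && (q_deg s == j)])`_k s != 0.
    apply/existsP; apply: contraNT nz => /existsPn nz; apply/eqP/big1 => k _.
    by rewrite ffunE /= (eqP (negPn (nz k))) scaler0.
  have /imageP[t] : (image (@delta D) [pred s | (hom_deg s == i) && (q_deg s == j)])`_k
     \in image (@delta D) [pred s | (hom_deg s == i) && (q_deg s == j)] by apply: mem_nth; rewrite size_image.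
  rewrite inE => /andP[/eqP ht /eqP qt] E0; move: nzk; rewrite E0 ffunE.
  by case: (s =P t) => [->|_]; rewrite ?eqxx.
have -> : x = \sum_s x s *: delta s.
  apply/ffunP => t; rewrite sum_ffunE (bigD1 t) //= big1 ?addr0 => [|s /negPf st].
    by rewrite !ffunE eqxx /GRing.scale /= mulr1.
  by rewrite !ffunE eq_sym st scaler0.
apply: memv_suml => s _; case: (eqVneq (x s) 0) => [->|/H[hs qs]].
  by rewrite scale0r mem0v.
apply/memvZ/memv_span/imageP; exists s => //.
by rewrite inE hs qs !eqxx.
Qed.

Lemma homog_chain_group i j (x : chain D) :
  homog (i + (n_neg D)%:Z) (j - i - (n_pos D)%:Z + (n_neg D)%:Z) x <-> x \in chain_group D i j.
Proof.
rewrite mem_chain_group; split=> H s /H[]; rewrite /hom_deg /q_deg; lia.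
Qed.

Lemma vquot_eq0 (K : fieldType) (V : vectType K) (U : {vspace V}) (v : V) :
  (\pi_(vquot U) v == 0) = (v \in U).
Proof.
rewrite -[RHS](congr1 (fun w => w \in U) (subr0 v)).
by rewrite (Quotient.idealrBE U v 0) raddf0.
Qed.

Lemma Kh_eq0 i j : exact D (i + (n_neg D)%:Z) (j - i - (n_pos D)%:Z + (n_neg D)%:Z) ->
  forall x : Kh D i j, x = 0.
Proof.
move=> ex; elim/quotW => v; apply/eqP; rewrite vquot_eq0 -memv_preim lfunE /=.
have := subvsP v; rewrite /cycles memv_cap memv_ker lfunE /= => /andP[/homog_chain_group Hv /eqP dv].
have [y Hy dy] := ex _ Hv dv.
apply/memv_imgP; exists y; last by rewrite lfunE.
apply/homog_chain_group; have -> : i - 1 + (n_neg D)%:Z = i + (n_neg D)%:Z - 1 by lia.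
have -> // : j - (i - 1) - (n_pos D)%:Z + (n_neg D)%:Z = j - i - (n_pos D)%:Z + (n_neg D)%:Z + 1.
by lia.
Qed.
End Homology.

Lemma count_crossings (D : diagram) (P : pred (crossing (edge D))) :
  #|[set k | P (xing k)]| = count P (crossings D).
Proof.
transitivity (count P [seq xing k | k <- enum 'I_(size (crossings D))]).
  by rewrite count_map count_enum; apply: eq_card => k; rewrite inE.
by congr count; exact: (map_tnth_enum (in_tuple (crossings D))).
Qed.

Lemma count_twists E (P : pred (crossing E)) pos n sgn down b :
  (forall a0 a1 a2 a3 f, P (Crossing a0 a1 a2 a3 (if sgn then ~~ f else f) f) = b) ->
  count P (twists pos n sgn down) = (if b then n else 0)%N.
Proof.
move=> H; rewrite /twists count_map (eq_count (a2 := fun=> b)) => [|k /=]; last first.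
  by case: sgn H => H; rewrite H.
by case: b {H}; rewrite ?count_pred0 // count_predT size_iota.
Qed.

Lemma n_neg_Kan n : n_neg (Kan n) = 4.
Proof.
rewrite /n_neg (count_crossings (D := Kan n) (fun x => ~~ positive x)) /= cats0 (@count_twists _ _ _ _ _ _ false).
  by rewrite addn0; case: (odd n).
by move=> a0 a1 a2 a3 [].
Qed.

Lemma n_pos_Kan n : n_pos (Kan n) = (4 + n)%N.
Proof.
rewrite /n_pos (count_crossings (D := Kan n) (@positive _)) /= cats0 (@count_twists _ _ _ _ _ _ true).
  by rewrite addn0; case: (odd n).
by move=> a0 a1 a2 a3 [].
Qed.

Lemma Kan_thin n i j : ~ (j - 2 * i = 1 \/ j - 2 * i = -1) -> forall x : Kh (Kan n.+1) i j, x = 0.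
Proof.
move=> hij; apply: Kh_eq0; apply: kan_exactP; rewrite n_neg_Kan n_pos_Kan => H; apply: hij.
lia.
Qed.

(** * Mirror images *)

Section QuotientIsomorphism.
Local Open Scope quotient_scope.

Section Transfer.
Variables (K : fieldType) (V V' : vectType K) (U : {vspace V}) (U' : {vspace V'}).
Variables (n : nat) (X : n.-tuple V) (X' : n.-tuple V').

(** Each quotient is identified with a complement; matching bases of the two complements and killing
    [U] induces the isomorphism. *)
Definition transfer (v : V) : V' := \sum_(i < n) coord X i (v - projv U v) *: X'`_i.

Lemma transfer_is_linear : linear transfer.
Proof.
move=> a v w; rewrite /transfer scaler_sumr -big_split; apply: eq_bigr => i _ /=.
by rewrite linearP opprD addrACA -scalerBr linearP scalerDl scalerA.
Qed.

Lemma transfer_ker v : v \in U -> transfer v = 0.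
Proof.
by move=> vU; rewrite /transfer projv_id // subrr big1 // => i _; rewrite linear0 scale0r.
Qed.
End Transfer.

Lemma transferK (K : fieldType) (V V' : vectType K) (U : {vspace V}) (U' : {vspace V'})
    n (X : n.-tuple V) (X' : n.-tuple V') v :
  basis_of (U^C)%VS X -> basis_of (U'^C)%VS X' ->
  transfer U' X' X (transfer U X X' v) = v - projv U v.
Proof.
move=> bX bX'; set w := transfer U X X' v.
have wC : w \in (U'^C)%VS.
  apply: memv_suml => i _; apply/memvZ/(basis_mem bX')/mem_nth; rewrite size_tuple; exact: ltn_ord.
have wU : w - projv U' w = w.
  suff -> : projv U' w = 0 by rewrite subr0.
  apply/eqP; rewrite -memv0 -(capv_compl U') memv_cap memv_proj /=.
  by rewrite -[projv U' w](subKr w) memvB ?memv_projC.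
rewrite {1}/transfer wU [RHS](coord_basis bX (memv_projC U v)).
apply: eq_bigr => i _; congr (_ *: _).
by rewrite coord_sum_free // (basis_free bX').
Qed.

Lemma vquot_isomorphic (K : fieldType) (V V' : vectType K) (U : {vspace V}) (U' : {vspace V'}) :
  \dim (U^C)%VS = \dim (U'^C)%VS -> isomorphic (vquot U) (vquot U').
Proof.
move=> codim; pose n := \dim (U^C)%VS.
pose X : n.-tuple V := vbasis (U^C)%VS.
pose X' : n.-tuple V' := tcast (esym codim) (vbasis (U'^C)%VS).
have bX : basis_of (U^C)%VS X by apply: vbasisP.
have bX' : basis_of (U'^C)%VS X' by rewrite /X' val_tcast; apply: vbasisP.
pose f (x : vquot U) : vquot U' := \pi_(vquot U') (transfer U X X' (repr x)).
pose g (x : vquot U') : vquot U := \pi_(vquot U) (transfer U' X' X (repr x)).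
have tpi (W W' : vectType K) (A : {vspace W}) (A' : {vspace W'}) (Y : n.-tuple W) (Y' : n.-tuple W') v :
    \pi_(vquot A') (transfer A Y Y' (repr (\pi_(vquot A) v))) = \pi_(vquot A') (transfer A Y Y' v).
  congr (\pi _); apply/eqP; rewrite -subr_eq0.
  pose tl := GRing.isLinear.Build _ _ _ _ _ (transfer_is_linear A Y Y').
  pose T : {linear W -> W'} := HB.pack (transfer A Y Y') tl.
  have <- : T (repr (\pi_(vquot A) v) - v) = transfer A Y Y' (repr (\pi_(vquot A) v)) - transfer A Y Y' v.
    exact: (raddfB T).
  by rewrite /T /= transfer_ker // (Quotient.idealrBE A) reprK.
have fg (W W' : vectType K) (A : {vspace W}) (A' : {vspace W'}) (Y : n.-tuple W) (Y' : n.-tuple W') :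
    basis_of (A^C)%VS Y -> basis_of (A'^C)%VS Y' ->
    cancel (fun x : vquot A => \pi_(vquot A') (transfer A Y Y' (repr x)))
           (fun x : vquot A' => \pi_(vquot A) (transfer A' Y' Y (repr x))).
  move=> bY bY'; elim/quotW => v; rewrite !tpi transferK //.
  by apply/eqP; rewrite -(Quotient.idealrBE A); rewrite addrAC memvB ?memv_proj // (Quotient.idealrBE A) reprK.
have fl : linear f.
  move=> a; elim/quotW => v; elim/quotW => w.
  rewrite /f -[a *: _]/(vquot_scale _ _) -vquot_scale_pi -raddfD !tpi transfer_is_linear raddfD; congr (_ + _).
  exact: vquot_scale_pi.
pose fL := GRing.isLinear.Build _ _ _ _ _ fl.
pose F : {linear vquot U -> vquot U'} := HB.pack f fL.
by exists F; exists g; apply: fg.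
Qed.
End QuotientIsomorphism.

(** * Ranks of operators and transposition *)

Section OperatorRank.
Variables (S : finType) (a : S -> S -> rat).
Local Notation C := {ffun S -> rat^o}.

Lemma mxop_is_linear : linear (mxop a).
Proof.
move=> c x y; apply/ffunP => t; rewrite !ffunE /GRing.scale /= mulr_sumr -big_split.
by apply: eq_bigr => s _; rewrite !ffunE mulrDr mulrCA.
Qed.

HB.instance Definition _ := GRing.isLinear.Build rat C C _ (mxop a) mxop_is_linear.

Definition op_rank : nat := \dim (limg (linfun (mxop a))).

(** Rank factorization treats rows and columns alike, so the rank is seen to be invariant under
    transposition. *)
Lemma op_rank_leP r : (op_rank <= r)%N <->
  exists (u w : 'I_r -> S -> rat), forall s t, a s t = \sum_i u i s * w i t.
Proof.
have mxop_delta s t : mxop a [ffun t => (t == s)%:R] t = a s t.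
  rewrite ffunE (bigD1 s) //= big1 => [|s' /negPf ss]; rewrite ffunE ?eqxx ?mulr1 ?addr0 //.
  by rewrite ss mulr0.
split=> [rr|[u [w H]]].
  pose V := limg (linfun (mxop a)); pose f s := mxop a [ffun t => (t == s)%:R].
  have fV s : f s \in V by apply/memv_imgP; exists [ffun t => (t == s)%:R]; rewrite ?memvf // lfunE.
  have key s t : f s t = \sum_(i < \dim V) coord (vbasis V) i (f s) * (vbasis V)`_i t.
    rewrite {1}(coord_vbasis (fV s)) sum_ffunE; apply: eq_bigr => i _; rewrite ffunE.
    by [].
  exists (fun i s => if insub (val i) is Some j then coord (vbasis V) j (f s) else 0).
  exists (fun i t => (vbasis V)`_i t) => s t.
  pose F k := (if insub k is Some j then coord (vbasis V) j (f s) else 0) * (vbasis V)`_k t.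
  rewrite -mxop_delta -/(f s) key (eq_bigr (fun i => F (val i))) => [|i _]; last first.
    by rewrite /F valK.
  rewrite (big_ord_widen _ F rr) big_mkcond /=; apply: eq_bigr => i _; rewrite /F.
  by case: insubP => [j -> //|/negPf ->]; rewrite mul0r.
pose X := [seq [ffun t => w i t] : C | i <- enum 'I_r].
have sX : size X = r by rewrite size_map size_enum_ord.
apply: leq_trans (_ : \dim <<X>>%VS <= r)%N; last by rewrite -[X in (_ <= X)%N]sX dim_span.
apply/dimvS/subvP => _ /memv_imgP[x _ ->]; rewrite lfunE /=.
have -> : mxop a x = \sum_i (\sum_s u i s * x s) *: ([ffun t => w i t] : C).
  apply/ffunP => t; rewrite ffunE sum_ffunE.
  under eq_bigr => s _ do rewrite H mulr_suml.
  rewrite exchange_big; apply: eq_bigr => i _; rewrite !ffunE /GRing.scale /= mulr_suml.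
  by apply: eq_bigr => s _; rewrite mulrAC.
apply: memv_suml => i _; apply/memvZ/memv_span/map_f; exact: mem_enum.
Qed.
End OperatorRank.

Lemma op_rank_dual_le (S S' : finType) (a : S -> S -> rat) (a' : S' -> S' -> rat)
    (phi : S' -> S) (e : S' -> rat) :
  (forall s t, a' s t = e s * e t * a (phi t) (phi s)) -> (op_rank a' <= op_rank a)%N.
Proof.
move=> H; have [u [w auw]] := (op_rank_leP a _).1 (leqnn _).
apply/op_rank_leP; exists (fun i s => e s * w i (phi s)), (fun i s => e s * u i (phi s)) => s t.
by rewrite H auw mulr_sumr; apply: eq_bigr => i _; ring.
Qed.

Lemma op_rank_dual (S S' : finType) (a : S -> S -> rat) (a' : S' -> S' -> rat)
    (phi : S -> S') (e : S -> rat) :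
  bijective phi -> (forall s, e s * e s = 1) ->
  (forall s t, a' (phi t) (phi s) = e s * e t * a s t) -> op_rank a' = op_rank a.
Proof.
move=> [psi pK qK] ee H; apply/eqP; rewrite eqn_leq; apply/andP; split.
  apply: (op_rank_dual_le (phi := psi) (e := e \o psi)) => s t /=.
  by rewrite -{1}[s]qK -{1}[t]qK H mulrC [e _ * e _]mulrC mulrC.
apply: (op_rank_dual_le (phi := phi) (e := e)) => s t.
by rewrite H mulrA mulrACA !ee mulr1 mul1r.
Qed.

Section Homology.
Variable D : diagram.
Implicit Types s t : enhanced_state D.

Definition in_degree i j s : bool := (hom_deg s == i) && (q_deg s == j).
Definition restrict_op i j (a : enhanced_state D -> enhanced_state D -> rat) s t : rat :=
  a s t * (in_degree i j s)%:R.
Definition id_coef s t : rat := (s == t)%:R.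
Definition diff2_coef s t : rat := \sum_u diff_coef s u * diff_coef u t.

Lemma dim_img_chain_group i j a :
  \dim (linfun (mxop a) @: chain_group D i j) = op_rank (restrict_op i j a).
Proof.
pose pr := mxop (restrict_op i j id_coef).
have prE x t : pr x t = (in_degree i j t)%:R * x t.
  rewrite ffunE (bigD1 t) //= big1 => [|s /negPf st]; rewrite /restrict_op /id_coef.
    by rewrite eqxx mul1r addr0.
  by rewrite st !mul0r.
have <- : limg (linfun pr) = chain_group D i j.
  apply/vspaceP => x; apply/idP/idP => [/memv_imgP[y _ ->]|].
    apply/mem_chain_group => s; rewrite lfunE /= prE.
    by case: (boolP (in_degree i j s)) => [/andP[/eqP-> /eqP->]//|_]; rewrite mul0r eqxx.
  move/mem_chain_group => H; apply/memv_imgP; exists x; rewrite ?memvf // lfunE; apply/ffunP => s /=.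
  rewrite prE /in_degree; case: (eqVneq (x s) 0) => [->|/H[-> ->]]; first by rewrite mulr0.
  by rewrite !eqxx mul1r.
rewrite /op_rank -limg_comp; congr (\dim (limg _)); apply/lfunP => x.
rewrite comp_lfunE !lfunE /=; apply/ffunP => t; rewrite mxop_comp ffunE.
apply: eq_bigr => s _; congr (_ * _); rewrite (bigD1 s) //= big1 => [|u us].
  by rewrite /restrict_op /id_coef eqxx mul1r addr0 mulrC.
by rewrite /restrict_op /id_coef eq_sym (negPf us) !mul0r.
Qed.

Lemma dim_chain_group i j : \dim (chain_group D i j) = op_rank (restrict_op i j id_coef).
Proof.
rewrite -dim_img_chain_group -[in LHS](lim1g (chain_group D i j)); congr (\dim (_ @: _)).
apply/lfunP => x; rewrite id_lfunE lfunE; apply/ffunP => t; rewrite ffunE.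
by rewrite (bigD1 t) //= big1 => [|s /negPf st]; rewrite /id_coef ?st ?mul0r // eqxx mul1r addr0.
Qed.

Lemma differential_mxop : differential D = linfun (mxop (@diff_coef D)).
Proof. by apply/lfunP => x; rewrite !lfunE; exact: diff_mxop. Qed.

Lemma dim_diff i j :
  \dim (differential D @: chain_group D i j) = op_rank (restrict_op i j (@diff_coef D)).
Proof. by rewrite differential_mxop dim_img_chain_group. Qed.

Lemma dim_diff2 i j :
  \dim (differential D @: (differential D @: chain_group D i j)) =
  op_rank (restrict_op i j diff2_coef).
Proof.
rewrite -dim_img_chain_group -limg_comp; congr (\dim (_ @: _)).
apply/lfunP => x; rewrite comp_lfunE differential_mxop !lfunE; apply/ffunP => t.
by rewrite /= mxop_comp ffunE.
Qed.

Lemma diff_coef_degree s t : diff_coef s t != 0 ->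
  hom_deg t = hom_deg s + 1 /\ q_deg t = q_deg s.
Proof.
move=> nz; have [k inc] : exists k, incident k s t.
  apply/existsP; apply: contraNT nz => /existsPn nz; apply/eqP/big1 => k.
  by rewrite (negPf (nz k)).
split; last by case/and4P: inc => _ _ _ /eqP.
by rewrite /hom_deg (incident_height inc); lia.
Qed.

Lemma boundaries_sub i j : (boundaries D i j <= chain_group D i j)%VS.
Proof.
apply/subvP => _ /memv_imgP[x /mem_chain_group Hx ->]; apply/mem_chain_group => t.
rewrite differential_mxop lfunE /= ffunE => nz.
have [s] : exists s, diff_coef s t * x s != 0.
  by apply/existsP; apply: contraNT nz => /existsPn nz; apply/eqP/big1 => s _; apply/eqP/negPn.
rewrite mulf_eq0 negb_or => /andP[/diff_coef_degree[-> ->] /Hx[-> ->]].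
by rewrite subrK.
Qed.

(** Rank-nullity twice: the cycles have dimension dim C - rank d, and the boundaries that are cycles
    have dimension rank d - rank (d d) for the incoming d. With the rank of d d kept, the count is
    valid for every diagram. *)
Lemma Kh_codim i j :
  let V := subvs_of (cycles D i j) in
  let B := (linfun (vsval : V -> chain D) @^-1: boundaries D i j)%VS in
  (\dim (B^C)%VS + op_rank (restrict_op i j (@diff_coef D))
    + op_rank (restrict_op (i - 1)%R j (@diff_coef D)) =
   op_rank (restrict_op i j id_coef) + op_rank (restrict_op (i - 1)%R j diff2_coef))%N.
Proof.
move=> V B; pose f := linfun (vsval : V -> chain D).
have f_inj : lker f == 0%VS.
  by apply/lker0P => x y; rewrite !lfunE /= => /val_inj.
have imf : limg f = cycles D i j.
  apply/vspaceP => x; apply/memv_imgP/idP => [[y _ ->]|xc]; first by rewrite lfunE subvsP.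
  by exists (Subvs xc); rewrite ?memvf // lfunE.
have dB : \dim B = \dim (boundaries D i j :&: lker (differential D))%VS.
  rewrite -(limg_dim_eq (f := f)); last by rewrite (eqP f_inj) capv0.
  congr (\dim _).
  rewrite /B -/f; apply/vspaceP => x; rewrite memv_cap; apply/memv_imgP/idP => [[y]|/andP[xb xk]].
    rewrite -memv_preim => yb ->; rewrite yb /=.
    by have := memv_img f (memvf y); rewrite imf memv_cap => /andP[].
  have xc : x \in cycles D i j by rewrite memv_cap xk (subvP (boundaries_sub i j)).
  by exists (Subvs xc); rewrite -?memv_preim lfunE.
have dV : \dim {: V} = \dim (cycles D i j) by have <- := congr1 (fun W : {vspace chain D} => \dim W) imf; apply/esym/limg_dim_eq; rewrite (eqP f_inj) capv0.
have h1 := limg_ker_dim (differential D) (chain_group D i j).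
have h2 := limg_ker_dim (differential D) (boundaries D i j).
rewrite -!dim_diff -dim_diff2 -dim_chain_group dimv_compl dV dB -/(boundaries D i j).
have := dimvS (subvf B); rewrite dV dB /cycles.
have arith (a b c k l m : nat) : (a + b = c -> k + l = m -> k <= a -> a - k + b + m = c + l)%N by lia.
exact: arith h1 h2.
Qed.
End Homology.

(** The bijection transposes the differential, so incoming and outgoing ranks change places and the
    codimension in [Kh_codim] stays the same. *)
Lemma Kh_dual (D D' : diagram) (phi : enhanced_state D -> enhanced_state D')
    (e : enhanced_state D -> rat) :
  bijective phi -> (forall s, e s * e s = 1) ->
  (forall s, hom_deg (phi s) = - hom_deg s) -> (forall s, q_deg (phi s) = - q_deg s) ->
  (forall s t, diff_coef (phi t) (phi s) = e s * e t * diff_coef s t) ->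
  forall i j, isomorphic (Kh D i j) (Kh D' (- i) (- j)).
Proof.
move=> phi_bij ee hphi qphi dphi i j.
have deg k l s : in_degree (- k) (- l) (phi s) = in_degree k l s.
  by rewrite /in_degree hphi qphi !eqr_opp.
have d2phi s t : diff2_coef (phi t) (phi s) = e s * e t * diff2_coef s t.
  rewrite /diff2_coef (reindex phi) /=; last exact: onW_bij.
  rewrite mulr_sumr; apply: eq_bigr => u _; rewrite !dphi.
  by rewrite -[RHS]mul1r -(ee u); ring.
have r0 : op_rank (restrict_op (- i) (- j) (@id_coef D')) = op_rank (restrict_op i j (@id_coef D)).
  apply: (op_rank_dual (phi := phi) (e := e)) => // s t.
  rewrite /restrict_op /id_coef deg (bij_eq phi_bij) eq_sym.
  by case: eqP => [->|]; rewrite ?mul0r ?mulr0 // ee !mul1r.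
have r1 k : op_rank (restrict_op (- k - 1) (- j) (@diff_coef D')) = op_rank (restrict_op k j (@diff_coef D)).
  apply: (op_rank_dual (phi := phi) (e := e)) => // s t.
  rewrite /restrict_op dphi -!mulrA; congr (_ * (_ * _)).
  case: (eqVneq (diff_coef s t) 0) => [->|/diff_coef_degree[ht qt]]; first by rewrite !mul0r.
  rewrite /in_degree hphi qphi ht qt eqr_opp -opprD eqr_opp (inj_eq (addIr 1)).
  by [].
have r2 : op_rank (restrict_op (- i - 1) (- j) (@diff2_coef D')) = op_rank (restrict_op (i - 1) j (@diff2_coef D)).
  apply: (op_rank_dual (phi := phi) (e := e)) => // s t.
  rewrite /restrict_op d2phi -!mulrA; congr (_ * (_ * _)).
  case: (eqVneq (diff2_coef s t) 0) => [->|nz]; first by rewrite !mul0r.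
  have [u] : exists u, diff_coef s u * diff_coef u t != 0.
    by apply/existsP; apply: contraNT nz => /existsPn nz; apply/eqP/big1 => u _; apply/eqP/negPn.
  rewrite mulf_eq0 negb_or => /andP[/diff_coef_degree[hu qu] /diff_coef_degree[ht qt]].
  rewrite /in_degree hphi qphi ht qt hu qu eqr_opp.
  by congr (_ * (_ && _)%:R); apply/eqP/eqP; lia.
apply: vquot_isomorphic; have := Kh_codim D i j; have := Kh_codim D' (- i) (- j).
have := r1 (i - 1); have -> : - (i - 1) - 1 = - i by ring.
move=> /= r1' ; rewrite r0 r2 r1 r1'; lia.
Qed.

(** Reflection reverses the cyclic order and fixes the ends of the under-strand; it exchanges the
    two smoothings. *)
Definition quad_rev (E : Type) (a : quad E) : quad E :=
  let: (a0, a1, a2, a3) := a in (a0, a3, a2, a1).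

Lemma connect_homo (T T' : finType) (e : rel T) (e' : rel T') (h : T -> T') x y :
  (forall x y, e x y -> e' (h x) (h y)) -> connect e x y -> connect e' (h x) (h y).
Proof.
move=> H /connectP[p]; elim: p x => [|z p IH] x /=; first by move=> _ ->; apply: connect0.
by case/andP=> xz pz lz; apply: connect_trans (connect1 (H _ _ xz)) (IH _ pz lz).
Qed.

Lemma signr_sum (I : finType) (F G : I -> nat) :
  (forall i, odd (F i) = odd (G i)) -> (-1) ^+ (\sum_i F i) = (-1) ^+ (\sum_i G i) :> rat.
Proof.
move=> H; rewrite -!prodrXr; apply: eq_bigr => i _.
by rewrite -signr_odd H signr_odd.
Qed.

(** A path reaching the crossing [k], cut where it first uses a join of [k], only uses joins at
    other crossings. Hence switching [k] leaves the set of touched edges unchanged. *)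
Lemma touched_except (D : diagram) k (s t : enhanced_state D) e :
  (forall l, l != k -> marker s l = marker t l) ->
  has (connect (adj (marker s)) e) (ends (arcs (xing k))) ->
  has (connect (adj (marker t)) e) (ends (arcs (xing k))).
Proof.
move=> st; set es := ends _; have Ees : es = ends (arcs (xing k)) by [].
move: es Ees => es Ees /hasP[x xk /connectP[p]]; elim: p e => [|z p IH] e /=.
  by move=> _ <-; apply/hasP; exists x.
case/andP=> /existsP[l ez] pz lz.
have [El|lk] := eqVneq l k.
  apply/hasP; exists e; last exact: connect0.
  move: ez; rewrite Ees El; case: (xing k) (marker s k) => a0 a1 a2 a3 ? ? [];
  by rewrite /smoothed /= !inE !xpair_eqE => /orP[/orP[]/andP[/eqP-> _]|/orP[]/andP[_ /eqP->]]; rewrite !eqxx ?orbT.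
have /hasP[y yk zy] := IH _ pz lz; apply/hasP; exists y => //.
by apply: connect_trans zy; apply: connect1; apply/existsP; exists l; rewrite -st.
Qed.

(** * Duality under reflection *)

Section Mirror.
Variables (D D' : diagram) (f : edge D -> edge D') (g : edge D' -> edge D).
Variables (pi : 'I_(size (crossings D)) -> 'I_(size (crossings D'))).
Variables (rho : 'I_(size (crossings D')) -> 'I_(size (crossings D))).
Hypotheses (fK : cancel f g) (gK : cancel g f) (piK : cancel pi rho) (rhoK : cancel rho pi).
Hypothesis arcs_pi : forall k, arcs (xing (pi k)) = quad_rev (quad_map f (arcs (xing k))).
Hypothesis positive_pi : forall k, positive (xing (pi k)) = ~~ positive (xing k).
Let f_inj := can_inj fK.
Let pi_inj := can_inj piK.
Implicit Types (s t : enhanced_state D) (v : {ffun 'I_(size (crossings D)) -> bool}).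

Definition mirror_marker v : {ffun 'I_(size (crossings D')) -> bool} := [ffun l => ~~ v (rho l)].

Lemma adj_mirror v e e' : adj (mirror_marker v) (f e) (f e') = adj v e e'.
Proof.
have key k : ((f e, f e') \in smoothed (xing (pi k)) (mirror_marker v (pi k)))
           || ((f e', f e) \in smoothed (xing (pi k)) (mirror_marker v (pi k))) =
   ((e, e') \in smoothed (xing k) (v k)) || ((e', e) \in smoothed (xing k) (v k)).
  rewrite ffunE piK !smoothedE arcs_pi; case: (arcs (xing k)) => [[[a0 a1] a2] a3].
  case: (v k); rewrite /= !inE !xpair_eqE !(inj_eq f_inj);
  by do 8 case: (_ == _).
apply/existsP/existsP => -[k kk]; first by exists (rho k); rewrite -key rhoK.
by exists (pi k); rewrite key.
Qed.

Lemma connect_mirror v e e' :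
  connect (adj (mirror_marker v)) (f e) (f e') = connect (adj v) e e'.
Proof.
apply/idP/idP; last by apply: connect_homo => x y; rewrite adj_mirror.
rewrite -{2}[e]fK -{2}[e']fK; apply: (connect_homo (h := g)) => x y.
by rewrite -{1}[x]gK -{1}[y]gK adj_mirror.
Qed.

Fact mirror_subproof s : [forall e, forall e', adj (mirror_marker (marker s)) e e' ==>
  ([ffun e => ~~ label s (g e)] e == [ffun e => ~~ label s (g e)] e' :> bool)].
Proof.
apply/forallP => e; apply/forallP => e'; apply/implyP; rewrite -{1}[e]gK -{1}[e']gK adj_mirror.
by move=> /connect1/label_connect; rewrite !ffunE => ->.
Qed.

Definition mirror_state s : enhanced_state D' := exist _ (_, _) (mirror_subproof s).

Lemma marker_mirror s : marker (mirror_state s) = mirror_marker (marker s). Proof. by []. Qed.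
Lemma marker_mirrorE s k : marker (mirror_state s) (pi k) = ~~ marker s k.
Proof. by rewrite marker_mirror ffunE piK. Qed.
Lemma label_mirrorE s e : label (mirror_state s) (f e) = ~~ label s e.
Proof. by rewrite /label /= ffunE fK. Qed.

Lemma height_mirror s : (height (mirror_state s) + height s)%N = size (crossings D).
Proof.
rewrite /height -[RHS]card_ord -(cardC [set k | marker s k]) addnC; congr addn.
rewrite -(card_imset _ (can_inj rhoK)); apply: eq_card => k; rewrite !inE.
apply/imsetP/idP => [[l]|sk]; first by rewrite inE marker_mirror ffunE => sl ->.
by exists (pi k); rewrite ?piK // inE marker_mirrorE.
Qed.

Lemma circle_sign_mirror s : circle_sign (mirror_state s) = - circle_sign s.
Proof.
pose ka := fingraph.root (adj (marker s)).
have kP x y : connect (adj (marker s)) x y = (ka x == ka y).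
  by apply/idP/eqP => /(fingraph.rootP (@connect_adj_sym _ _)).
rewrite (circle_sign_image kP) (@circle_sign_image _ _ (ka \o g)) => [|x y]; last first.
  by rewrite /= -kP -connect_mirror !gK.
have img (P Q : pred bool) : (forall b, P (~~ b) = Q b) ->
    [set (ka \o g) e | e in [pred e | P (label (mirror_state s) e)]] =
    [set ka e | e in [pred e | Q (label s e)]].
  move=> PQ; apply/setP => z; apply/imsetP/imsetP => -[e]; rewrite inE => le ->.
    by exists (g e) => //; rewrite inE -PQ -label_mirrorE gK.
  by exists (f e); rewrite ?inE ?label_mirrorE ?PQ //= fK.
rewrite opprB (img id negb) // (img negb id) // => b; exact: negbK.
Qed.

Lemma n_pos_neg (D0 : diagram) : (n_pos D0 + n_neg D0)%N = size (crossings D0).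
Proof.
rewrite /n_pos /n_neg -[RHS]card_ord -(cardC [set k | positive (xing k)]); congr addn.
by apply: eq_card => k; rewrite !inE.
Qed.

Lemma n_pos_mirror : n_pos D' = n_neg D.
Proof.
rewrite /n_pos /n_neg -(card_imset _ pi_inj); apply: eq_card => k; rewrite !inE.
apply/idP/imsetP => [kp|[l]]; last by rewrite inE => lp ->; rewrite positive_pi.
by exists (rho k); rewrite ?rhoK // inE -positive_pi rhoK.
Qed.

Lemma size_mirror : size (crossings D') = size (crossings D).
Proof. by rewrite -[LHS]card_ord -[RHS]card_ord; exact: (bij_eq_card (Bijective rhoK piK)). Qed.

Lemma n_neg_mirror : n_neg D' = n_pos D.
Proof. have := n_pos_neg D; have := n_pos_neg D'; rewrite size_mirror n_pos_mirror; lia. Qed.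

Lemma hom_deg_mirror s : hom_deg (mirror_state s) = - hom_deg s.
Proof.
rewrite /hom_deg n_neg_mirror; have := height_mirror s; have := n_pos_neg D; lia.
Qed.

Lemma q_deg_mirror s : q_deg (mirror_state s) = - q_deg s.
Proof.
rewrite /q_deg n_neg_mirror n_pos_mirror circle_sign_mirror.
have := height_mirror s; have := n_pos_neg D; lia.
Qed.

Lemma touched_mirror s e k :
  has (connect (adj (marker (mirror_state s))) (f e)) (ends (arcs (xing (pi k)))) =
  has (connect (adj (marker s)) e) (ends (arcs (xing k))).
Proof.
rewrite arcs_pi; case: (arcs (xing k)) => [[[a0 a1] a2] a3] /=.
by rewrite marker_mirror !connect_mirror; do 4 case: (connect _ _ _).
Qed.

(** Reversing an arrow exchanges merges and splits. The description by circle signs and by agreement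
    off the touched circles is symmetric under this, since the touched edges are the same at both
    ends. *)
Lemma incident_mirror k s t :
  incident (pi k) (mirror_state t) (mirror_state s) = incident k s t.
Proof.
rewrite !incidentE marker_mirrorE negbK !circle_sign_mirror.
rewrite !andbA; congr andb; last by rewrite eq_sym -subr_eq -opprD eqr_opp.
have -> : marker t k && agree_except (pi k) (mirror_state t) (mirror_state s) =
          ~~ marker s k && agree_except k s t.
  apply/andP/andP => -[].
    move=> tk /forallP H.
    have := H (pi k); rewrite !marker_mirrorE tk eqxx => /eqP -> ; split=> //.
    apply/forallP => l; have := H (pi l); rewrite !marker_mirrorE (inj_eq pi_inj).
    by case: (l =P k) => [->|_]; rewrite ?tk ?orbT // !orbF => /eqP/negb_inj ->.
  move=> sk /forallP H; have /eqP := H k; rewrite eqxx orbT => tk; split=> //.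
  apply/forallP => l; rewrite -[l]rhoK !marker_mirrorE (inj_eq pi_inj) (eqP (H (rho l))).
  by case: (rho l =P k) => [->|_]; rewrite ?orbF ?orbT // sk.
case: (boolP (~~ _ && _)) => //= /andP[sk /forallP st].
have touched e : has (connect (adj (marker t)) e) (ends (arcs (xing k))) =
                 has (connect (adj (marker s)) e) (ends (arcs (xing k))).
  by apply/idP/idP; apply: touched_except => l lk; rewrite (eqP (st l)) (negPf lk) orbF.
apply/forallP/forallP => H e.
  by have := H (f e); rewrite touched_mirror touched !label_mirrorE (inj_eq negb_inj) eq_sym.
by rewrite -[e]gK touched_mirror touched !label_mirrorE (inj_eq negb_inj) eq_sym.
Qed.

(** Reversing the cube and permuting the crossings by [pi] changes the cube signs by the
    coboundary of this exponent: the first sum reverses the cube, the second one counts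
    the inversions of [pi]. *)
Definition mirror_exponent s : nat :=
  (\sum_(k | marker s k) (\sum_l (pi l < pi k) + \sum_(l | marker s l) ((l < k) && (pi k < pi l))))%N.
Definition mirror_sign s : rat := (-1) ^+ mirror_exponent s.

Lemma mirror_exponent_incident k s t : ~~ marker s k -> agree_except k s t ->
  (mirror_exponent t = mirror_exponent s + \sum_l (pi l < pi k)
    + \sum_(l | marker s l) ((l < k) && (pi k < pi l))
    + \sum_(l | marker s l) ((k < l) && (pi l < pi k)))%N.
Proof.
move=> sk /forallP st.
have split_k (F : 'I_(size (crossings D)) -> nat) : (\sum_(l | marker t l) F l = F k + \sum_(l | marker s l) F l)%N.
  rewrite (bigD1 k) /= ?(eqP (st k)) ?eqxx ?orbT //; congr addn; apply: eq_bigl => l.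
  by rewrite (eqP (st l)); case: eqP => [->|_]; rewrite ?orbF ?andbT // (negPf sk) andbF.
rewrite /mirror_exponent split_k.
under [X in (_ + X)%N]eq_bigr => l _ do rewrite split_k addnCA.
rewrite big_split /= split_k ltnn /=; lia.
Qed.

Lemma cube_sign_mirror k s t : ~~ marker s k -> agree_except k s t ->
  cube_sign (pi k) (mirror_state t) = mirror_sign s * mirror_sign t * cube_sign k s.
Proof.
move=> sk st; rewrite /cube_sign /mirror_sign (mirror_exponent_incident sk st).
have -> : #|[set l : 'I_(size (crossings D')) | (l < pi k)%N && marker (mirror_state t) l]| = (\sum_(l < size (crossings D)) ((pi l < pi k) && ~~ marker t l))%N.
  rewrite -sum1_card big_mkcond (reindex pi) /=; last by exists rho => l _; rewrite ?piK ?rhoK.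
  by apply: eq_bigr => l _; rewrite inE marker_mirrorE; case: (_ && _).
have -> : #|[set l : 'I_(size (crossings D)) | (l < k)%N && marker s l]| = (\sum_(l < size (crossings D)) ((l < k) && marker s l))%N.
  by rewrite -sum1_card big_mkcond /=; apply: eq_bigr => l _; rewrite inE; case: (_ && _).
rewrite -!addnA exprD mulrA -expr2 sqrr_sign mul1r -exprD.
rewrite ![\sum_(l | marker s l) _]big_mkcond -!big_split /=.
(* Parities are compared for each [l] separately, by its marker and its position relative to [k]
   before and after [pi]. *)
apply: signr_sum => l; move/forallP: st => /(_ l) /eqP ->.
have [->|lk] := eqVneq l k; first by rewrite ltnn (negPf sk) !andbF.
rewrite orbF; have lk' : (k < l)%N = ~~ (l < k)%N by rewrite ltn_neqAle -leqNgt eq_sym lk.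
have plk : (pi k < pi l)%N = ~~ (pi l < pi k)%N.
  by rewrite ltn_neqAle -leqNgt eq_sym (inj_eq val_inj) (inj_eq pi_inj) lk.
rewrite lk' plk; by case: (marker s l); case: (l < k)%N; case: (pi l < pi k)%N.
Qed.

Lemma diff_coef_mirror s t :
  diff_coef (mirror_state t) (mirror_state s) = mirror_sign s * mirror_sign t * diff_coef s t.
Proof.
rewrite /diff_coef (reindex pi) /=; last by exists rho => l _; rewrite ?piK ?rhoK.
rewrite mulr_sumr; apply: eq_big => [k|k]; first exact: incident_mirror.
rewrite incident_mirror incidentE => /and4P[sk st _ _].
exact: cube_sign_mirror.
Qed.

Fact mirror_back_subproof (s : enhanced_state D') :
  [forall e, forall e', adj [ffun k => ~~ marker s (pi k)] e e' ==>
  ([ffun e => ~~ label s (f e)] e == [ffun e => ~~ label s (f e)] e' :> bool)].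
Proof.
apply/forallP => e; apply/forallP => e'; apply/implyP; rewrite -adj_mirror !ffunE.
have -> : mirror_marker [ffun k => ~~ marker s (pi k)] = marker s.
  by apply/ffunP => l; rewrite !ffunE rhoK negbK.
by move=> /connect1/label_connect ->.
Qed.

Lemma mirror_state_bij : bijective mirror_state.
Proof.
exists (fun s : enhanced_state D' => exist _ (_, _) (mirror_back_subproof s) : enhanced_state D) => s.
  apply: state_ext; apply/ffunP => x; rewrite ?[label _]/= ?[marker _]/= ffunE.
    by rewrite marker_mirrorE negbK.
  by rewrite label_mirrorE negbK.
apply: state_ext; apply/ffunP => x.
  by rewrite marker_mirror !ffunE rhoK negbK.
by rewrite -[x]gK label_mirrorE /label /= ffunE negbK.
Qed.

Lemma Kh_mirror i j : isomorphic (Kh D i j) (Kh D' (- i) (- j)).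
Proof.
apply: (Kh_dual (phi := mirror_state) (e := mirror_sign)).
- exact: mirror_state_bij.
- by move=> s; rewrite -expr2 sqrr_sign.
- exact: hom_deg_mirror.
- exact: q_deg_mirror.
- exact: diff_coef_mirror.
Qed.
End Mirror.

(** * Reflecting the diagram in its axis *)

Section KanMirror.
Variable n : nat.
Local Notation D := (Kan n.+1).
Local Notation D' := (kanenobu (Negz n) 0).

Definition flip (e : kanenobu_edge n.+1 0) : kanenobu_edge n.+1 0 :=
  match e with
  | inl (inl (b, e)) => inl (inl (~~ b, e))
  | inl (inr b) => inl (inr b)
  | inr (inl (k, b)) => inr (inl (k, ~~ b))
  | inr (inr (k, b)) => inr (inr (k, ~~ b))
  end.

Lemma flipK : involutive flip.
Proof. by case=> [[[[] ?]|?]|[[? []]|[? []]]]. Qed.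

Definition swap_halves (k : nat) : nat :=
  if (k < 4)%N then k.+4 else if (k < 8)%N then (k - 4)%N else k.

Lemma swap_halvesK : involutive swap_halves.
Proof. by do 8 case=> [|] //. Qed.

Lemma size_Kan : size (crossings D) = (8 + n.+1)%N.
Proof. by rewrite /= cats0 size_map size_iota. Qed.
Lemma size_Kan_mirror : size (crossings D') = (8 + n.+1)%N.
Proof. by rewrite /= cats0 size_map size_iota. Qed.

Lemma swap_halves_lt k : (k < 8 + n.+1 -> swap_halves k < 8 + n.+1)%N.
Proof. by do 8 case: k => [|k] //. Qed.

Lemma swap_lt (k : 'I_(size (crossings D))) : (swap_halves k < size (crossings D'))%N.
Proof. by rewrite size_Kan_mirror swap_halves_lt // -size_Kan ltn_ord. Qed.
Lemma swap_lt' (k : 'I_(size (crossings D'))) : (swap_halves k < size (crossings D))%N.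
Proof. by rewrite size_Kan swap_halves_lt // -size_Kan_mirror ltn_ord. Qed.

Definition swap (k : 'I_(size (crossings D))) := Ordinal (swap_lt k).
Definition swap' (k : 'I_(size (crossings D'))) := Ordinal (swap_lt' k).

Lemma xing_swap (T : Type) (F : crossing (edge D) -> T) (F' : crossing (edge D') -> T) :
  (forall k x0, (k < 8 + n.+1)%N ->
     F' (nth x0 (crossings D') (swap_halves k)) = F (nth x0 (crossings D) k)) ->
  forall k, F' (xing (swap k)) = F (xing k).
Proof.
move=> H k; rewrite /xing !(tnth_nth (xing k)) /= H // -size_Kan; exact: ltn_ord.
Qed.

Lemma Kan_mirror i j : isomorphic (Kh D i j) (Kh D' (- i) (- j)).
Proof.
apply: (@Kh_mirror D D' (flip : edge D -> edge D') (flip : edge D' -> edge D) swap swap').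
- exact: flipK.
- exact: flipK.
- by move=> k; apply: val_inj; exact: swap_halvesK.
- by move=> k; apply: val_inj; exact: swap_halvesK.
- apply: (xing_swap (F' := @arcs _) (F := fun x => quad_rev (quad_map flip (arcs x)))) => k x0.
  (* The eight crossings of the two halves and the first twist crossing are treated one by one, the
     other twist crossings uniformly. *)
  do 9 (case: k => [|k]; first by []).
  rewrite !addSn !ltnS => kn; rewrite /swap_halves /= !cats0 /twists.
  by rewrite !(nth_map 0%N) ?size_iota // nth_iota.
apply: (xing_swap (F' := @positive _) (F := fun x => ~~ positive x)) => k x0.
do 9 (case: k => [|k]; first by rewrite /= ?/positive /= ?addn0; case: (odd n)).
rewrite !addSn !ltnS => kn; rewrite /swap_halves /= !cats0 /twists.
by rewrite !(nth_map 0%N) ?size_iota // /positive /=; case: (odd _).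
Qed.
End KanMirror.

(** * The signature *)

Section HermitianForms.
Local Open Scope sesquilinear_scope.

Section Inertia.
Variables (C : numClosedFieldType) (n : nat).
Implicit Types (d x : 'rV[C]_n) (T : 'M[C]_n).

Lemma diag_form d x : (x *m diag_mx d *m x^t*) 0 0 = \sum_j d 0 j * (x 0 j * (x 0 j)^*).
Proof.
by rewrite mul_mx_diag !mxE; apply: eq_bigr => j _; rewrite !mxE mulrAC mulrC.
Qed.

(** The dimension count of Sylvester's law: with more positive than negative entries, some nonzero
    [x] supported on the positive ones has [x *m T] zero on the negative ones. The form is then
    positive at [x] and nonnegative at its image, though [T] reverses its sign. *)
Lemma inertia_le d T : (forall j, d 0 j \is Num.real) ->
  T *m diag_mx d *m T^t* = - diag_mx d ->
  (#|[set j | (0 < d 0 j)%R]| <= #|[set j | (d 0 j < 0)%R]|)%N.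
Proof.
move=> dR HT; set P := [set j | _]; set N := [set j | _]; rewrite leqNgt; apply/negP => lt.
pose M : 'M[C]_(#|P|, #|N|) := \matrix_(i, j) T (enum_val i) (enum_val j).
have /rowV0Pn[u /sub_kermxP uM u0] : kermx M != 0.
  rewrite -mxrank_eq0 mxrank_ker subn_eq0 -ltnNge.
  by apply: leq_ltn_trans lt; apply: rank_leq_col.
pose x : 'rV[C]_n := \row_j \sum_i u 0 i * (enum_val i == j)%:R.
have xP i : x 0 (enum_val i) = u 0 i.
  rewrite mxE (bigD1 i) //= eqxx mulr1 big1 ?addr0 // => k /negPf ki.
  by rewrite (inj_eq enum_val_inj) ki mulr0.
have xN j : j \notin P -> x 0 j = 0.
  move=> jP; rewrite mxE big1 // => i _.
  by case: eqP => [E|]; rewrite ?mulr0 //; move: jP; rewrite -E enum_valP.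
have yN j : j \in N -> (x *m T) 0 j = 0.
  move=> jN; transitivity ((u *m M) 0 (enum_rank_in jN j)); last by rewrite uM mxE.
  rewrite !mxE; under [RHS]eq_bigr => i _ do rewrite mxE enum_rankK_in // -xP.
  rewrite (bigID (mem P)) /= [X in _ + X]big1 ?addr0 => [|k /xN ->]; last by rewrite mul0r.
  by rewrite big_enum_val.
have E : \sum_j d 0 j * ((x *m T) 0 j * ((x *m T) 0 j)^*) =
         - \sum_j d 0 j * (x 0 j * (x 0 j)^*).
  rewrite -!diag_form trmx_mul map_mxM.
  have -> : x *m T *m diag_mx d *m (T^t* *m x^t*) = x *m (T *m diag_mx d *m T^t*) *m x^t*.
    by rewrite !mulmxA.
  by rewrite HT mulmxN mulNmx mxE.
have pos : 0 < \sum_j d 0 j * (x 0 j * (x 0 j)^*).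
  have [i ui] : exists i, u 0 i != 0.
    by apply/existsP; apply: contraNT u0 => /existsPn H; apply/eqP/rowP => i; rewrite mxE; apply/eqP/negPn.
  have dP := enum_valP i; rewrite inE in dP.
  rewrite (bigD1 (enum_val i)) //= ltr_wpDr //.
    apply: sumr_ge0 => j _; case: (boolP (j \in P)) => [|/xN ->]; last by rewrite mul0r mulr0.
    by rewrite inE => /ltW dj; rewrite mulr_ge0 ?mul_conjC_ge0.
  by rewrite mulr_gt0 // mul_conjC_gt0 xP.
have : 0 <= \sum_j d 0 j * ((x *m T) 0 j * ((x *m T) 0 j)^*).
  apply: sumr_ge0 => j _; case: (boolP (j \in N)) => [/yN ->|]; first by rewrite mul0r mulr0.
  by rewrite inE -real_leNgt ?real0 // => dj; rewrite mulr_ge0 ?mul_conjC_ge0.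
by rewrite E oppr_ge0 => /le_gtF; rewrite pos.
Qed.

Lemma inertia_balanced d T : (forall j, d 0 j \is Num.real) ->
  T *m diag_mx d *m T^t* = - diag_mx d ->
  #|[set j | 0 < d 0 j]| = #|[set j | d 0 j < 0]|.
Proof.
move=> dR HT; apply/eqP; rewrite eqn_leq (inertia_le dR HT) /=.
have := @inertia_le (- d) T; rewrite !raddfN /= mulNmx HT => H.
have {H} := H _ erefl.
have -> : [set j | 0 < (- d) 0 j] = [set j | d 0 j < 0] by apply/setP => j; rewrite !inE mxE oppr_gt0.
have -> : [set j | (- d) 0 j < 0] = [set j | 0 < d 0 j] by apply/setP => j; rewrite !inE mxE oppr_lt0.
by apply=> j; rewrite mxE rpredN.
Qed.
End Inertia.

(** The signature counts eigenvalues, so [C] is conjugated into a unitary eigenbasis, where the form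
    is diagonal. *)
Lemma mx_signature_anti n (A C : 'M[rat]_n) : A^T = A -> C *m A *m C^T = - A -> mx_signature A = 0.
Proof.
move=> Asym HC; rewrite /mx_signature; set AC := map_mx ratr A : 'M[algC]_n.
have ratr_conj m k (B : 'M[rat]_(m, k)) : (map_mx ratr B : 'M[algC]_(m, k)) ^t* = map_mx ratr B^T.
  by apply/matrixP => i j; rewrite !mxE fmorph_rat.
have AR : AC \is hermsymmx.
  by apply/is_hermitianmxP; rewrite expr0 scale1r ratr_conj Asym.
have /orthomx_spectralP := hermitian_normalmx AR.
set P := spectralmx AC; set d := spectral_diag AC => AE.
have PU : P \is unitarymx by apply: spectral_unitarymx.
have dR j : d 0 j \is Num.real.
  by have /mxOverP := hermitian_spectral_diag_real AR; apply.
pose CC := map_mx ratr C : 'M[algC]_n.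
have HCC : CC *m AC *m CC^t* = - AC by rewrite ratr_conj -!map_mxM HC map_mxN.
suff -> : #|[set j | 0 < d 0 j]| = #|[set j | d 0 j < 0]| by rewrite subrr.
apply: (inertia_balanced (T := P *m CC *m P^t*)) => //.
rewrite !trmx_mul !map_mxM map_trmx trmxK map_mxCK.
rewrite invmx_unitary // in AE.
have -> : P *m CC *m P^t* *m diag_mx d *m (P *m (CC^t* *m P^t*)) =
          P *m (CC *m (P^t* *m diag_mx d *m P) *m CC^t*) *m P^t* by rewrite !mulmxA.
rewrite -AE HCC mulmxN mulNmx {1}AE; congr (- _).
by rewrite !mulmxA (unitarymxP PU) mul1mx -mulmxA (unitarymxP PU) mulmx1.
Qed.

End HermitianForms.

(** * The Seifert form on flows *)

Section CrossingForm.
Variables (D : diagram) (z w : edge D -> rat) (x : crossing (edge D)).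
Definition conserves : bool := z (under_in x) + z (over_in x) == z (under_out x) + z (over_out x).
Definition crossing_form : rat := (z (right_out x) - z (right_in x)) * w (right_mid x).
End CrossingForm.

Section Flows.
Variable D : diagram.
Local Notation E := (edge D).
Implicit Types (z w : E -> rat) (x : crossing E).

Definition is_flow z : bool := all (conserves z) (crossings D).
Definition seifert z w : rat :=
  \sum_(x <- crossings D) crossing_form z w x.
Definition sym_seifert z w := seifert z w + seifert w z.

Definition flow_row z : 'rV[rat]_#|E| := \row_i z (enum_val i).
Definition row_flow (r : 'rV[rat]_#|E|) : E -> rat := fun e => r 0 (enum_rank e).

Lemma flow_rowK z : row_flow (flow_row z) =1 z.
Proof. by move=> e; rewrite /row_flow mxE enum_rankK. Qed.

Lemma eq_is_flow z w : z =1 w -> is_flow z = is_flow w.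
Proof. by move=> zw; apply: eq_all => x; rewrite /conserves !zw. Qed.

Lemma eq_seifert z z' w w' : z =1 z' -> w =1 w' -> seifert z w = seifert z' w'.
Proof. by move=> zz ww; apply: eq_bigr => x _; rewrite /crossing_form !zz ww. Qed.

Lemma mul_unit_flow r e : r *m (unit_flow e)^T = (row_flow r e)%:M.
Proof.
apply/matrixP => i j; rewrite !ord1 !mxE (bigD1 (enum_rank e)) //= !mxE !eqxx mulr1 big1 ?addr0 //.
by move=> k /negPf ke; rewrite !mxE ke andbF mulr0.
Qed.

Lemma seifert_mx r s : r *m seifert_form D *m s^T = (seifert (row_flow r) (row_flow s))%:M.
Proof.
rewrite /seifert_form mulmx_sumr mulmx_suml /seifert raddf_sum; apply: eq_bigr => x _.
rewrite -!mulmxA -[unit_flow _ *m s^T]trmxK trmx_mul trmxK mul_unit_flow tr_scalar_mx.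
rewrite mulmxA linearB /= mulmxBr !mul_unit_flow -raddfB /=.
by rewrite -scalar_mxM.
Qed.

Lemma is_flowP r : (r *m net_flow D == 0) = is_flow (row_flow r).
Proof.
have key k : (r *m net_flow D) 0 k = row_flow r (under_in (xing k)) + row_flow r (over_in (xing k))
    - row_flow r (under_out (xing k)) - row_flow r (over_out (xing k)).
  transitivity ((r *m (unit_flow (under_in (xing k)) + unit_flow (over_in (xing k))
                - unit_flow (under_out (xing k)) - unit_flow (over_out (xing k)))^T) 0 0).
    by rewrite mxE [RHS]mxE; apply: eq_bigr => i _; congr (_ * _); rewrite mxE [RHS]mxE.
  by rewrite !(linearB, linearD) /= !mul_unit_flow !mxE.
have -> : is_flow (row_flow r) = all (conserves (row_flow r)) (in_tuple (crossings D)) by [].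
apply/eqP/all_tnthP => [H k|H].
  have := key k; rewrite H mxE -/(xing k) /conserves => E0.
  by rewrite -subr_eq0 opprD addrA -E0.
apply/rowP => k; rewrite key [RHS]mxE; have := H k; rewrite -/(xing k) /conserves => /eqP ->.
by ring.
Qed.

(** Applied to the rows of the kernel matrix, which span the flows, [tau] gives flows again;
    expressing them through these rows produces the matrix [C] of an anti-isometry. *)
Lemma signature_anti (tau : (E -> rat) -> (E -> rat)) :
  (forall z, is_flow z -> is_flow (tau z)) ->
  (forall z w, is_flow z -> is_flow w -> sym_seifert (tau z) (tau w) = - sym_seifert z w) ->
  signature D = 0.
Proof.
move=> tau_flow tau_anti; pose K := kermx (net_flow D).
have Kflow i : is_flow (row_flow (row i K)).
  by rewrite -is_flowP -row_mul mulmx_ker row0.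
pose K' := \matrix_i flow_row (tau (row_flow (row i K))).
have /submxP[C CK] : (K' <= K)%MS.
  apply/row_subP => i; rewrite rowK; apply/sub_kermxP/eqP; rewrite is_flowP.
  by rewrite (eq_is_flow (flow_rowK _)); apply/tau_flow/Kflow.
have ent (M : 'M[rat]_#|E|) i j : (M *m seifert_form D *m M^T + (M *m seifert_form D *m M^T)^T) i j =
    sym_seifert (row_flow (row i M)) (row_flow (row j M)).
  rewrite mxE [_^T _ _]mxE.
  have e1 a b : (M *m seifert_form D *m M^T) a b = seifert (row_flow (row a M)) (row_flow (row b M)).
    transitivity ((row a M *m seifert_form D *m (row b M)^T) 0 0); last by rewrite seifert_mx mxE.
    rewrite -row_mul mxE [RHS]mxE; apply: eq_bigr => k _; rewrite [row _ _ _ _]mxE ![_^T _ _]mxE.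
    by rewrite [row b _ _ _]mxE.
  by rewrite !e1.
rewrite /signature -/(seifert_matrix D) (@mx_signature_anti _ _ C) ?oppr0 //.
  by rewrite linearD /= trmxK addrC.
have -> : C *m (seifert_matrix D + (seifert_matrix D)^T) *m C^T =
    K' *m seifert_form D *m K'^T + (K' *m seifert_form D *m K'^T)^T.
  rewrite mulmxDr mulmxDl CK /seifert_matrix -/K !trmx_mul !trmxK !mulmxA.
  by [].
apply/matrixP => i j; rewrite ent !rowK [RHS]mxE ent -tau_anti //.
by rewrite /sym_seifert !(eq_seifert (flow_rowK _) (flow_rowK _)).
Qed.
End Flows.

(** * The form on the twist region and on the two halves *)

Section Twists.
Variables (D : diagram) (pos : nat -> bool -> edge D).
Local Notation E := (edge D).
Implicit Types z w : E -> rat.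
Local Notation skew z k := (z (pos k false) - z (pos k true)).

Lemma twists_recr m sgn down : twists pos m.+1 sgn down =
  twists pos m sgn down ++ [:: let d := down (+) odd m in
       let tl := pos m false in let tr := pos m true in
       let bl := pos m.+1 false in let br := pos m.+1 true in
       if sgn then Crossing tr tl bl br (~~ d) d else Crossing tl bl br tr d d].
Proof. by rewrite /twists -{1}[m.+1]addn1 iotaD map_cat. Qed.

(** Conservation at a crossing with antiparallel strands says exactly that the difference of the two
    sides changes sign. *)
Lemma twists_conserves m z : all (conserves z) (twists pos m true true) <->
  forall k, (k <= m)%N -> skew z k = (-1) ^+ k * skew z 0.
Proof.
have last k d : conserves z (Crossing (pos k true) (pos k false) (pos k.+1 false) (pos k.+1 true) (~~ d) d)
    = (skew z k.+1 == - skew z k).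
  by rewrite /conserves; case: d => /=; apply/eqP/eqP => H; lra.
elim: m => [|m IH].
  by split=> // _ k; rewrite leqn0 => /eqP ->; rewrite mul1r.
rewrite twists_recr all_cat /= last andbT; split=> [/andP[/IH H /eqP dm] k|H].
  rewrite leq_eqVlt => /predU1P[->|]; last exact: H.
  by rewrite dm (H m) // exprS mulN1r mulNr.
apply/andP; split; first by apply/IH => k km; apply/H/leqW.
by rewrite (H m.+1) // (H m) // exprS mulN1r mulNr.
Qed.

(** Two consecutive crossings contribute - [skew z 0] * [skew w 0], since [skew] changes
    sign at each crossing; the last term is that of an unpaired crossing. *)
Lemma twists_form m z w :
  (forall k, (k <= m)%N -> skew z k = (-1) ^+ k * skew z 0) ->
  (forall k, (k <= m)%N -> skew w k = (-1) ^+ k * skew w 0) ->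
  \sum_(x <- twists pos m true true) crossing_form z w x =
  - (m./2)%:R * (skew z 0 * skew w 0) + (odd m)%:R * (skew z 0 * w (pos m false)).
Proof.
elim: m => [|m IH] Hz Hw; first by rewrite big_nil oppr0 !mul0r addr0.
rewrite twists_recr big_cat big_seq1 /= IH => [|k km|k km]; [|exact/Hz/leqW|exact/Hw/leqW].
have := Hz m (leqnSn m); have := Hw m (leqnSn m); have := Hz m.+1 (leqnn _).
rewrite /crossing_form exprS -signr_odd uphalf_half; case: (odd m) => /= z1 w0 z0.
  rewrite natrD; move: z1 w0 z0; rewrite !expr1.
  move: (pos m true) (pos m false) (pos m.+1 true) (pos m.+1 false) (pos 0%N false) (pos 0%N true).
  move=> a b c e u v z1 w0 z0; have -> : z b = - (z u - z v) + z a by lra.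
  have -> : w a = w b + (w u - w v) by lra.
  by ring.
rewrite add0n; move: z1 w0 z0; rewrite !expr0.
move: (pos m true) (pos m false) (pos m.+1 true) (pos m.+1 false) (pos 0%N false) (pos 0%N true).
move=> a b c e u v z1 w0 z0; have -> : z c = z e + (z u - z v) by lra.
by ring.
Qed.
End Twists.

Section Body.
Variable D : diagram.
Local Notation E := (edge D).
Variables (inner : bool -> inner_edge -> E) (lo up : E) (U V Q : bool -> E).
Implicit Types z w : E -> rat.

(** The twists influence the orientation of the two halves only through the parity [b] of their
    number. *)
Definition kan_body (b : bool) : seq (crossing E) :=
  figure_eight (inner false) lo up (U false) (V false) (Q false) (Q false) true (~~ b) (~~ b)
  ++ [seq Defs.reflect x | x <- figure_eight (inner true) lo up (U true) (V true) (Q true) (Q true) false b b].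

(** The conservation laws, with the relation imposed by the twists, solved for eight edges: after
    substitution the form becomes a polynomial identity. *)
Lemma kan_body_even z : all (conserves z) (kan_body false) ->
  z (V false) - z (V true) = z (U false) - z (U true) ->
  ([/\ z (inner false Eab) = - z (inner false Ebd) + z (U true) + z (V false) - z (V true) + z (Q false),
   z (inner false Ead) = z (inner false Ebd) + z up - z (V false),
   z (inner false Ecd1) = z (inner false Ecd2) + z up - z (V false) & z (inner true Eab) = - z (inner true Ebd) + z (U true) + z (Q true)] /\
  [/\ z (inner true Ead) = z (inner true Ebd) + z up - z (V true),
   z (inner true Ecd1) = z (inner true Ecd2) + z up - z (V true),
   z lo = z up + z (U true) - z (V true) & z (U false) = z (U true) + z (V false) - z (V true)]).
Proof.
rewrite /= /conserves /=.
move=> /and5P[/eqP h1 /eqP h2 /eqP h3 /eqP h4 /and5P[/eqP h5 /eqP h6 /eqP h7 /eqP h8 _]] h9.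
by split; split; lra.
Qed.

Lemma kan_body_odd z : all (conserves z) (kan_body true) ->
  z (V false) - z (V true) = - (z (U false) - z (U true)) ->
  ([/\ z (inner false Eab) = z (inner false Ebd) + z (U true) - z (V false) + z (V true) - z (Q false),
   z (inner false Ead) = z (inner false Ebd) + z up - z (V false),
   z (inner false Ecd1) = z (inner false Ecd2) + z up - z (V false) & z (inner true Eab) = z (inner true Ebd) + z (U true) - z (Q true)] /\
  [/\ z (inner true Ead) = z (inner true Ebd) + z up - z (V true),
   z (inner true Ecd1) = z (inner true Ecd2) + z up - z (V true),
   z lo = - z up + z (U true) + z (V true) & z (U false) = z (U true) - z (V false) + z (V true)]).
Proof.
rewrite /= /conserves /=.
move=> /and5P[/eqP h1 /eqP h2 /eqP h3 /eqP h4 /and5P[/eqP h5 /eqP h6 /eqP h7 /eqP h8 _]] h9.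
by split; split; lra.
Qed.
End Body.

Section BodyForm.
Variable D : diagram.
Local Notation E := (edge D).
Variables (inner : bool -> inner_edge -> E) (lo up : E) (U V Q : bool -> E).
Implicit Types z w : E -> rat.

Definition skew_U z : rat := z (U false) - z (U true).

(** On the solved flows only four coordinates survive, chosen so that no product of two
    x-coordinates occurs. *)
Lemma kan_body_form_even z w :
  let x1 (z : E -> rat) := z (inner true Ead) - z (inner true Ebd) in
  let x2 (z : E -> rat) := z (inner true Ead) - z lo in
  let y1 (z : E -> rat) := skew_U z in
  let y2 (z : E -> rat) := z (inner false Ebd) - z (inner true Ebd) in
  all (conserves z) (kan_body inner lo up U V Q false) ->
  all (conserves w) (kan_body inner lo up U V Q false) ->
  z (V false) - z (V true) = z (U false) - z (U true) ->
  w (V false) - w (V true) = w (U false) - w (U true) ->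
  \sum_(x <- kan_body inner lo up U V Q false) (crossing_form z w x + crossing_form w z x) =
  x1 z * (y1 w + y2 w) + x2 z * (- 3 * y1 w + 2 * y2 w)
  + x1 w * (y1 z + y2 z) + x2 w * (- 3 * y1 z + 2 * y2 z)
  + (2 * y1 z * y1 w - 3 * (y1 z * y2 w + y2 z * y1 w) + 2 * y2 z * y2 w).
Proof.
move=> x1 x2 y1 y2 hz hw dz dw.
have [[z1 z2 z3 z4] [z5 z6 z7 z8]] := kan_body_even hz dz.
have [[w1 w2 w3 w4] [w5 w6 w7 w8]] := kan_body_even hw dw.
rewrite /kan_body /= !big_cons big_nil /crossing_form /x1 /x2 /y1 /y2 /skew_U /=.
rewrite /right_out /right_in /right_mid /positive /=.
rewrite ?(z1, z2, z3, z4, z5, z6, z7, z8, w1, w2, w3, w4, w5, w6, w7, w8).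
by ring.
Qed.

(** The additional term on the left is the contribution of the unpaired twist crossing, from
    [twists_form]. *)
Lemma kan_body_form_odd z w :
  let x1 (z : E -> rat) := z (inner true Ead) - z (inner true Ebd) in
  let x2 (z : E -> rat) := z (inner true Eab) - z (inner true Ebd) in
  let y1 (z : E -> rat) := - skew_U z in
  let y2 (z : E -> rat) := z (Q false) - z (Q true) in
  all (conserves z) (kan_body inner lo up U V Q true) ->
  all (conserves w) (kan_body inner lo up U V Q true) ->
  z (V false) - z (V true) = - (z (U false) - z (U true)) ->
  w (V false) - w (V true) = - (w (U false) - w (U true)) ->
  \sum_(x <- kan_body inner lo up U V Q true) (crossing_form z w x + crossing_form w z x)
  + (skew_U z * w (V false) + skew_U w * z (V false)) =
  x1 z * (2 * y1 w - y2 w) + x2 z * (y1 w + 2 * y2 w)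
  + x1 w * (2 * y1 z - y2 z) + x2 w * (y1 z + 2 * y2 z)
  - (4 * y1 z * y1 w + (y1 z * y2 w + y2 z * y1 w) + 2 * y2 z * y2 w).
Proof.
move=> x1 x2 y1 y2 hz hw dz dw.
have [[z1 z2 z3 z4] [z5 z6 z7 z8]] := kan_body_odd hz dz.
have [[w1 w2 w3 w4] [w5 w6 w7 w8]] := kan_body_odd hw dw.
rewrite /kan_body /= !big_cons big_nil /crossing_form /x1 /x2 /y1 /y2 /skew_U /=.
rewrite /right_out /right_in /right_mid /positive /=.
rewrite ?(z1, z2, z3, z4, z5, z6, z7, z8, w1, w2, w3, w4, w5, w6, w7, w8).
by ring.
Qed.
End BodyForm.

(** * The anti-isometry for K(n+1,0) *)

Section KanSignature.
Variable n : nat.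
Local Notation D := (Kan n.+1).
Local Notation E := (edge D).
Implicit Types z w : E -> rat.

Let inner side e : E := Ein n.+1 side e.
Let lo : E := Esum n.+1 false.
Let up : E := Esum n.+1 true.
Let U side : E := Epos n.+1 0 side.
Let V side : E := Epos n.+1 n.+1 side.
Let Q side : E := Eq n.+1 side.

Lemma crossings_Kan : crossings D =
  kan_body inner lo up U V Q (odd n.+1) ++ twists (Epos n.+1) n.+1 true true.
Proof.
rewrite /kan_body -catA -[twists _ _ _ _]cats0.
transitivity (let half side s1 s2 s3 := figure_eight (inner side) lo up (U side) (V side) (Q side) (Q side) s1 s2 s3 in
  half false true (~~ odd n.+1) (~~ odd (n.+1 + 0))
  ++ [seq Defs.reflect x | x <- half true false (~~ ~~ odd n.+1) (~~ ~~ odd (n.+1 + 0))]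
  ++ twists (Epos n.+1) n.+1 true true ++ [::]); first by [].
by rewrite addn0 !negbK.
Qed.

Definition coord_x1 z := z (inner true Ead) - z (inner true Ebd).
Definition coord_x2 z := if odd n.+1 then z (inner true Eab) - z (inner true Ebd) else z (inner true Ead) - z lo.
Definition coord_y1 z := if odd n.+1 then - skew_U U z else skew_U U z.
Definition coord_y2 z := if odd n.+1 then z (Q false) - z (Q true) else z (inner false Ebd) - z (inner true Ebd).

(** The form in the coordinates above, [t] being the number of pairs of
    consecutive crossings in the twist region. *)
Definition coord_form (b : bool) (t : rat) (x1 x2 y1 y2 x1' x2' y1' y2' : rat) : rat :=
  if b then
    x1 * (2 * y1' - y2') + x2 * (y1' + 2 * y2') + x1' * (2 * y1 - y2) + x2' * (y1 + 2 * y2)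
    - (4 * y1 * y1' + (y1 * y2' + y2 * y1') + 2 * y2 * y2') - 2 * t * y1 * y1'
  else
    x1 * (y1' + y2') + x2 * (- 3 * y1' + 2 * y2') + x1' * (y1 + y2) + x2' * (- 3 * y1 + 2 * y2)
    + (2 * y1 * y1' - 3 * (y1 * y2' + y2 * y1') + 2 * y2 * y2') - 2 * t * y1 * y1'.

Lemma is_flow_Kan z : is_flow z <-> all (conserves z) (kan_body inner lo up U V Q (odd n.+1)) /\
  forall k, (k <= n.+1)%N ->
    z (Epos n.+1 k false) - z (Epos n.+1 k true) = (-1) ^+ k * (z (U false) - z (U true)).
Proof.
rewrite /is_flow crossings_Kan all_cat; split=> [/andP[-> /twists_conserves]//|[-> H]].
exact/twists_conserves.
Qed.

Lemma sym_seifert_Kan z w : is_flow z -> is_flow w ->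
  sym_seifert z w = coord_form (odd n.+1) (n.+1./2)%:R
    (coord_x1 z) (coord_x2 z) (coord_y1 z) (coord_y2 z)
    (coord_x1 w) (coord_x2 w) (coord_y1 w) (coord_y2 w).
Proof.
move=> /is_flow_Kan[hz tz] /is_flow_Kan[hw tw].
have split_sum (f : crossing E -> rat) : \sum_(x <- crossings D) f x =
    \sum_(x <- kan_body inner lo up U V Q (odd n.+1)) f x
    + \sum_(x <- twists (Epos n.+1) n.+1 true true) f x by rewrite crossings_Kan big_cat.
rewrite /sym_seifert /seifert (split_sum (crossing_form z w)) (split_sum (crossing_form w z)).
rewrite (twists_form (D := D) (pos := Epos n.+1) tz tw) (twists_form (D := D) (pos := Epos n.+1) tw tz) [LHS]addrACA -big_split.
have dz := tz n.+1 (leqnn _); have dw := tw n.+1 (leqnn _); move: dz dw hz hw.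
rewrite -[(-1) ^+ n.+1]signr_odd /coord_x1 /coord_x2 /coord_y1 /coord_y2.
case: (odd n.+1); rewrite ?expr1 ?expr0 ?mul1r ?mulN1r => dz dw hz hw.
  have H := kan_body_form_odd hz hw dz dw; rewrite /coord_form.
  rewrite -{}H /skew_U; ring.
have H := kan_body_form_even hz hw dz dw; rewrite /coord_form.
by rewrite -{}H /skew_U -[false%:R]/(0 : rat); ring.
Qed.

(** A flow with prescribed coordinates, found by solving the conservation laws with the remaining
    free edges set to 0. *)
Definition kan_flow (a1 a2 b1 b2 : rat) (e : E) : rat :=
  if odd n.+1 then
    match e with
    | inl (inl (false, Eab)) => a2 - b1 - b2
    | inl (inl (false, Ead)) => a1 - b1
    | inl (inl (false, Ecd1)) => a1 - b1
    | inl (inl (true, Eab)) => a2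
    | inl (inl (true, Ead)) => a1
    | inl (inl (true, Ecd1)) => a1
    | inl (inl _) => 0
    | inl (inr false) => a2 - a1
    | inl (inr true) => a1
    | inr (inl (k, s)) => (if nat_of_ord k == 0%N then a2 else 0) - (if s then 0 else (-1) ^+ nat_of_ord k * b1)
    | inr (inr (_, s)) => if s then 0 else b2
    end
  else
    match e with
    | inl (inl (false, Eab)) => b1 - a2 - b2
    | inl (inl (false, Ead)) => a1 + a2 - b1 + b2
    | inl (inl (false, Ebd)) => a2 + b2
    | inl (inl (false, Ecd1)) => a1 - b1
    | inl (inl (true, Eab)) => - a2
    | inl (inl (true, Ead)) => a1 + a2
    | inl (inl (true, Ebd)) => a2
    | inl (inl (true, Ecd1)) => a1
    | inl (inl _) => 0
    | inl (inr _) => a1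
    | inr (inl (k, s)) => if s then 0 else (-1) ^+ nat_of_ord k * b1
    | inr (inr _) => 0
    end.

Lemma kan_flow_is_flow a1 a2 b1 b2 : is_flow (kan_flow a1 a2 b1 b2).
Proof.
apply/is_flow_Kan; split; last first.
  move=> k kn; rewrite /kan_flow /U /Epos !inordK //=; case: (odd n); case: eqP => _; rewrite /= ?expr0; ring.
have := exprS (-1 : rat) n; rewrite -[_ ^+ n]signr_odd.
rewrite /kan_body /= /conserves /under_in /over_in /under_out /over_out /kan_flow /U /V /Epos /=.
by case: (odd n) => /= e; rewrite !inordK //= e;
  repeat match goal with |- is_true (_ && _) => apply/andP; split end; rewrite //; apply/eqP; ring.
Qed.

Lemma coord_kan_flow a1 a2 b1 b2 : let z := kan_flow a1 a2 b1 b2 in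
  [/\ coord_x1 z = a1, coord_x2 z = a2, coord_y1 z = b1 & coord_y2 z = b2].
Proof.
rewrite /coord_x1 /coord_x2 /coord_y1 /coord_y2 /kan_flow /skew_U /U /Epos !inordK //=.
by case: (odd n) => /=; split; ring.
Qed.

(** The coordinates x1, x2 span an isotropic plane dual to that of y1, y2; x is
    replaced by - x + c(y), with c such that the terms in y alone change sign. *)
Definition kan_anti z : E -> rat :=
  let t := (n.+1./2)%:R in let y1 := coord_y1 z in let y2 := coord_y2 z in
  if odd n.+1 then
    (* Let B be the pairing of x with y and S the part of the form in y alone. Then c solves c B = -
       S, and 5 is the determinant of B for both parities: its rows are (2, -1), (1, 2) here and (1,
       1), (-3, 2) in the even case. *)
    kan_flow (- coord_x1 z + (7 + 4 * t) / 5 * y1) (- coord_x2 z + (6 + 2 * t) / 5 * y1 + y2) y1 y2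
  else
    kan_flow (- coord_x1 z + (5 + 4 * t) / 5 * y1) (- coord_x2 z + (5 - 2 * t) / 5 * y1 - y2) y1 y2.

Lemma signature_Kan : signature D = 0.
Proof.
have anti_flow z : is_flow (kan_anti z) by rewrite /kan_anti; case: (odd n.+1); apply: kan_flow_is_flow.
apply: (signature_anti (tau := kan_anti)) => // z w hz hw.
rewrite !sym_seifert_Kan // /kan_anti /coord_form.
case E0 : (odd n.+1);
  do 2 (match goal with |- context [coord_x1 (kan_flow ?a ?b ?c ?d)] => have [-> -> -> ->] := coord_kan_flow a b c d end);
  by field.
Qed.
End KanSignature.

Theorem corollary4p8 (p : int) (p_gt0 : 0 < p) :
  homologically_thin (kanenobu p 0) /\
  forall i j : int,
    isomorphic (Kh (kanenobu p 0) i j) (Kh (kanenobu (- p) 0) (- i) (- j)).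
Proof.
case: p p_gt0 => [[//|n]|//] _; split; last exact: (@Kan_mirror n).
move=> i j [x x0]; rewrite (signature_Kan n) add0r sub0r.
case: (eqVneq (j - 2 * i) 1) => [|h1]; first by left.
case: (eqVneq (j - 2 * i) (-1)) => [|h2]; first by right.
case/eqP: x0; apply: (Kan_thin (n := n)) => -[] /eqP; [exact/negP | exact/negP].
Qed.
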